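(* Let $n\ge 2$, $Q\in\mathcal{S}^n_{(o)}$, $p>1$ and $q>0$ with $p\neq q$, and let $\mu$ be a discrete measure on $S^{n-1}$ that is not concentrated on any closed hemisphere. Then there exists a polytope $P\in\mathcal{K}^n_{(o)}$ such that $\widetilde{C}_{p,q}(P,Q,\cdot)=\mu$.
   Context: $S^{n-1}$ is the unit sphere of $\mathbb{R}^n$, $o$ the origin, $\mathcal{H}^{k}$ the $k$-dimensional Hausdorff measure. A discrete measure on $S^{n-1}$ is a finite positive Borel measure with finite support. $\mathcal{K}^n_{(o)}$ is the family of convex bodies (compact convex sets with non-empty interior) in $\mathbb{R}^n$ containing $o$ in their interior. A polytope is the convex hull of finitely many points, with non-empty interior. $\mathcal{S}^n_{(o)}$ is the family of compact sets $Q\subset\mathbb{R}^n$ that are star shaped with respect to $o$ and contain $o$ in their interior; their radial functions are assumed continuous. The radial function is $\varrho_S(u)=\max\{t\ge 0: tu\in S\}$, $u\in S^{n-1}$. The support function of a compact convex $K$ is $h_K(u)=\max_{x\in K}\langle x,u\rangle$, and $F(K,u)=\{x\in K:\langle x,u\rangle=h_K(u)\}$. For a Borel set $\eta\subset S^{n-1}$, $\alpha_K^*(\eta)=\{u\in S^{n-1}:\varrho_K(u)u\in F(K,v)\text{ for some }v\in\eta\}$. The $q$th dual curvature measure of $K$ with respect to $Q$ is the Borel measure on $S^{n-1}$ given by $$\widetilde{C}_q(K,Q,\eta)=\frac1n\int_{\alpha_K^*(\eta)}\varrho_K^q(u)\varrho_Q^{n-q}(u)\,d\mathcal{H}^{n-1}(u),$$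 and the $L_p$ $q$th dual curvature measure of $K\in\mathcal{K}^n_{(o)}$ with respect to $Q$ is defined by $d\widetilde{C}_{p,q}(K,Q,\cdot)=h_K^{-p}\,d\widetilde{C}_q(K,Q,\cdot)$. *)

(* Defs.v *)
From HB Require Import structures.
From mathcomp Require Import all_boot all_order all_algebra.
From mathcomp Require Import all_classical all_reals all_analysis.

Set Implicit Arguments.
Unset Strict Implicit.
Unset Printing Implicit Defensive.

Import Order.TTheory GRing.Theory Num.Theory.
Import numFieldNormedType.Exports.

Local Open Scope classical_set_scope.
Local Open Scope ring_scope.

(** ** Euclidean space

    The topology of ['rV[R]_n] is that of the library (induced by the sup norm),
    which is the Euclidean topology; metric notions use [enorm]. *)

Definition dotp (R : realType) (n : nat) (x y : 'rV[R]_n) : R :=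
  \sum_(i < n) x ord0 i * y ord0 i.

Definition enorm (R : realType) (n : nat) (x : 'rV[R]_n) : R :=
  Num.sqrt (dotp x x).

Definition sphere (R : realType) (n : nat) : set 'rV[R]_n :=
  [set u | enorm u = 1].
Arguments sphere : clear implicits.

Definition borelE (R : realType) (n : nat) :=
  g_sigma_algebraType (@open 'rV[R]_n).
Arguments borelE : clear implicits.

(** ** Hausdorff measure *)

(* Volume of the unit ball of R^k, i.e. pi^(k/2) / Gamma(k/2 + 1). *)
Fixpoint ball_vol (R : realType) (k : nat) : R :=
  match k with
  | 0 => 1
  | 1 => 2
  | k'.+2 => 2 * pi / k%:R * ball_vol R k'
  end.

Section hausdorff_measure.
Local Open Scope ereal_scope.
Context (R : realType) (n : nat).
Implicit Types A B : set 'rV[R]_n.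

(* The diameter of the empty set is -oo. *)
Definition diam A : \bar R :=
  ereal_sup [set (enorm (x.1 - x.2))%:E | x in A `*` A].

(* Normalised so that the k-dimensional Hausdorff measure on R^k is Lebesgue
   measure. *)
Definition hausdorff_gauge (k : nat) A : \bar R :=
  if A == set0 then 0 else (ball_vol R k / 2 ^+ k)%R%:E * diam A ^+ k.

Definition hausdorff_pre (k : nat) (delta : R) A : \bar R :=
  ereal_inf [set \sum_(i <oo) hausdorff_gauge k (F i) |
    F in [set F : (set 'rV[R]_n)^nat |
      (forall i, diam (F i) <= delta%:E) /\ A `<=` \bigcup_i F i]].

Definition hausdorff (k : nat) A : \bar R :=
  ereal_sup [set hausdorff_pre k delta A | delta in [set d | (0 < d)%R]].

Lemma ball_vol_ge0 k : (0 <= ball_vol R k)%R.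
Proof.
suff: (0 <= ball_vol R k)%R /\ (0 <= ball_vol R k.+1)%R by case.
elim: k => [|k [IH1 IH2]]; first by split => //=; rewrite ?ler01 ?ler0n.
split=> //=; rewrite mulr_ge0// divr_ge0 ?ler0n// mulr_ge0 ?ler0n//.
exact: pi_ge0.
Qed.

Lemma diam_ge0 A : A !=set0 -> 0 <= diam A.
Proof.
move=> [x Ax]; apply: (@le_trans _ _ (enorm (x - x))%:E).
  by rewrite lee_fin sqrtr_ge0.
by apply: ereal_sup_ubound; exists (x, x).
Qed.

Lemma hausdorff_gauge_ge0 k A : 0 <= hausdorff_gauge k A.
Proof.
rewrite /hausdorff_gauge; case: eqVneq => [//|/set0P A0].
rewrite mule_ge0 ?expe_ge0 ?diam_ge0//.
by rewrite lee_fin divr_ge0 ?ball_vol_ge0// exprn_ge0// ler0n.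
Qed.

(* [hausdorff_pre] is the library's outer measure construction applied to the
   gauge extended by +oo to the sets of diameter larger than delta, all sets
   being taken as measurable. *)
Local Notation allsets := (g_sigma_algebraType [set: set 'rV[R]_n]).

Definition gauge_ext k delta (A : set allsets) : \bar R :=
  if diam A <= delta%:E then hausdorff_gauge k A else +oo.

Lemma gauge_ext_ge0 k delta A : 0 <= gauge_ext k delta A.
Proof. by rewrite /gauge_ext; case: ifP; rewrite ?hausdorff_gauge_ge0 ?leey. Qed.

Lemma gauge_ext0 k delta : gauge_ext k delta set0 = 0.
Proof.
rewrite /gauge_ext /diam setX0 image_set0 ereal_sup0 leNye.
by rewrite /hausdorff_gauge eqxx.
Qed.

Lemma hausdorff_preE k delta :
  hausdorff_pre k delta = mu_ext (gauge_ext k delta).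
Proof.
apply/funext => A; apply/eqP; rewrite eq_le; apply/andP; split.
  apply: le_ereal_inf_tmp => _ [F [_ AF] <-].
  have [Fd|] := pselect (forall i, diam (F i) <= delta%:E).
    apply: ereal_inf_lbound; exists F; first by split.
    by apply: eq_eseriesr => i _; rewrite /gauge_ext Fd.
  move=> /existsNP[i Fi]; rewrite (@eseries_pinfty _ _ xpredT i) ?leey//.
    by move=> j _; rewrite gt_eqF// (lt_le_trans _ (gauge_ext_ge0 _ _ _)).
  by rewrite /gauge_ext; case: ifP.
apply: le_ereal_inf_tmp => _ [F [Fd AF] <-].
apply: ereal_inf_lbound; exists F.
  by split => // i; exact: sub_sigma_algebra.
by apply: eq_eseriesr => i _; rewrite /gauge_ext Fd.
Qed.

Lemma hausdorff_pre_le k delta A : (0 < delta)%R ->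
  hausdorff_pre k delta A <= hausdorff k A.
Proof. by move=> d0; apply: ereal_sup_ubound; exists delta. Qed.

Lemma hausdorff_pre_ge0 k delta A : 0 <= hausdorff_pre k delta A.
Proof. by rewrite hausdorff_preE mu_ext_ge0// => B; exact: gauge_ext_ge0. Qed.

Lemma hausdorff_ge0 k A : 0 <= hausdorff k A.
Proof.
apply: le_trans (hausdorff_pre_le k A ltr01).
exact: hausdorff_pre_ge0.
Qed.

Lemma hausdorff0 k : hausdorff k set0 = 0.
Proof.
apply/eqP; rewrite eq_le hausdorff_ge0 andbT.
by apply: ge_ereal_sup => _ [d d0 <-]; rewrite hausdorff_preE mu_ext0//;
  [exact: gauge_ext0|exact: gauge_ext_ge0].
Qed.

Lemma le_hausdorff k : {homo hausdorff k : A B / A `<=` B >-> A <= B}.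
Proof.
move=> A B AB; apply: ge_ereal_sup => _ [d d0 <-].
apply: le_trans (hausdorff_pre_le _ _ d0).
by rewrite hausdorff_preE; exact: le_mu_ext.
Qed.

Lemma hausdorff_sigma_subadditive k : sigma_subadditive (hausdorff k).
Proof.
move=> F; apply: ge_ereal_sup => _ [d d0 <-].
apply: (@le_trans _ _ (\sum_(i <oo) hausdorff_pre k d (F i))).
  by rewrite hausdorff_preE; apply: mu_ext_sigma_subadditive => B;
  exact: gauge_ext_ge0.
by apply: lee_nneseries => i *; [exact: hausdorff_pre_ge0|
  exact: hausdorff_pre_le].
Qed.

HB.instance Definition _ (k : nat) := isOuterMeasure.Build R 'rV[R]_n
  (hausdorff k) (hausdorff0 k) (hausdorff_ge0 k) (@le_hausdorff k)
  (@hausdorff_sigma_subadditive k).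

(* The complete measure on the Caratheodory sigma-algebra. *)
Definition hausdorff_measure (k : nat) :
    {measure set (caratheodory_type (hausdorff k)) -> \bar R} :=
  let H : {outer_measure set 'rV[R]_n -> \bar R} := hausdorff k in
  (H : set (caratheodory_type H) -> \bar R).

End hausdorff_measure.

Arguments hausdorff_measure : clear implicits.

(** ** Convex bodies, polytopes and star bodies *)

Section bodies.
Context (R : realType) (n : nat).
Implicit Types K Q S : set 'rV[R]_n.

Definition convex_body_o K : Prop :=
  [/\ convex_set (K : set (convex_lmodType 'rV[R]_n)), compact K & interior K 0].

Definition convex_hull (V : set 'rV[R]_n) : set 'rV[R]_n :=
  smallest (fun C : set 'rV[R]_n =>
    convex_set (C : set (convex_lmodType 'rV[R]_n))) V.

Definition polytope K : Prop :=
  (exists2 V : set 'rV[R]_n, finite_set V & K = convex_hull V) /\ interior K !=set0.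

(* For the sets considered, the suprema below are attained. *)
Definition radial S (u : 'rV[R]_n) : R := sup [set t : R | 0 <= t /\ S (t *: u)].

Definition support_fun K (u : 'rV[R]_n) : R := sup [set dotp x u | x in K].

Definition star_body_o Q : Prop :=
  [/\ compact Q,
      (forall (x : 'rV[R]_n) (t : R), Q x -> 0 <= t <= 1 -> Q (t *: x)),
      interior Q 0 &
      {within sphere R n, continuous (radial Q)}].

Definition face K (u : 'rV[R]_n) : set 'rV[R]_n :=
  [set x | K x /\ dotp x u = support_fun K u].

End bodies.

(** ** Dual curvature measures

    Borel measures on the sphere are seen as Borel measures on ['rV[R]_n] that
    vanish outside the sphere. *)

Section dual_curvature.
Local Open Scope ereal_scope.
Context (R : realType) (n : nat).
Implicit Types (K Q eta : set 'rV[R]_n).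

Definition reverse_radial_gauss_image K eta : set 'rV[R]_n :=
  [set u | sphere R n u /\
    exists2 v, (eta `&` sphere R n) v & face K v (radial K u *: u)].

(* The set integrated over need not be Borel; [hausdorff_measure] is complete. *)
Definition dual_curvature (q : R) K Q eta : \bar R :=
  (n%:R^-1)%R%:E *
  \int[hausdorff_measure R n n.-1]_(u in reverse_radial_gauss_image K eta)
    (radial K u `^ q * radial Q u `^ (n%:R - q))%R%:E.

(* [dual_curvature q K Q] is a measure for convex bodies K containing the origin
   in their interior; the library integral is defined for any set function. *)
Definition Lp_dual_curvature (p q : R) K Q (eta : set (borelE R n)) : \bar R :=
  \int[dual_curvature q K Q : set (borelE R n) -> \bar R]_(u in eta)
    (support_fun K u `^ (- p))%R%:E.

Definition topological_support (mu : set (borelE R n) -> \bar R) :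
    set 'rV[R]_n :=
  [set x | forall U : set 'rV[R]_n, open U -> U x -> 0 < mu U].

Definition concentrated_on (mu : set (borelE R n) -> \bar R)
  (A : set 'rV[R]_n) : Prop := mu (~` A) = 0.

Definition discrete_on_sphere
    (mu : {finite_measure set (borelE R n) -> \bar R}) : Prop :=
  concentrated_on mu (sphere R n) /\ finite_set (topological_support mu).

Definition closed_hemisphere (v : 'rV[R]_n) : set 'rV[R]_n :=
  [set u | sphere R n u /\ (0 <= dotp u v)%R].

End dual_curvature.

(* Main.v *)
Require Import Defs.
From HB Require Import structures.
From mathcomp Require Import all_boot all_order all_algebra.
From mathcomp Require Import all_classical all_reals all_analysis.
From mathcomp Require Import ring lra.

Set Implicit Arguments.
Unset Strict Implicit.
Unset Printing Implicit Defensive.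

Import Order.TTheory GRing.Theory Num.Theory.
Import numFieldNormedType.Exports measurable_realfun.

Local Open Scope classical_set_scope.
Local Open Scope ring_scope.

(** Write mu as a sum of atoms alpha_i at distinct unit vectors u_i ([discrete_on_sphereP]). That no
    closed hemisphere carries mu means that every v <> 0 has a positive inner product with some u_i,
    so the sets P_z = {x : <x, u_i> <= z_i} ([hpoly u z]) with z >= 0 are compact. With the weight w
    = rho_Q^(n-q), it suffices to find z > 0 such that, for each i, the integral of rho_z^q w over
    the directions leaving P_z through the interior of its i-th facet equals n alpha_i z_i^p
    ([exists_balanced]). The dual curvature measure of P_z is then the sum of the Dirac masses at
    u_i with weights alpha_i z_i^p, and since h(u_i) = z_i the factor h^(-p) leaves exactly alpha_i.

    Such a z comes from maximising Phi(z), the integral of rho_z^q w over the whole sphere, over z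
    >= 0 with sum alpha_i z_i^p = 1. Phi is monotone, homogeneous of degree q and upper
    semicontinuous ([Phi_usc]), so a maximiser exists ([exists_Phi_maximizer]). A priori some of its
    coordinates vanish, that is, the origin lies on the boundary. [maximizer_gt0] excludes this:
    raising the zero coordinates to t makes the integrand bounded below on a strip of directions of
    measure at least c t, where it was zero ([strip_lower_bound]), whereas the constraint changes
    only by order t^p with p > 1.

    At a positive maximiser, multiplying one z_i by e^s and letting s decrease to 0 bounds the
    integral over the i-th facet cone by alpha_i z_i^p Phi(z) ([strict_cone_le]). The cones fill the
    sphere up to a null set, so both sides add up to Phi(z) and every inequality is an equality
    ([strict_cone_integral]). A dilation by t multiplies the two sides by t^q and t^p; as p <> q,
    the constant Phi(z) can be turned into n.

    The measure theory rests on four facts about the Hausdorff outer measure: open sets are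
    Caratheodory measurable ([open_caratheodory_le]), the sphere has finite measure
    ([hausdorff_sphere_fin]), great subspheres are null ([hausdorff_great_sphere]), and a set whose
    projection contains a cube has positive measure ([hausdorff_gt0]). *)

(** * Euclidean geometry of row vectors *)

Section euclidean.
Context (R : realType) (n : nat).
Implicit Types (x y z u v : 'rV[R]_n) (a : R).

Lemma dotpC x y : dotp x y = dotp y x.
Proof. by apply: eq_bigr => i _; rewrite mulrC. Qed.

Lemma dotpDl x y z : dotp (x + y) z = dotp x z + dotp y z.
Proof. by rewrite -big_split; apply: eq_bigr => i _; rewrite mxE mulrDl. Qed.

Lemma dotpZl a x z : dotp (a *: x) z = a * dotp x z.
Proof. by rewrite mulr_sumr; apply: eq_bigr => i _; rewrite mxE mulrA. Qed.

Lemma dotpNl x z : dotp (- x) z = - dotp x z.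
Proof. by rewrite -scaleN1r dotpZl mulN1r. Qed.

Lemma dotpBl x y z : dotp (x - y) z = dotp x z - dotp y z.
Proof. by rewrite dotpDl dotpNl. Qed.

Lemma dotpDr x y z : dotp z (x + y) = dotp z x + dotp z y.
Proof. by rewrite !(dotpC z) dotpDl. Qed.

Lemma dotpZr a x z : dotp z (a *: x) = a * dotp z x.
Proof. by rewrite !(dotpC z) dotpZl. Qed.

Lemma dotpNr x z : dotp z (- x) = - dotp z x.
Proof. by rewrite !(dotpC z) dotpNl. Qed.

Lemma dotpBr x y z : dotp z (x - y) = dotp z x - dotp z y.
Proof. by rewrite !(dotpC z) dotpBl. Qed.

Lemma dotp0l z : dotp 0 z = 0.
Proof. by rewrite -(scale0r z) dotpZl mul0r. Qed.

Lemma dotp0r z : dotp z 0 = 0.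
Proof. by rewrite dotpC dotp0l. Qed.

Lemma dotp_suml I (r : seq I) (P : pred I) (F : I -> 'rV[R]_n) z :
  dotp (\sum_(i <- r | P i) F i) z = \sum_(i <- r | P i) dotp (F i) z.
Proof.
by apply: (big_morph (fun x => dotp x z)) => [x y|]; rewrite ?dotpDl ?dotp0l.
Qed.

Lemma dotp_ge0 x : 0 <= dotp x x.
Proof. by apply: sumr_ge0 => i _; rewrite -expr2 sqr_ge0. Qed.

Lemma dotp_eq0 x : dotp x x = 0 -> x = 0.
Proof.
move=> /eqP; rewrite psumr_eq0 => [/allP h|i _]; last by rewrite -expr2 sqr_ge0.
apply/rowP => i; rewrite mxE; apply/eqP; rewrite -sqrf_eq0 expr2.
exact: h (mem_index_enum i).
Qed.

Lemma enorm_ge0 x : 0 <= enorm x.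
Proof. exact: sqrtr_ge0. Qed.

Lemma sqr_enorm x : enorm x ^+ 2 = dotp x x.
Proof. by rewrite sqr_sqrtr// dotp_ge0. Qed.

Lemma enorm0 : enorm (0 : 'rV[R]_n) = 0.
Proof. by rewrite /enorm dotp0l sqrtr0. Qed.

Lemma enorm_eq0 x : enorm x = 0 -> x = 0.
Proof. by move=> x0; apply: dotp_eq0; rewrite -sqr_enorm x0 expr0n. Qed.

Lemma enorm_gt0 x : x != 0 -> 0 < enorm x.
Proof.
move=> x0; rewrite lt_neqAle enorm_ge0 andbT eq_sym.
by apply: contra_neq x0; exact: enorm_eq0.
Qed.

Lemma enormZ a x : enorm (a *: x) = `|a| * enorm x.
Proof.
by rewrite /enorm dotpZl dotpZr mulrA -expr2 sqrtrM ?sqr_ge0// sqrtr_sqr.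
Qed.

Lemma enormN x : enorm (- x) = enorm x.
Proof. by rewrite -scaleN1r enormZ normrN1 mul1r. Qed.

Lemma enormBC x y : enorm (x - y) = enorm (y - x).
Proof. by rewrite -enormN opprB. Qed.

Lemma cauchy_schwarz x y : dotp x y <= enorm x * enorm y.
Proof.
have [->|y0] := eqVneq y 0; first by rewrite dotp0r enorm0 mulr0.
have y1 := enorm_gt0 y0.
apply: le_trans (ler_norm _) _.
rewrite -ler_sqr ?nnegrE ?mulr_ge0 ?enorm_ge0// exprMn !sqr_enorm real_normK ?num_real//.
have := dotp_ge0 (dotp y y *: x - dotp x y *: y).
rewrite dotpBl !dotpBr !dotpZl !dotpZr (dotpC y x).
have -> : dotp y y * (dotp y y * dotp x x) - dotp y y * (dotp x y * dotp x y) -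
   (dotp x y * (dotp y y * dotp x y) - dotp x y * (dotp x y * dotp y y)) =
   dotp y y * (dotp x x * dotp y y - dotp x y ^+ 2) by ring.
by rewrite pmulr_rge0 ?subr_ge0// -sqr_enorm exprn_gt0.
Qed.

Lemma cauchy_schwarz_abs x y : `|dotp x y| <= enorm x * enorm y.
Proof.
by rewrite ler_norml cauchy_schwarz andbT lerNl -dotpNl (le_trans (cauchy_schwarz _ _))// enormN.
Qed.

Lemma enormD x y : enorm (x + y) <= enorm x + enorm y.
Proof.
rewrite -ler_sqr ?nnegrE ?addr_ge0 ?enorm_ge0// sqr_enorm.
rewrite dotpDl !dotpDr (dotpC y x) sqrrD !sqr_enorm.
by have := cauchy_schwarz x y; lra.
Qed.

Lemma enormB x y : enorm (x - y) <= enorm x + enorm y.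
Proof. by rewrite -(enormN y) enormD. Qed.

Lemma enorm_triangle y x z : enorm (x - z) <= enorm (x - y) + enorm (y - z).
Proof. by rewrite -(subrK y x) -addrA (le_trans (enormD _ _))// subrK. Qed.

Lemma ler_enormB x y : `|enorm x - enorm y| <= enorm (x - y).
Proof.
have := enormD (x - y) y; have := enormD (y - x) x.
rewrite !subrK (enormBC y x) => h1 h2.
by rewrite ler_norml; apply/andP; split; lra.
Qed.

Lemma coord_le_enorm x i : `|x ord0 i| <= enorm x.
Proof.
rewrite -ler_sqr ?nnegrE ?enorm_ge0// sqr_enorm real_normK ?num_real//.
rewrite /dotp (bigD1 i)//= -expr2 lerDl.
by apply: sumr_ge0 => j _; rewrite -expr2 sqr_ge0.
Qed.

Lemma enorm_le_coord x a : (forall i, `|x ord0 i| <= a) -> enorm x <= n%:R * a.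
Proof.
move=> xa; case: (posnP n) => [n0|n0].
  have -> : x = 0 by apply/rowP => i; move: (ltn_ord i); rewrite {2}n0.
  by rewrite enorm0 n0 mul0r.
have a0 : 0 <= a by apply: le_trans (xa (Ordinal n0)).
rewrite -ler_sqr ?nnegrE ?enorm_ge0 ?mulr_ge0// sqr_enorm exprMn.
apply: (@le_trans _ _ (\sum_(i < n) a ^+ 2)).
  apply: ler_sum => i _; rewrite -expr2 -real_normK ?num_real//.
  by rewrite ler_sqr ?nnegrE.
rewrite sumr_const card_ord -[leLHS]mulr_natl ler_wpM2r ?sqr_ge0//.
by rewrite -natrX ler_nat leq_pmull.
Qed.

(** Coordinates are bounded by the Euclidean norm, and the norm by [n] times a bound on the
    coordinates, so Euclidean balls generate the sup-norm topology. *)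
Lemma nbhs_enorm x (A : set 'rV[R]_n) :
  nbhs x A <-> exists2 r, 0 < r & forall y, enorm (y - x) < r -> A y.
Proof.
split.
- move=> /nbhs_ballP[r /= r0 rA]; exists r => // y yx; apply: rA.
  split => // i j; rewrite /ball/= !ord1.
  have := coord_le_enorm (y - x) j; rewrite !mxE distrC => /le_lt_trans; exact.
- move=> [r r0 rA]; apply/nbhs_ballP; exists (r / n.+1%:R).
    by rewrite /= divr_gt0.
  move=> y [_ xy]; apply: rA; apply: (@le_lt_trans _ _ (n%:R * (r / n.+1%:R))).
    apply: enorm_le_coord => i; rewrite !mxE distrC ltW//.
    by move: (xy ord0 i).
  by rewrite mulrCA gtr_pMr// ltr_pdivrMr// mul1r ltr_nat.
Qed.

Lemma lipschitz_continuous (f : 'rV[R]_n -> R) L :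
  (forall x y, `|f x - f y| <= L * enorm (x - y)) -> continuous f.
Proof.
move=> fL x s /= /(nbhs_ballP (f x))[e /= e0 es].
have L0 : 0 < `|L| + 1 by rewrite ltr_wpDl.
apply/nbhs_enorm; exists (e / (`|L| + 1)); first by rewrite divr_gt0.
move=> y; rewrite ltr_pdivlMr// => yx; apply: es; rewrite /ball/=.
apply: le_lt_trans (fL _ _) _; rewrite enormBC.
apply: le_lt_trans yx; rewrite mulrC ler_wpM2l ?enorm_ge0//.
by rewrite (le_trans (ler_norm L))// lerDl.
Qed.

Lemma continuous_dotp v : continuous (fun x => dotp x v).
Proof.
apply: (@lipschitz_continuous _ (enorm v)) => x y.
by rewrite -dotpBl mulrC cauchy_schwarz_abs.
Qed.

Lemma continuous_enorm : continuous (@enorm R n).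
Proof. by apply: (@lipschitz_continuous _ 1) => x y; rewrite mul1r ler_enormB. Qed.

Lemma open_enorm (A : set 'rV[R]_n) :
  open A <-> forall x, A x -> exists2 r, 0 < r & forall y, enorm (y - x) < r -> A y.
Proof.
rewrite openE; split=> h x /h; first by move=> /nbhs_enorm.
by move=> ?; apply/nbhs_enorm.
Qed.

Lemma interior_enorm (A : set 'rV[R]_n) x :
  interior A x <-> exists2 r, 0 < r & forall y, enorm (y - x) < r -> A y.
Proof. exact: nbhs_enorm. Qed.

Lemma compact_enorm (A : set 'rV[R]_n) a :
  closed A -> (forall x, A x -> enorm x <= a) -> compact A.
Proof.
move=> cA Aa; apply: bounded_closed_compact => //.
exists (Num.max 0 a); split; first exact: num_real.
move=> b ab x Ax; change (mx_norm x <= b); rewrite mx_normrE.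
have ab' : Num.max 0 a <= b by exact: ltW.
apply/bigmax_leP; split; first by rewrite (le_trans _ ab')// le_max lexx.
move=> [i j] _ /=; rewrite ord1 (le_trans (coord_le_enorm _ _))//.
by rewrite (le_trans (Aa _ Ax))// (le_trans _ ab')// le_max lexx orbT.
Qed.

Lemma compact_enorm_bounded (A : set 'rV[R]_n) :
  compact A -> exists2 a, 0 < a & forall x, A x -> enorm x <= a.
Proof.
move=> /compact_bounded[b [_ hb]].
have b0 : 0 < Num.max b 0 + 1 by rewrite ltr_pwDr// le_max lexx orbT.
exists (n.+1%:R * (Num.max b 0 + 1)); first by rewrite mulr_gt0.
move=> x Ax; apply: (@le_trans _ _ (n%:R * (Num.max b 0 + 1))).
  apply: enorm_le_coord => i.
  have bb : b < Num.max b 0 + 1 by rewrite ltr_pwDr// le_max lexx.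
  apply: le_trans (hb _ bb _ Ax); rewrite -[leRHS]/(mx_norm x) mx_normrE.
  by apply/bigmax_geP; right; exists (ord0, i).
by rewrite ler_wpM2r ?(ltW b0)// ler_nat.
Qed.

Lemma closed_dotp_le v a : closed [set x | dotp x v <= a].
Proof. by apply: (@closed_comp _ _ (fun x => dotp x v) [set t | t <= a]) => [x _|];
  [exact: continuous_dotp|exact: closed_le]. Qed.

Lemma closed_enorm_ge v a : closed [set x | a <= enorm (x - v)].
Proof.
apply: (@closed_comp _ _ (fun x => enorm (x - v)) [set t | a <= t]) => [x _|].
  apply: (@lipschitz_continuous _ 1) => y z; rewrite mul1r.
  by rewrite (le_trans (ler_enormB _ _))// opprB addrA subrK.
exact: closed_ge.
Qed.

Lemma closed_sphere : closed (sphere R n).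
Proof. by apply: (@closed_comp _ _ (@enorm R n) [set 1]) => [x _|];
  [exact: continuous_enorm|exact: closed_eq]. Qed.

Lemma compact_sphere : compact (sphere R n).
Proof. by apply: (@compact_enorm _ 1 closed_sphere) => x /= ->. Qed.

Lemma sphere_dotp u : sphere R n u -> dotp u u = 1.
Proof. by move=> /= u1; rewrite -sqr_enorm u1 expr1n. Qed.

Lemma sphere_dotp_le u v : sphere R n u -> sphere R n v -> dotp u v <= 1.
Proof. by move=> /= u1 v1; rewrite (le_trans (cauchy_schwarz _ _))// u1 v1 mulr1. Qed.

Lemma sphere_normalize x : x != 0 -> sphere R n ((enorm x)^-1 *: x).
Proof.
move=> x0; rewrite /sphere/= enormZ gtr0_norm ?invr_gt0 ?enorm_gt0//.
by rewrite mulVf// gt_eqF// enorm_gt0.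
Qed.

Lemma sphere_neq0 u : sphere R n u -> u != 0.
Proof.
move=> /= u1; apply/eqP => u0; move: u1.
by rewrite u0 /sphere/= enorm0 => /eqP; rewrite eq_sym oner_eq0.
Qed.

(* Radial projection is Lipschitz away from the origin. *)
Lemma normalize_lipschitz x y : 1 <= enorm x -> 1 <= enorm y ->
  enorm ((enorm x)^-1 *: x - (enorm y)^-1 *: y) <= 2 * enorm (x - y).
Proof.
move=> x1 y1.
have x0 : 0 < enorm x by apply: lt_le_trans x1.
have y0 : 0 < enorm y by apply: lt_le_trans y1.
(* The pivot [y / enorm x] separates the change of vector from the change of length; each
   contributes at most [enorm (x - y)]. *)
apply: (le_trans (enorm_triangle ((enorm x)^-1 *: y) _ _)).
rewrite -scalerBr -scalerBl !enormZ gtr0_norm ?invr_gt0//.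
have -> : (enorm x)^-1 - (enorm y)^-1 = (enorm x)^-1 * (enorm y)^-1 * (enorm y - enorm x).
  by field; rewrite !gt_eqF.
rewrite normrM gtr0_norm ?mulr_gt0 ?invr_gt0// mulrAC -[_ * _ * enorm y]mulrA mulVf ?gt_eqF// mulr1.
have /ler_wpM2l : 0 <= (enorm x)^-1 by rewrite invr_ge0 ltW.
move=> /(_ _ _ (ler_enormB y x)); rewrite (enormBC y x).
have : (enorm x)^-1 * enorm (x - y) <= enorm (x - y).
  by rewrite ler_piMl ?enorm_ge0// invf_le1.
lra.
Qed.

(** The kernel of the column [e^T] has dimension at least [n - 1]. With [e = 0] the lemma serves as
    a source of unit vectors. *)
Lemma exists_orthogonal (e : 'rV[R]_n) : (2 <= n)%N -> exists2 a, sphere R n a & dotp a e = 0.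
Proof.
move=> n2.
have : kermx e^T != 0.
  rewrite -mxrank_eq0 mxrank_ker -lt0n subn_gt0.
  by rewrite (leq_ltn_trans (rank_leq_col _)).
move=> /rowV0Pn[v /sub_kermxP ve v0].
exists ((enorm v)^-1 *: v); first exact: sphere_normalize.
rewrite dotpZl; suff -> : dotp v e = 0 by rewrite mulr0.
have /matrixP/(_ ord0 ord0) := ve; rewrite !mxE => <-.
by apply: eq_bigr => i _; rewrite mxE.
Qed.

End euclidean.

(** * Hausdorff measure as a metric outer measure; Lipschitz maps *)

Section hausdorff_theory.
Local Open Scope ereal_scope.
Context (R : realType).

Lemma diam_leP n (A : set 'rV[R]_n) (d : R) :
  diam A <= d%:E <-> forall x y, A x -> A y -> (enorm (x - y) <= d)%R.
Proof.
split=> [Ad x y Ax Ay|Ad].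
  have : (enorm (x - y))%:E <= diam A.
    apply: ereal_sup_ubound.
    by exists (x, y).
  by move=> /le_trans/(_ Ad); rewrite lee_fin.
by apply: ge_ereal_sup => _ [[x y] /= [Ax Ay] <-]; rewrite lee_fin Ad.
Qed.

(** The comparison is by pairs of points rather than by a map, so that it applies to the image of a
    part of [A] under a map that is Lipschitz on that part only. *)
Lemma diam_lipschitz m n (A : set 'rV[R]_m) (B : set 'rV[R]_n) (L : R) : (0 < L)%R ->
  (forall x y, B x -> B y -> exists x' y', [/\ A x', A y' &
     (enorm (x - y) <= L * enorm (x' - y'))%R]) ->
  diam B <= L%:E * diam A.
Proof.
move=> L0 h; apply: ge_ereal_sup => _ [[x y] /= [Bx By] <-].
have [x' [y' [Ax Ay xy]]] := h _ _ Bx By.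
apply: (@le_trans _ _ (L%:E * (enorm (x' - y'))%:E)); first by rewrite -EFinM lee_fin.
apply: lee_wpmul2l; first by rewrite lee_fin ltW.
by apply: ereal_sup_ubound; exists (x', y').
Qed.

Definition gauge_const (k : nat) : R := (ball_vol R k / 2 ^+ k)%R.

Lemma gauge_const_gt0 k : (0 < gauge_const k)%R.
Proof.
rewrite divr_gt0 ?exprn_gt0//.
suff: (0 < ball_vol R k)%R /\ (0 < ball_vol R k.+1)%R by case.
elim: k => [|k [IH1 IH2]]; first by split => //=.
by split=> //=; rewrite mulr_gt0// divr_gt0// mulr_gt0// pi_gt0.
Qed.

Lemma hausdorff_gaugeE n k (A : set 'rV[R]_n) : A !=set0 ->
  hausdorff_gauge k A = (gauge_const k)%:E * diam A ^+ k.
Proof. by move=> /set0P/negbTE A0; rewrite /hausdorff_gauge A0. Qed.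

Lemma hausdorff_gauge0 n k : hausdorff_gauge k (@set0 'rV[R]_n) = 0.
Proof. by rewrite /hausdorff_gauge eqxx. Qed.

Lemma lee_expe2r (x y : \bar R) k : 0 <= x -> x <= y -> x ^+ k <= y ^+ k.
Proof.
move=> x0 xy; elim: k => [|k IH]; first by rewrite !expe0.
by rewrite !expeS lee_pmul ?expe_ge0.
Qed.

Lemma hausdorff_gauge_lipschitz m n k (A : set 'rV[R]_m) (B : set 'rV[R]_n) (L : R) :
  (0 < L)%R -> (forall x y, B x -> B y -> exists x' y', [/\ A x', A y' &
     (enorm (x - y) <= L * enorm (x' - y'))%R]) ->
  hausdorff_gauge k B <= (L ^+ k)%:E * hausdorff_gauge k A.
Proof.
move=> L0 h; have [->|/set0P B0] := eqVneq B set0.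
  by rewrite hausdorff_gauge0 mule_ge0 ?hausdorff_gauge_ge0// lee_fin exprn_ge0// ltW.
have A0 : A !=set0 by case: B0 => x Bx; have [x' [_ [Ax _ _]]] := h x x Bx Bx; exists x'.
rewrite !hausdorff_gaugeE// muleCA lee_wpmul2l ?lee_fin ?(ltW (gauge_const_gt0 _))//.
apply: (@le_trans _ _ ((L%:E * diam A) ^+ k)).
  by apply: lee_expe2r; [exact: diam_ge0|exact: diam_lipschitz].
suff -> : (L%:E * diam A) ^+ k = (L ^+ k)%:E * diam A ^+ k by [].
elim: k => [|k IH]; first by rewrite !expe0 mule1.
by rewrite !expeS IH exprS EFinM muleACA.
Qed.

Lemma hausdorff_gauge_le n k (A : set 'rV[R]_n) (d : R) :
  (0 <= d)%R -> diam A <= d%:E -> hausdorff_gauge k A <= (gauge_const k * d ^+ k)%:E.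
Proof.
move=> d0 Ad; have [->|/set0P A0] := eqVneq A set0.
  by rewrite hausdorff_gauge0 lee_fin mulr_ge0 ?exprn_ge0// ltW// gauge_const_gt0.
rewrite hausdorff_gaugeE// (EFinM (gauge_const k)) EFin_expe; apply: lee_wpmul2l.
  by rewrite lee_fin ltW// gauge_const_gt0.
by apply: lee_expe2r => //; exact: diam_ge0.
Qed.

Lemma le_hausdorff_gauge n k (A B : set 'rV[R]_n) :
  A `<=` B -> hausdorff_gauge k A <= hausdorff_gauge k B.
Proof.
move=> AB; have := @hausdorff_gauge_lipschitz _ _ k B A 1 ltr01.
rewrite expr1n mul1e; apply => x y Ax Ay.
by exists x, y; split; [exact: AB|exact: AB|rewrite mul1r].
Qed.

Lemma hausdorff_pre_anti n k (d1 d2 : R) (A : set 'rV[R]_n) : (d1 <= d2)%R ->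
  hausdorff_pre k d2 A <= hausdorff_pre k d1 A.
Proof.
move=> d12; apply: le_ereal_inf_tmp => _ [F [Fd AF] <-].
apply: ereal_inf_lbound; exists F => //; split => // i.
by rewrite (le_trans (Fd i))// lee_fin.
Qed.

(** A covering set of diameter at most [d < e] cannot meet both [A] and [B], so every cover of the
    union splits into a cover of each. *)
Lemma hausdorff_pre_separated n k (d e : R) (A B : set 'rV[R]_n) : (d < e)%R ->
  (forall x y, A x -> B y -> (e <= enorm (x - y))%R) ->
  hausdorff_pre k d A + hausdorff_pre k d B <= hausdorff_pre k d (A `|` B).
Proof.
move=> de AB; apply: le_ereal_inf_tmp => _ [F [Fd ABF] <-].
(* [G C] keeps the members of the cover that meet [C] and replaces the others by the empty set,
   leaving the indexing unchanged. *)
pose G (C : set 'rV[R]_n) i := F i `&` [set _ | F i `&` C !=set0].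
have G0 C i : 0 <= hausdorff_gauge k (G C i) by exact: hausdorff_gauge_ge0.
have dG C : C `<=` A `|` B ->
    hausdorff_pre k d C <= \sum_(i <oo) hausdorff_gauge k (G C i).
  move=> CAB; apply: ereal_inf_lbound; exists (G C) => //; split.
    move=> i; apply/diam_leP => x y [Fx _] [Fy _].
    by have /diam_leP := Fd i; apply.
  by move=> x Cx; have [i _ Fx] := ABF x (CAB x Cx); exists i => //; split=> //; exists x.
apply: (le_trans (leeD (dG A (@subsetUl _ _ _)) (dG B (@subsetUr _ _ _)))).
rewrite -nneseriesD//; apply: lee_nneseries => i _.
  by rewrite adde_ge0.
have [[x [Fx Ax]]|nA] := pselect (F i `&` A !=set0).
  have -> : G B i = set0.
    rewrite -subset0 => z [_ [y [Fy By]]].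
    have := AB _ _ Ax By; rewrite leNgt => /negP; apply.
    by apply: le_lt_trans de; have /diam_leP := Fd i; apply.
  by rewrite hausdorff_gauge0 adde0 le_hausdorff_gauge// => ? [].
have -> : G A i = set0 by rewrite -subset0 => z [_ /nA].
by rewrite hausdorff_gauge0 add0e le_hausdorff_gauge// => ? [].
Qed.

Lemma hausdorff_separated n k (e : R) (A B : set 'rV[R]_n) : (0 < e)%R ->
  (forall x y, A x -> B y -> (e <= enorm (x - y))%R) ->
  hausdorff k A + hausdorff k B <= hausdorff k (A `|` B).
Proof.
move=> e0 AB.
have [->|Ufin] := eqVneq (hausdorff k (A `|` B)) +oo; first by rewrite leey.
have fin C : C `<=` A `|` B -> hausdorff k C \is a fin_num.
  move=> /(le_hausdorff k) CAB; rewrite ge0_fin_numE ?hausdorff_ge0//.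
  by apply: le_lt_trans CAB _; rewrite ltey.
have fA := fin A (@subsetUl _ _ _); have fB := fin B (@subsetUr _ _ _).
rewrite -leeBrDr//; apply: ge_ereal_sup => _ [d1 d10 <-].
have fA1 : hausdorff_pre k d1 A \is a fin_num.
  rewrite ge0_fin_numE ?hausdorff_pre_ge0//.
  by rewrite (le_lt_trans (hausdorff_pre_le _ _ d10))// -ge0_fin_numE ?hausdorff_ge0.
rewrite leeBrDr// -leeBrDl//; apply: ge_ereal_sup => _ [d2 d20 <-]; rewrite leeBrDl//.
(* A scale below [d1] and [d2], where the two premeasures only increase, and below the separation
   [e]. *)
pose d : R := Num.min (Num.min d1 d2) (e / 2)%R.
have d0 : (0 < d)%R by rewrite !lt_min/= d10 d20 divr_gt0.
apply: le_trans (hausdorff_pre_le k _ d0).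
apply: le_trans (hausdorff_pre_separated k _ AB); last first.
  by rewrite /d gt_min; apply/orP; right; lra.
by apply: leeD; apply: hausdorff_pre_anti; rewrite !ge_min lexx ?orbT.
Qed.

Section open_caratheodory.
Context (n k : nat) (U X : set 'rV[R]_n).
Hypotheses (oU : open U).
Local Notation H := (@hausdorff R n k).

(** Inner approximation of [U]: the points at distance at least [1 / (m + 1)] from its complement.
    The sets [S m] below are the parts of [X] in the successive rings. *)
Let V (m : nat) : set 'rV[R]_n :=
  [set x | forall y, (enorm (y - x) < m.+1%:R^-1)%R -> U y].

Let S m := X `&` (V m.+1 `\` V m).

Let V_nd m1 m2 : (m1 <= m2)%N -> V m1 `<=` V m2.
Proof.
move=> m12 x Vx y yx; apply: Vx; apply: lt_le_trans yx _.
by rewrite lef_pV2 ?posrE// ler_nat.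
Qed.

Let VU m : V m `<=` U.
Proof. by move=> x; apply; rewrite subrr enorm0 invr_gt0. Qed.

Let UV x : U x -> exists m, V m x.
Proof.
move/open_enorm : oU => /[apply] -[r r0 rU].
exists (Num.trunc r^-1) => y yx; apply: rU; apply: lt_trans yx _.
by rewrite invf_plt ?posrE//; exact: truncnS_gt.
Qed.

Let V_sep m x y : V m x -> ~ V m.+1 y ->
  (m.+1%:R^-1 - m.+2%:R^-1 <= enorm (x - y))%R.
Proof.
move=> Vx /existsNP[z /not_implyP[zy nUz]].
have /negP : ~ (enorm (z - x) < m.+1%:R^-1)%R by move=> /Vx.
rewrite -leNgt => zx.
have := enorm_triangle y z x; rewrite (enormBC y x) => h.
by rewrite lerBlDr (le_trans zx)// (le_trans h)// addrC lerD2l ltW.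
Qed.

Let gap_gt0 m : (0 < m.+1%:R^-1 - m.+2%:R^-1 :> R)%R.
Proof. by rewrite subr_gt0 ltf_pV2 ?posrE// ltr_nat. Qed.

Let T s N := [set x | exists2 j, (j < N)%N & S (j.*2 + s) x].

(** Rings whose indices differ by at least two are a positive distance apart, so the measures of
    rings of one parity add up inside [X]. *)
Let rings s N : (\sum_(j < N) H (S (j.*2 + s))) <= H X.
Proof.
suff : (\sum_(j < N) H (S (j.*2 + s))) <= H (T s N).
  by move=> /le_trans; apply; apply: le_hausdorff => x [j _ []].
elim: N => [|N IH]; first by rewrite big_ord0 hausdorff_ge0.
rewrite big_ord_recr/=.
have -> : T s N.+1 = T s N `|` S (N.*2 + s).
  apply/seteqP; split=> [x [j]|x [[j jN Sx]|Sx]].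
  - by rewrite ltnS leq_eqVlt => /orP[/eqP ->|jN] ?; [right|left; exists j].
  - by exists j => //; rewrite ltnS ltnW.
  - by exists N.
apply: (le_trans (leeD2r _ IH)).
case: N {IH} => [|N].
  have -> : T s 0 = set0 by rewrite -subset0 => x [].
  by rewrite hausdorff0 add0e set0U.
apply: (hausdorff_separated k (gap_gt0 (N.*2 + s).+1)) => x y [j jN [_ [Vx _]]] [_ [_ nVy]].
apply: V_sep; last by move: nVy; rewrite doubleS.
by apply: V_nd Vx; rewrite ltnS leq_add2r leq_double.
Qed.

Let rings_fin : H X < +oo -> \sum_(j <oo) H (S j) < +oo.
Proof.
move=> HX; apply: (@le_lt_trans _ _ (H X + H X)); last by rewrite lte_add_pinfty.
apply: lime_le.
  by apply: is_cvg_nneseries => j _ _; exact: hausdorff_ge0.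
apply: nearW => N.
apply: (@le_trans _ _ (\sum_(0 <= j < N.*2) H (S j))).
  rewrite [leRHS](@big_cat_nat _ _ _ N)//=; last by rewrite -addnn leq_addr.
  by rewrite leeDl// sume_ge0// => j _; exact: hausdorff_ge0.
apply: (@le_trans _ _ (\sum_(j < N) H (S (j.*2 + 0)) + \sum_(j < N) H (S (j.*2 + 1)))); last first.
  by apply: leeD; exact: rings.
rewrite le_eqVlt; apply/orP; left; apply/eqP.
elim: N => [|N IH]; first by rewrite double0 big_nil !big_ord0 adde0.
rewrite doubleS !big_nat_recr//= IH !big_ord_recr/= addn0 addn1 -!addeA; congr (_ + _).
by rewrite addeCA.
Qed.

Let cover m : X `&` U `<=` (X `&` V m) `|` \bigcup_(j in [set j | (m <= j)%N]) S j.
Proof.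
move=> x [Xx /UV Ux].
have [M /asboolP VM minM] := ex_minnP (P := fun m => `[< V m x >])
  (let: ex_intro m Vm := Ux in ex_intro _ m (asboolT Vm)).
have [Mm|mM] := leqP M m; first by left; split => //; exact: V_nd VM.
case: M => // M in VM minM mM *; right; exists M => //; split=> //; split=> //.
by move=> /asboolP /minM; rewrite ltnn.
Qed.

(** Caratheodory's criterion for metric outer measures. [X] inside [V m] is separated from [X]
    outside [U], so their measures add; what [V m] misses of [U] lies in the rings of index at least
    [m], whose total measure is a tail of a convergent series. *)
Lemma open_caratheodory_le : H (X `&` U) + H (X `&` ~` U) <= H X.
Proof.
have [->|Xfin] := eqVneq (H X) +oo; first by rewrite leey.
apply/lee_addgt0Pr => e e0.
have HX : H X < +oo by rewrite ltey.
have /fine_cvgP[tfin] := nneseries_tail_cvg (rings_fin HX) (fun j _ => hausdorff_ge0 _ _).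
move=> /cvgrPdist_lt/(_ _ e0) te; near \oo => m.
have Te : \sum_(m <= j <oo) H (S j) <= e%:E.
  have tm : \sum_(m <= j <oo) H (S j) \is a fin_num by near: m.
  rewrite -(fineK tm) lee_fin ltW//.
  apply: (@le_lt_trans _ _ `|0 - fine (\sum_(m <= j <oo) H (S j))|%R).
    by rewrite sub0r normrN ler_norm.
  by near: m.
apply: (@le_trans _ _ (H (X `&` V m) + e%:E + H (X `&` ~` U))).
  apply: leeD2r; apply: (le_trans (le_hausdorff k (cover m))).
  apply: (le_trans (outer_measureU2 _ _ _)); apply: leeD2l.
  apply: le_trans Te.
  apply: (@le_trans _ _ (\sum_(j <oo) H (if (m <= j)%N then S j else set0))).
    apply: (le_trans _ (outer_measure_sigma_subadditive H _)).
    apply: le_hausdorff => x [j /= mj Sx]; exists j => //; by rewrite mj.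
  rewrite [leRHS]eseries_cond [leRHS]eseries_mkcond.
  apply: lee_nneseries => j _; first by rewrite hausdorff_ge0.
  by rewrite /=; case: ifP => // _; rewrite hausdorff0.
rewrite addeAC leeD2r//.
apply: le_trans (le_hausdorff k (_ : (X `&` V m) `|` (X `&` ~` U) `<=` X)); last first.
  by move=> x [[]|[]].
apply: (hausdorff_separated k (gap_gt0 m)) => x y [_ Vx] [_ nUy].
by apply: V_sep => // /VU.
Unshelve. all: by end_near. Qed.

End open_caratheodory.

Lemma measurable_hausdorff_open n k (U : set 'rV[R]_n) : open U ->
  (hausdorff k : set (caratheodory_type (@hausdorff R n k)) -> _).-cara.-measurable U.
Proof.
move=> oU; apply: le_caratheodory_measurable => X.
exact: open_caratheodory_le.
Qed.

(** A cover of [A] at scale [d / L], cut down to [A] and mapped by [f], is a cover of the image at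
    scale [d]. *)
Lemma hausdorff_lipschitz m n k (f : 'rV[R]_m -> 'rV[R]_n) (A : set 'rV[R]_m) (L : R) :
  (0 < L)%R ->
  (forall x y, A x -> A y -> (enorm (f x - f y) <= L * enorm (x - y))%R) ->
  hausdorff k (f @` A) <= (L ^+ k)%:E * hausdorff k A.
Proof.
move=> L0 fL; apply: ge_ereal_sup => _ [d d0 <-].
apply: (@le_trans _ _ ((L ^+ k)%:E * hausdorff_pre k (d / L) A)); last first.
  apply: lee_wpmul2l; first by rewrite lee_fin exprn_ge0// ltW.
  by apply: hausdorff_pre_le; rewrite divr_gt0.
rewrite -lee_pdivrMl ?exprn_gt0//.
apply: le_ereal_inf_tmp => _ [F [Fd AF] <-].
rewrite lee_pdivrMl ?exprn_gt0// -nneseriesZl => [|i _]; last exact: hausdorff_gauge_ge0.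
have h i x y : (f @` (F i `&` A)) x -> (f @` (F i `&` A)) y -> exists x' y',
    [/\ F i x', F i y' & (enorm (x - y) <= L * enorm (x' - y'))%R].
  by move=> [x' [Fx Ax] <-] [y' [Fy Ay] <-]; exists x', y'; split => //; exact: fL.
apply: (@le_trans _ _ (\sum_(i <oo) hausdorff_gauge k (f @` (F i `&` A)))).
  apply: ereal_inf_lbound; exists (fun i => f @` (F i `&` A)) => //; split.
    move=> i; apply: (le_trans (diam_lipschitz L0 (h i))).
    by rewrite -lee_pdivlMl// muleC -EFinM.
  by move=> _ [x Ax <-]; have [i _ Fx] := AF x Ax; exists i => //; exists x.
apply: lee_nneseries => i _; first by rewrite hausdorff_gauge_ge0.
exact: hausdorff_gauge_lipschitz (h i).
Qed.

End hausdorff_theory.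

(** * Finite measure of the sphere, null great subspheres *)

Section insertion.
Context (R : realType) (m : nat) (i : 'I_m.+1).
Implicit Types (x : 'rV[R]_m.+1) (y : 'rV[R]_m) (s : R).

(** With [col'] this splits the space as a line times the remaining coordinates, along the
    coordinate [i]. *)
Definition insert s y : 'rV[R]_m.+1 := \row_j oapp (y ord0) s (unlift i j).

Lemma insert_at s y : insert s y ord0 i = s.
Proof. by rewrite mxE unlift_none. Qed.

Lemma insert_lift s y j : insert s y ord0 (lift i j) = y ord0 j.
Proof. by rewrite mxE liftK. Qed.

Lemma dotp_insert s s' y y' : dotp (insert s y) (insert s' y') = s * s' + dotp y y'.
Proof.
rewrite /dotp (@bigD1_ord _ _ _ _ i)//= !insert_at; congr (_ + _).
by apply: eq_bigr => j _; rewrite !insert_lift.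
Qed.

Lemma insertB s s' y y' : insert s y - insert s' y' = insert (s - s') (y - y').
Proof. by apply/rowP => j; rewrite !mxE; case: unliftP => [j' _|_] /=; rewrite ?mxE. Qed.

Lemma insertZ a s y : a *: insert s y = insert (a * s) (a *: y).
Proof. by apply/rowP => j; rewrite !mxE; case: unliftP => [j' _|_] /=; rewrite ?mxE. Qed.

Lemma insert_col' x : insert (x ord0 i) (col' i x) = x.
Proof. by apply/rowP => j; rewrite !mxE; case: unliftP => [j' ->|->] /=; rewrite ?mxE. Qed.

Lemma col'_insert s y : col' i (insert s y) = y.
Proof. by apply/rowP => j; rewrite mxE insert_lift. Qed.

Lemma enorm_insert_ge s y : enorm y <= enorm (insert s y).
Proof.
rewrite -ler_sqr ?nnegrE ?enorm_ge0// !sqr_enorm dotp_insert lerDr -expr2.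
exact: sqr_ge0.
Qed.

Lemma enorm_insert_le s y : enorm (insert s y) <= `|s| + enorm y.
Proof.
rewrite -ler_sqr ?nnegrE ?addr_ge0 ?enorm_ge0// sqr_enorm dotp_insert sqrrD.
rewrite sqr_enorm real_normK ?num_real// -expr2 lerD2r lerDl.
by rewrite mulrn_wge0// mulr_ge0 ?enorm_ge0.
Qed.

Lemma enorm_insert0 y : enorm (insert 0 y) = enorm y.
Proof.
apply/eqP; rewrite eq_le enorm_insert_ge andbT.
by rewrite (le_trans (enorm_insert_le _ _))// normr0 add0r.
Qed.

End insertion.

Definition unit_cube (R : realType) m : set 'rV[R]_m :=
  [set y | forall j, `|y ord0 j| <= 1].
Arguments unit_cube : clear implicits.

Section hausdorff_sphere.
Local Open Scope ereal_scope.
Context (R : realType).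

Lemma hausdorff_finite_subadditive n k (I : eqType) (r : seq I) (F : I -> set 'rV[R]_n) :
  hausdorff k [set x | exists2 i, i \in r & F i x] <= \sum_(i <- r) hausdorff k (F i).
Proof.
elim: r => [|a r IH].
  by rewrite big_nil (_ : [set x | _] = set0) ?hausdorff0// -subset0 => x [].
rewrite big_cons; apply: le_trans (leeD2l _ IH).
apply: le_trans (outer_measureU2 (@hausdorff R n k) _ _).
apply: le_hausdorff => x [i]; rewrite inE => /orP[/eqP ->|ir] Fx; first by left.
by right; exists i.
Qed.

Lemma hausdorff_pre_finite n k (d delta : R) (I : finType) (F : I -> set 'rV[R]_n) A :
  (0 <= d <= delta)%R -> A `<=` [set x | exists i, F i x] ->
  (forall i x y, F i x -> F i y -> (enorm (x - y) <= d)%R) ->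
  hausdorff_pre k delta A <= (#|I|%:R * (gauge_const R k * d ^+ k))%:E.
Proof.
move=> /andP[d0 dd] AF Fd.
pose G (j : nat) := [set x | exists2 i : I, enum_rank i = j :> nat & F i x].
have Gd j : diam (G j) <= d%:E.
  apply/diam_leP => x y [i ij Fx] [i' ij' Fy]; apply: Fd Fx _.
  suff -> : i = i' by [].
  by apply/enum_rank_inj/val_inj; rewrite /= ij ij'.
apply: (@le_trans _ _ (\sum_(j <oo) hausdorff_gauge k (G j))).
  apply: ereal_inf_lbound; exists G => //; split.
    by move=> j; rewrite (le_trans (Gd j))// lee_fin.
  by move=> x /AF[i Fx]; exists (enum_rank i : nat) => //; exists i.
rewrite (nneseries_split 0 #|I|) => [|j _]; last exact: hausdorff_gauge_ge0.
rewrite add0n eseries0 ?adde0; last first.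
  move=> j Ij _; rewrite (_ : G j = set0) ?hausdorff_gauge0// -subset0 => x [i ij _].
  by move: Ij; rewrite -ij leqNgt ltn_ord.
apply: (@le_trans _ _ (\sum_(0 <= j < #|I|) (gauge_const R k * d ^+ k)%:E)).
  by apply: lee_sum => j _; exact: hausdorff_gauge_le.
by rewrite sumEFin sumr_const_nat subn0 mulr_natl.
Qed.

(** The cube is cut into [(N + 1) ^ m] cells of side [2 / (N + 1)], whose diameters are at most [m]
    times the side. *)
Lemma hausdorff_pre_cube m k (N : nat) (delta : R) :
  (m%:R * (2 / N.+1%:R) <= delta)%R ->
  hausdorff_pre k delta (unit_cube R m) <=
    ((N.+1 ^ m)%:R * (gauge_const R k * (m%:R * (2 / N.+1%:R)) ^+ k))%:E.
Proof.
move=> Nd.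
pose F (f : {ffun 'I_m -> 'I_N.+1}) := [set y : 'rV[R]_m | forall j,
  ((f j)%:R <= (y ord0 j + 1) / 2 * N.+1%:R <= (f j).+1%:R)%R].
have -> : (N.+1 ^ m)%N = #|{ffun 'I_m -> 'I_N.+1}| by rewrite card_ffun !card_ord.
apply: (@hausdorff_pre_finite _ _ _ _ _ F).
- by rewrite Nd andbT mulr_ge0// divr_ge0.
- move=> y yc.
  have cell j : exists i : 'I_N.+1,
      (i%:R <= (y ord0 j + 1) / 2 * N.+1%:R <= i.+1%:R)%R.
    have := yc j; rewrite ler_norml => /andP[y1 y2].
    set t := ((_ + 1) / 2 * _)%R.
    have t0 : (0 <= t)%R by rewrite mulr_ge0// divr_ge0// -lerBlDr sub0r.
    have tN : (t <= N.+1%:R)%R.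
      by rewrite -[leRHS]mul1r ler_wpM2r// ler_pdivrMr// mul1r; lra.
    have [tlt|tge] := ltP t N.+1%:R%R.
      have tn : (Num.trunc t < N.+1)%N by rewrite truncn_lt_nat.
      exists (Ordinal tn) => /=; rewrite truncn_le t0/= ltW//.
      exact: truncnS_gt.
    (* The right endpoint belongs to the last closed cell. *)
    exists ord_max => /=; rewrite tN andbT (le_trans _ tge)//.
    by rewrite ler_nat.
  have [f fP] := choice cell.
  by exists [ffun j => f j] => j; rewrite ffunE.
- move=> f x y Fx Fy; apply: enorm_le_coord => j; rewrite !mxE.
  have /andP[x1 x2] := Fx j; have /andP[y1 y2] := Fy j.
  have N0 : (0 < N.+1%:R :> R)%R by [].
  rewrite ler_norml ler_pdivlMr// -mulNr ler_pdivrMr//.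
  move: x1 x2 y1 y2; rewrite -(natr1 (f j : nat)).
  by move: (N.+1%:R)%R ((f j)%:R)%R => b a x1 x2 y1 y2; apply/andP; split; lra.
Qed.

(** In the exponent [k = m] the powers of [N + 1] in the subdivision bound cancel, so the bound is
    uniform in the scale. *)
Lemma hausdorff_cube_fin m : hausdorff m (unit_cube R m) < +oo.
Proof.
apply: (@le_lt_trans _ _ (gauge_const R m * (m%:R * 2) ^+ m)%:E); last exact: ltry.
apply: ge_ereal_sup => _ [d d0 <-].
have Nd : (m%:R * (2 / (Num.trunc (m%:R * 2 / d)).+1%:R) <= d)%R.
  by rewrite mulrA ler_pdivrMr// [leRHS]mulrC -ler_pdivrMr// ltW// truncnS_gt.
apply: le_trans (hausdorff_pre_cube _ Nd) _.
set N := (Num.trunc _).+1; rewrite lee_fin natrX [(m%:R * (_ / _))%R]mulrA expr_div_n.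
have : (N%:R ^+ m != 0 :> R)%R by rewrite expf_neq0// pnatr_eq0.
move: (N%:R ^+ m)%R ((m%:R * 2) ^+ m)%R (gauge_const R m) => P a g P0.
by rewrite le_eqVlt; apply/orP; left; apply/eqP; field.
Qed.

(** For [k > m] the subdivision bound is of order [1 / (N + 1)]; [N] is taken large enough both for
    the scale [d] and for the error [e]. *)
Lemma hausdorff_cube_eq0 m k : (m < k)%N -> hausdorff k (unit_cube R m) = 0.
Proof.
move=> mk; apply/eqP; rewrite eq_le hausdorff_ge0 andbT.
apply: ge_ereal_sup => _ [d d0 <-]; apply/lee_addgt0Pr => e e0; rewrite add0e.
pose C : R := (gauge_const R k * (m%:R * 2) ^+ k)%R.
pose N := Num.trunc (Num.max (m%:R * 2 / d) (C / e))%R.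
have := truncnS_gt (Num.max (m%:R * 2 / d) (C / e))%R; rewrite gt_max -/N => /andP[N1 N2].
have Nd : (m%:R * (2 / N.+1%:R) <= d)%R.
  by rewrite mulrA ler_pdivrMr// [leRHS]mulrC -ler_pdivrMr// ltW.
apply: le_trans (hausdorff_pre_cube _ Nd) _; rewrite lee_fin.
have -> : ((N.+1 ^ m)%:R * (gauge_const R k * (m%:R * (2 / N.+1%:R)) ^+ k) =
    C * (N.+1%:R ^+ m / N.+1%:R ^+ k))%R.
  by rewrite /C natrX [(m%:R * (_ / _))%R]mulrA expr_div_n; ring.
apply: (@le_trans _ _ (C / N.+1%:R)%R); last first.
  by rewrite ler_pdivrMr// [leRHS]mulrC -ler_pdivrMr// ltW.
rewrite ler_wpM2l//.
  by rewrite /C mulr_ge0 ?(ltW (gauge_const_gt0 _ _))// exprn_ge0// mulr_ge0.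
rewrite ler_pdivrMr ?exprn_gt0// -(subnK mk) addnS exprS mulKf//.
by rewrite exprD ler_peMl ?exprn_ge0// exprn_ege1// ler1n.
Qed.

(** Radial projection of a cube face to the sphere. The faces together cover the sphere, since a
    coordinate of largest absolute value tells on which face a direction lies; as faces have norm at
    least 1, the projection is 2-Lipschitz. *)
Let face_map m (i : 'I_m.+1) (b : bool) (y : 'rV[R]_m) : 'rV[R]_m.+1 :=
  let x := insert i (if b then 1 else -1)%R y in ((enorm x)^-1 *: x)%R.

Let sphere_faces m : sphere R m.+1 `<=`
  [set x | exists2 ib : 'I_m.+1 * bool, ib \in enum {: 'I_m.+1 * bool} &
    (face_map ib.1 ib.2 @` unit_cube R m) x].
Proof.
move=> x x1.
have [i _ maxi] := @arg_maxP _ R _ ord0 xpredT (fun i => `|x ord0 i|%R) isT.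
have {}maxi j : (`|x ord0 j| <= `|x ord0 i|)%R by exact: maxi.
have xi0 : (0 < `|x ord0 i|)%R.
  rewrite lt_neqAle normr_ge0 andbT eq_sym; apply/eqP => xi0.
  have /eqP := sphere_neq0 x1; apply; apply/rowP => j; rewrite mxE; apply/eqP.
  by rewrite -normr_le0 -xi0 maxi.
exists (i, 0 <= x ord0 i)%R; first by rewrite mem_enum.
exists ((`|x ord0 i|)^-1 *: col' i x)%R.
  move=> j; rewrite !mxE normrM normfV normr_id ler_pdivrMl// mulr1.
  exact: maxi.
rewrite /face_map/=.
have -> : insert i (if (0 <= x ord0 i)%R then 1 else -1)%R (`|x ord0 i|^-1 *: col' i x)%R =
    (`|x ord0 i|^-1 *: x)%R.
  have /(congr1 ( *:%R `|x ord0 i|^-1)%R) := insert_col' i x; rewrite insertZ => <-.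
  congr (insert i _ _).
  case: ifPn => [x0|]; first by rewrite ger0_norm// mulVf// -normr_gt0.
  by rewrite -ltNge => x0; rewrite ltr0_norm// invrN mulNr mulVf// -normr_gt0.
rewrite enormZ (_ : enorm x = 1%R)// mulr1 normfV normr_id invrK scalerA divff ?scale1r//.
by rewrite gt_eqF.
Qed.

Let hausdorff_face m k (i : 'I_m.+1) b :
  hausdorff k (face_map i b @` unit_cube R m) <= (2 ^+ k)%:E * hausdorff k (unit_cube R m).
Proof.
apply: hausdorff_lipschitz => // x y _ _; rewrite /face_map.
set s := (if b then 1 else -1)%R.
have s1 y' : (1 <= enorm (insert i s y'))%R.
  apply: le_trans (coord_le_enorm _ i); rewrite insert_at /s.
  by case: b {s} => //; rewrite ?normrN normr1.
apply: le_trans (normalize_lipschitz (s1 x) (s1 y)) _.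
by rewrite insertB subrr enorm_insert0.
Qed.

Lemma hausdorff_sphere_fin m : hausdorff m (sphere R m.+1) < +oo.
Proof.
apply: (le_lt_trans (le_hausdorff _ (@sphere_faces m))).
apply: (le_lt_trans (hausdorff_finite_subadditive _ _ _)).
apply/lte_sum_pinfty => -[i b] _.
apply: (le_lt_trans (hausdorff_face _ _ _)).
by rewrite lte_mul_pinfty ?lee_fin// ?hausdorff_cube_fin.
Qed.

Lemma hausdorff_sphere_eq0 m k : (m < k)%N -> hausdorff k (sphere R m.+1) = 0.
Proof.
move=> mk; apply/eqP; rewrite eq_le hausdorff_ge0 andbT.
apply: (le_trans (le_hausdorff _ (@sphere_faces m))).
apply: (le_trans (hausdorff_finite_subadditive _ _ _)).
rewrite big1// => -[i b] _; apply/eqP; rewrite eq_le hausdorff_ge0 andbT.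
apply: (le_trans (hausdorff_face _ _ _)).
by rewrite hausdorff_cube_eq0// mule0.
Qed.

(** Solving [dotp x v = 0] for a coordinate with [v_i <> 0] and normalising exhibits the great
    subsphere as a Lipschitz image of the sphere one dimension lower, which is null in dimension
    [m + 1]. *)
Lemma hausdorff_great_sphere m (v : 'rV[R]_m.+2) : v != 0%R ->
  hausdorff m.+1 (sphere R m.+2 `&` [set x | dotp x v = 0%R]) = 0.
Proof.
move=> v0; apply/eqP; rewrite eq_le hausdorff_ge0 andbT.
have [i vi] : exists i, v ord0 i != 0%R.
  apply: contrapT => /forallNP h; case/eqP: v0; apply/rowP => i; rewrite mxE.
  by apply/eqP/negPn/negP => /h.
pose l (y : 'rV[R]_m.+1) : R := (- dotp y (col' i v) / v ord0 i)%R.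
pose f y := let x := insert i (l y) y in ((enorm x)^-1 *: x)%R.
pose L : R := (enorm (col' i v) / `|v ord0 i| + 1)%R.
have L0 : (0 < 2 * L)%R by rewrite mulr_gt0// ltr_wpDl// divr_ge0 ?enorm_ge0.
have lB y y' : (l y - l y')%R = l (y - y')%R by rewrite /l dotpBl; ring.
have ll y : (`|l y| <= enorm (col' i v) / `|v ord0 i| * enorm y)%R.
  rewrite /l normrM normrN normfV mulrAC ler_wpM2r ?invr_ge0//.
  by rewrite mulrC cauchy_schwarz_abs.
have fL x y : sphere R m.+1 x -> sphere R m.+1 y ->
    (enorm (f x - f y) <= 2 * L * enorm (x - y))%R.
  have ge1 z : sphere R m.+1 z -> (1 <= enorm (insert i (l z) z))%R.
    by move=> /= <-; exact: enorm_insert_ge.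
  move=> /ge1 x1 /ge1 y1; apply: (le_trans (normalize_lipschitz x1 y1)).
  rewrite -mulrA ler_wpM2l// insertB lB (le_trans (enorm_insert_le _ _ _))//.
  by rewrite mulrDl mul1r lerD2r.
apply: (@le_trans _ _ (hausdorff m.+1 (f @` sphere R m.+1))); last first.
  by rewrite (le_trans (hausdorff_lipschitz _ L0 fL))// hausdorff_sphere_eq0// mule0.
apply: le_hausdorff => x [x1 /= xv].
have xl : x ord0 i = l (col' i x).
  move: xv; rewrite -{1}(insert_col' i x) -{1}(insert_col' i v) dotp_insert => /eqP.
  by rewrite addr_eq0 => /eqP h; rewrite /l -h mulfK.
have cx0 : col' i x != 0%R.
  apply/eqP => cx; have /eqP := sphere_neq0 x1; apply.
  rewrite -(insert_col' i x) xl cx /l dotp0l oppr0 mul0r.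
  by apply/rowP => j; rewrite !mxE; case: unlift => [?|]/=; rewrite ?mxE.
exists ((enorm (col' i x))^-1 *: col' i x)%R; first exact: sphere_normalize.
rewrite /f/= /l dotpZl -mulrN -mulrA -/(l _) -insertZ -xl insert_col'.
rewrite enormZ (_ : enorm x = 1%R)// mulr1 normfV invrK scalerA.
by rewrite ger0_norm ?enorm_ge0// divff ?scale1r// gt_eqF// enorm_gt0.
Qed.

End hausdorff_sphere.

(** * Positivity of the Hausdorff measure *)

Section hausdorff_positivity.
Local Open Scope ereal_scope.
Context (R : realType).

(* Integrate the covering inequality one coordinate at a time. *)
Lemma box_cover_volume (p : nat -> nat -> R) (d : nat -> R) (l : nat -> R) (a : R) :
  (0 <= a)%R -> (forall i, 0 <= d i)%R -> forall m (c : nat -> R), (forall i, 0 <= c i)%R ->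
  (forall y : nat -> R, (forall j, (j < m)%N -> (l j <= y j <= l j + a)%R) ->
    1 <= \sum_(i <oo) (c i * \prod_(j < m) ((`|y j - p i j| <= d i)%R%:R : R))%:E) ->
  (a ^+ m)%:E <= \sum_(i <oo) (c i * (2 * d i) ^+ m)%:E.
Proof.
move=> a0 d0; elim=> [|m IH] c c0 h.
  have := h l (fun j => ltac:(done)); rewrite expr0 => /le_trans; apply.
  by apply: lee_nneseries => i _; rewrite ?big_ord0 ?expr0// lee_fin mulr1 c0.
pose I i : set (measurableTypeR R) := `[(p i m - d i)%R, (p i m + d i)%R]%classic.
pose D : set (measurableTypeR R) := `[l m, (l m + a)%R]%classic.
pose g i (t : measurableTypeR R) : \bar R := ((c i * (2 * d i) ^+ m) * \1_(I i) t)%:E.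
have g0 i t : 0 <= g i t.
  by rewrite lee_fin !mulr_ge0// exprn_ge0// mulr_ge0.
have mg i : measurable_fun D (g i).
  apply/measurable_EFinP; apply: measurable_funM => //.
  by apply: measurable_indic; exact: measurable_itv.
have mD : measurable D by exact: measurable_itv.
have muI (x y : R) : (x <= y)%R -> lebesgue_measure `[x, y]%classic = (y - x)%:E.
  move=> xy; rewrite lebesgue_measure_itv/= lte_fin; case: ltP => // yx.
  by rewrite (_ : x = y) ?subrr//; apply/eqP; rewrite eq_le xy.
have key t : D t -> (a ^+ m)%:E <= \sum_(i <oo) g i t.
  rewrite /D/= in_itv/= => tD.
  (* Freezing the last coordinate at [t] absorbs its indicator into the coefficients; this is why
     the induction is uniform in [c]. *)
  pose c' i : R := (c i * \1_(I i) t)%R.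
  apply: le_trans (IH c' _ _) _; first by move=> i; rewrite mulr_ge0.
    move=> y yl; pose y' j := if j == m then t else y j.
    apply: le_trans (h y' _) _.
      move=> j; rewrite ltnS leq_eqVlt /y' => /orP[/eqP ->|jm]; first by rewrite eqxx.
      by rewrite ltn_eqF// yl.
    rewrite le_eqVlt; apply/orP; left; apply/eqP; apply: eq_eseriesr => i _.
    congr (_%:E); rewrite big_ord_recr/= /c' -mulrA; congr (_ * _)%R; rewrite mulrC.
    congr (_ * _)%R.
      rewrite /y' eqxx indicE; congr (_ %:R); congr nat_of_bool.
      rewrite ler_distlC; apply/idP/idP; rewrite inE /I/= in_itv/= => /andP[? ?].
        by apply/andP; split; lra.
      by apply/andP; split; lra.
    by apply: eq_bigr => j _; rewrite /y' ltn_eqF.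
  apply: lee_nneseries => i _; first by rewrite lee_fin mulr_ge0 ?exprn_ge0 ?mulr_ge0.
  by rewrite /g /c' lee_fin mulrAC.
apply: (@le_trans _ _ (\int[lebesgue_measure]_(t in D) (a ^+ m)%:E)).
  rewrite integral_cst//= muI ?lerDl// addrAC subrr add0r.
  by rewrite -EFinM exprS mulrC.
apply: (@le_trans _ _ (\int[lebesgue_measure]_(t in D) (\sum_(i <oo) g i t))).
  have mS : measurable_fun D (fun t => \sum_(i <oo) g i t).
    by apply: ge0_emeasurable_sum.
  by apply: ge0_le_integral => // t _; rewrite lee_fin exprn_ge0.
rewrite integral_nneseries//; apply: lee_nneseries => i _.
  by move=> _; apply: integral_ge0 => t _; exact: g0.
have ci : (0 <= c i * (2 * d i) ^+ m)%R by rewrite mulr_ge0// exprn_ge0// mulr_ge0.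
rewrite (_ : \int[_]_(t in D) g i t = (c i * (2 * d i) ^+ m)%:E *
    \int[lebesgue_measure]_(t in D) (\1_(I i) t)%:E); last first.
  rewrite -ge0_integralZl_EFin//.
  by apply/measurable_EFinP; apply: measurable_indic; exact: measurable_itv.
rewrite integral_indic//=; last exact: measurable_itv.
have -> : (c i * (2 * d i) ^+ m.+1)%:E = (c i * (2 * d i) ^+ m)%:E * (2 * d i)%:E.
  by rewrite -EFinM exprSr mulrA.
apply: lee_wpmul2l; first by rewrite lee_fin.
apply: (@le_trans _ _ (lebesgue_measure (I i))).
  by apply: le_measure; rewrite ?inE//; [apply: measurableI => //; exact: measurable_itv|
    exact: measurable_itv].
by rewrite muI ?lee_fin; have := d0 i; lra.
Qed.

(** Forgetting the coordinate [i0], each covering set projects into a box with half-side its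
    diameter. These boxes cover a cube of side [a], so their volumes, hence the gauges, have a sum
    bounded below. *)
Lemma hausdorff_gt0 m (i0 : 'I_m.+1) (A : set 'rV[R]_m.+1) (l : 'rV[R]_m) (a : R) :
  (0 < a)%R ->
  (forall y : 'rV[R]_m, (forall j, l ord0 j <= y ord0 j <= l ord0 j + a)%R ->
     exists2 x, A x & forall j, x ord0 (lift i0 j) = y ord0 j) ->
  0 < hausdorff m A.
Proof.
move=> a0 hA.
have c0 : (0 < gauge_const R m / 2 ^+ m * a ^+ m)%R.
  apply: mulr_gt0; last exact: exprn_gt0.
  by apply: divr_gt0; [exact: gauge_const_gt0|exact: exprn_gt0].
apply: (@lt_le_trans _ _ (gauge_const R m / 2 ^+ m * a ^+ m)%:E); first by rewrite lte_fin.
apply: le_trans (hausdorff_pre_le m A ltr01).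
apply: le_ereal_inf_tmp => _ [F [Fd AF] <-].
pose d i : R := if pselect (F i !=set0) then fine (diam (F i)) else 0%R.
(* Empty covering sets get the coefficient 0: for [m = 0] the power of their diameter would be 1,
   while their gauge is 0. *)
pose c i : R := if pselect (F i !=set0) then 1%R else 0%R.
pose x0 i : 'rV[R]_m.+1 := if pselect (F i !=set0) is left h then projT1 (cid h) else 0%R.
pose pi i : 'rV[R]_m := \row_j x0 i ord0 (lift i0 j).
pose ext (y : 'rV[R]_m) (j : nat) : R := oapp (y ord0) 0%R (insub j).
have extE y (j : 'I_m) : ext y j = y ord0 j by rewrite /ext valK.
have dF i : F i !=set0 -> diam (F i) = (d i)%:E.
  rewrite /d; case: pselect => // Fi _; rewrite fineK// ge0_fin_numE ?diam_ge0//.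
  by rewrite (le_lt_trans (Fd i))// ltry.
have d0 i : (0 <= d i)%R.
  by rewrite /d; case: pselect => // Fi; rewrite fine_ge0// diam_ge0.
have ce0 i : (0 <= c i)%R by rewrite /c; case: pselect.
have := @box_cover_volume (fun i => ext (pi i)) d (ext l) a (ltW a0) d0 m c ce0.
have -> : \sum_(i <oo) hausdorff_gauge m (F i) =
    (gauge_const R m / 2 ^+ m)%:E * \sum_(i <oo) (c i * (2 * d i) ^+ m)%:E.
  rewrite -nneseriesZl => [|i _]; last by rewrite lee_fin mulr_ge0// exprn_ge0// mulr_ge0.
  apply: eq_eseriesr => i _; rewrite /c; case: pselect => [Fi|nFi] /=.
    rewrite hausdorff_gaugeE// dF// mul1r -EFin_expe -!EFinM; congr (_%:E).
    by rewrite exprMn mulrA divfK// expf_neq0.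
  rewrite (_ : F i = set0) ?hausdorff_gauge0 ?mul0r ?mule0//.
  by apply: contrapT => /eqP/set0P.
rewrite EFinM => vol; apply: lee_wpmul2l.
  by rewrite lee_fin divr_ge0 ?exprn_ge0// ltW// gauge_const_gt0.
apply: vol => y yl.
have [j|x Ax xy] := hA (\row_j y j).
  by by rewrite mxE -extE; exact: yl.
have [i _ Fx] := AF x Ax.
apply: le_trans (nneseries_lim_ge i.+1 _); last first.
  by move=> k _ _; rewrite lee_fin mulr_ge0// prodr_ge0.
rewrite big_nat_recr//=; apply: (@le_trans _ _ (c i * \prod_(j < m)
    ((`|y j - ext (pi i) j| <= d i)%R%:R : R))%:E); last first.
  by rewrite leeDr// sume_ge0// => k _; rewrite lee_fin mulr_ge0// prodr_ge0.
have Fi : F i !=set0 by exists x.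
rewrite big1 ?mulr1; first by rewrite /c; case: pselect.
move=> j _; rewrite extE mxE; suff -> : (`|y j - x0 i ord0 (lift i0 j)| <= d i)%R by [].
have Fx0 : F i (x0 i) by rewrite /x0; case: pselect => // h; exact: projT2.
have /diam_leP/(_ _ _ Fx Fx0) : diam (F i) <= (d i)%:E by rewrite dF.
apply: le_trans; apply: le_trans (coord_le_enorm _ (lift i0 j)).
by rewrite !mxE xy mxE.
Qed.

End hausdorff_positivity.

(** * Polytopes given by half-spaces *)

Section polytopes.
Context (R : realType) (n : nat).

Lemma convex_setP (A : set 'rV[R]_n) : convex_set (A : set (convex_lmodType 'rV[R]_n)) <->
  forall x y t, A x -> A y -> 0 <= t <= 1 -> A (t *: x + (1 - t) *: y).
Proof.
split=> [cA x y t Ax Ay /andP[t0 t1]|h x y t].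
  by have := cA x y (Itv01 t0 t1); rewrite !inE; apply.
by rewrite !inE => Ax Ay; apply: h => //; apply/andP; split.
Qed.

Lemma exists_pos_lb (I : finType) (z : I -> R) : (forall i, 0 < z i) ->
  exists2 r, 0 < r & forall i, r <= z i.
Proof.
move=> z0; have S0 : 0 < \sum_i (z i)^-1 + 1.
  by rewrite ltr_wpDl// sumr_ge0// => i _; rewrite invr_ge0 ltW.
(* A reciprocal of a sum of reciprocals instead of a minimum; the [+ 1] keeps it meaningful for
   empty [I]. *)
exists (\sum_i (z i)^-1 + 1)^-1 => [|i]; first by rewrite invr_gt0.
rewrite invf_ple ?posrE// (bigD1 i)//= -addrA lerDl addr_ge0// sumr_ge0// => j _.
by rewrite invr_ge0 ltW.
Qed.

Context (I : finType) (u : I -> 'rV[R]_n).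
Hypothesis u1 : forall i, sphere R n (u i).
Hypothesis u_pos : forall v, v != 0 -> exists i, 0 < dotp v (u i).

Definition hpoly (z : I -> R) : set 'rV[R]_n := [set x | forall i, dotp x (u i) <= z i].

(** Compactness of the sphere. The function [f] is twice the sum of the positive parts of the
    [dotp v (u i)]; it is continuous and positive, and a direction with all inner products below the
    chosen [c] would fall under its minimum. *)
Lemma u_pos_unif : exists2 c, 0 < c & forall v, sphere R n v -> exists i, c <= dotp v (u i).
Proof.
have [[v0 v01]|S0] := pselect (sphere R n !=set0); last first.
  by exists 1 => // v v1; case: S0; exists v.
pose f v := \sum_i (`|dotp v (u i)| + dotp v (u i)).
have f_ge0 v i : 0 <= `|dotp v (u i)| + dotp v (u i).
  by have := ler_norm (- dotp v (u i)); rewrite normrN; lra.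
have cf : continuous f.
  apply: (@lipschitz_continuous _ _ _ (\sum_(i : I) 2)) => x y.
  rewrite /f -sumrB mulr_suml (le_trans (ler_norm_sum _ _ _))//.
  apply: ler_sum => i _.
  have h : `|dotp x (u i) - dotp y (u i)| <= enorm (x - y).
    by rewrite -dotpBl (le_trans (cauchy_schwarz_abs _ _))// (u1 i) mulr1.
  rewrite opprD addrACA (le_trans (ler_normD _ _))//.
  by have := ler_dist_dist (dotp x (u i)) (dotp y (u i)); lra.
have := @compact_EVT_min _ R f (sphere R n) (ex_intro _ _ v01) (@compact_sphere R n).
move=> /(_ (continuous_subspaceT cf))[m /[!inE] m1 fm].
have fm0 : 0 < f m.
  have [i mi] := u_pos (sphere_neq0 m1).
  by rewrite /f (bigD1 i)//= ltr_wpDr ?sumr_ge0// ltr_wpDl.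
have I0 : 0 < (2 * #|I|.+1%:R : R) by rewrite mulr_gt0.
exists (f m / (2 * #|I|.+1%:R)) => [|v v1]; first by rewrite divr_gt0.
apply: contrapT => /forallNP h.
have := fm v; rewrite inE leNgt => /(_ v1)/negP; apply.
apply: (@le_lt_trans _ _ (\sum_(i : I) (f m / #|I|.+1%:R))).
  apply: ler_sum => i _; have /negP := h i; rewrite -ltNge invfM mulrCA.
  set q := f m / _ => hi; have q0 : 0 < q by rewrite divr_gt0.
  have [d0|d0] := leP 0 (dotp v (u i)).
    rewrite ger0_norm//; move: hi; rewrite -ltr_pdivrMl ?invr_gt0// invrK mulr_natl mulr2n.
    exact: ltW.
  by rewrite ltr0_norm// addNr ltW.
rewrite sumr_const -[X in X < _]mulr_natr -mulrA gtr_pMr// mulrC ltr_pdivrMr//.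
by rewrite mul1r ltr_nat.
Qed.

(** Some [u i] makes an inner product at least [c * enorm x] with [x], and this is at most [z i].
    The constant does not depend on [z]. *)
Lemma hpoly_bounded : exists2 b, 0 < b & forall z x,
  (forall i, 0 <= z i) -> hpoly z x -> enorm x <= b * \sum_i z i.
Proof.
have [c c0 hc] := u_pos_unif; exists c^-1; first by rewrite invr_gt0.
move=> z x z0 zx; have [->|x0] := eqVneq x 0.
  by rewrite enorm0; apply: mulr_ge0; [rewrite invr_ge0 ltW|exact: sumr_ge0].
have [i] := hc _ (sphere_normalize x0).
rewrite dotpZl mulrC ler_pdivlMr ?enorm_gt0// => h.
rewrite ler_pdivlMl//; apply: (le_trans h); apply: (le_trans (zx i)).
by rewrite (bigD1 i)//= lerDl sumr_ge0.
Qed.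

Lemma hpoly_compact z : (forall i, 0 <= z i) -> compact (hpoly z).
Proof.
move=> z0; have [b _ hb] := hpoly_bounded.
apply: (@compact_enorm _ _ _ (b * \sum_i z i)); last by move=> x; exact: hb.
rewrite (_ : hpoly z = \bigcap_i [set x | dotp x (u i) <= z i]); last first.
  by apply/seteqP; split=> [x zx i _|x zx i]; [exact: zx|exact: zx].
by apply: closed_bigI => i _; exact: closed_dotp_le.
Qed.

Lemma hpoly_convex z : convex_set (hpoly z : set (convex_lmodType 'rV[R]_n)).
Proof.
apply/convex_setP => x y t zx zy /andP[t0 t1] i.
rewrite dotpDl !dotpZl.
have := ler_wpM2l t0 (zx i); have t1' : 0 <= 1 - t by rewrite subr_ge0.
have := ler_wpM2l t1' (zy i); lra.
Qed.

Lemma hpoly_interior z : (forall i, 0 < z i) -> interior (hpoly z) 0.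
Proof.
move=> /exists_pos_lb[r r0 rz]; apply/interior_enorm; exists r => // y.
rewrite subr0 => yr i; apply: le_trans (cauchy_schwarz _ _) _.
by rewrite (u1 i) mulr1 (le_trans (ltW yr)).
Qed.

Lemma hpoly_convex_body z : (forall i, 0 < z i) -> convex_body_o (hpoly z).
Proof.
move=> z0; split; [exact: hpoly_convex|apply: hpoly_compact => i; exact: ltW|].
exact: hpoly_interior.
Qed.

(** A vertex is encoded as a point that is the only solution of its active constraints. *)
Let vertices z := [set x | hpoly z x /\ forall y,
  (forall i, dotp x (u i) = z i -> dotp y (u i) = z i) -> y = x].

(** A vertex is determined by its set of active constraints, and there are finitely many such
    sets. *)
Let vertices_fin z : finite_set (vertices z).
Proof.
pose act x : {set I} := [set i | dotp x (u i) == z i]%SET.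
pose f (A : {set I}) := get [set x | vertices z x /\ act x = A].
apply: (@sub_finite_set _ _ (f @` [set: {set I}])); last first.
  by apply: finite_image; exact: finite_finset.
move=> x vx; exists (act x) => //.
have [_ fx] : [set y | vertices z y /\ act y = act x] (f (act x)).
  by apply: getPex; exists x.
case: vx => _; apply => i xi.
by have /setP/(_ i) := fx; rewrite !inE xi eqxx => /eqP.
Qed.

(* Following a line inside the polytope until it meets a new facet. *)
Let ray z x d : hpoly z x -> d != 0 -> exists t, [/\ 0 <= t, hpoly z (x + t *: d) &
  exists2 i, dotp (x + t *: d) (u i) = z i & dotp d (u i) != 0].
Proof.
move=> zx d0; have [i0 di0] := u_pos d0.
pose h i := (z i - dotp x (u i)) / dotp d (u i).
have [i di imin] := @arg_minP _ R _ i0 (fun i => 0 < dotp d (u i)) h di0.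
exists (h i); split.
- by rewrite divr_ge0 ?subr_ge0 ?zx// ltW.
- move=> j; rewrite dotpDl dotpZl addrC -lerBrDr.
  have [dj|dj] := ltP 0 (dotp d (u j)).
    by rewrite -ler_pdivlMr//; exact: imin.
  apply: (@le_trans _ _ 0); last by rewrite subr_ge0 zx.
  by rewrite mulr_ge0_le0// divr_ge0 ?subr_ge0 ?zx// ltW.
- exists i; last by rewrite gt_eqF.
  by rewrite dotpDl dotpZl /h divfK ?gt_eqF// addrC subrK.
Qed.

(** Induction on the number of inactive constraints. A point that is not a vertex can move both ways
    along a line preserving its active constraints; each way it meets a new one, and the point is a
    convex combination of the two ends. *)
Let hpoly_sub_hull z : hpoly z `<=` convex_hull (vertices z).
Proof.
move=> x zx C [/convex_setP cC vC].
have [m] := ubnP #|[set i | dotp x (u i) != z i]%SET|.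
elim: m x zx => // m IH x zx; rewrite ltnS => xm.
have [vx|] := pselect (forall y, (forall i, dotp x (u i) = z i -> dotp y (u i) = z i) -> y = x).
  by apply: vC.
move=> /existsNP[y /not_implyP[yx /eqP nyx]].
pose d := y - x; have d0 : d != 0 by rewrite subr_eq0.
have dx i : dotp x (u i) = z i -> dotp d (u i) = 0.
  by move=> xi; rewrite dotpBl yx// xi subrr.
have step e t : (e = d \/ e = - d) -> hpoly z (x + t *: e) ->
    (exists2 i, dotp (x + t *: e) (u i) = z i & dotp e (u i) != 0) -> C (x + t *: e).
  move=> ed zt [i ti ei]; apply: IH => //; apply: leq_trans xm.
  have ex j : dotp x (u j) = z j -> dotp e (u j) = 0.
    by move=> xj; case: ed => ->; rewrite ?dotpNl dx ?oppr0.
  apply: proper_card; apply/properP; split.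
    apply/fintype.subsetP => j; rewrite !inE; apply: contra => /eqP xj.
    by rewrite dotpDl dotpZl ex// mulr0 addr0 xj.
  exists i; rewrite !inE ?ti ?eqxx//.
  by apply: contra ei => /eqP/ex ->.
have [t1 [t10 zt1 et1]] := ray zx d0.
have Nd0 : - d != 0 by rewrite oppr_eq0.
have [t2 [t20 zt2 et2]] := ray zx Nd0.
have C1 := step d t1 (or_introl erefl) zt1 et1.
have C2 := step (- d) t2 (or_intror erefl) zt2 et2.
have [t12|t12] := eqVneq (t1 + t2) 0.
  have t1z : t1 = 0 by lra.
  by move: C1; rewrite t1z scale0r addr0.
have t12p : 0 < t1 + t2 by rewrite lt_neqAle eq_sym t12 addr_ge0.
have -> : x = (t2 / (t1 + t2)) *: (x + t1 *: d) + (1 - t2 / (t1 + t2)) *: (x + t2 *: - d).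
  by apply/rowP => j; rewrite !mxE; field.
apply: cC => //; apply/andP; split; first by rewrite divr_ge0// ltW.
by rewrite ler_pdivrMr// mul1r lerDr.
Qed.

Lemma hpoly_polytope z : (forall i, 0 < z i) -> polytope (hpoly z).
Proof.
move=> z0; split; last by exists 0; exact: hpoly_interior.
exists (vertices z) => //; apply/seteqP; split; first exact: hpoly_sub_hull.
by apply: smallest_sub; [exact: hpoly_convex|move=> x []].
Qed.

End polytopes.

(** * Radial functions of these polytopes *)

Section radial_function.
Context (R : realType) (n : nat) (I : finType) (u : I -> 'rV[R]_n).
Hypothesis u1 : forall i, sphere R n (u i).
Hypothesis u_pos : forall v, v != 0 -> exists i, 0 < dotp v (u i).
Implicit Types (z : I -> R) (v : 'rV[R]_n) (t : R).
Local Notation rho z := (radial (hpoly u z)).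

Let rho_set z v t : [set t : R | 0 <= t /\ hpoly u z (t *: v)] t <->
  0 <= t /\ forall i, t * dotp v (u i) <= z i.
Proof. by split => -[t0 h]; split=> // i; have := h i; rewrite dotpZl. Qed.

Let rho_set0 z v : (forall i, 0 <= z i) ->
  [set t : R | 0 <= t /\ hpoly u z (t *: v)] 0.
Proof. by move=> z0; apply/rho_set; split=> // i; rewrite mul0r. Qed.

Let rho_ub z v i : (forall i, 0 <= z i) -> 0 < dotp v (u i) ->
  ubound [set t : R | 0 <= t /\ hpoly u z (t *: v)] (z i / dotp v (u i)).
Proof. by move=> z0 vi t /rho_set[_ /(_ i)]; rewrite ler_pdivlMr. Qed.

(** The admissible [t] form a closed interval starting at 0, bounded because some [dotp v (u i)] is
    positive. This equivalence replaces the supremum in what follows. *)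
Lemma radial_hpolyP z v t : (forall i, 0 <= z i) -> v != 0 -> 0 <= t ->
  t <= rho z v <-> forall i, t * dotp v (u i) <= z i.
Proof.
move=> z0 v0 t0; split=> [tr i|h].
  have [vi|vi] := ltP 0 (dotp v (u i)); last by rewrite (le_trans _ (z0 i))// mulr_ge0_le0.
  rewrite -ler_pdivlMr// (le_trans tr)//.
  by apply: ge_sup; [exists 0; exact: rho_set0|exact: rho_ub].
have [i vi] := u_pos v0.
apply: ub_le_sup; first by exists (z i / dotp v (u i)); exact: rho_ub.
by apply/rho_set.
Qed.

Lemma radial_hpoly_ge0 z v : (forall i, 0 <= z i) -> v != 0 -> 0 <= rho z v.
Proof. by move=> z0 v0; apply/radial_hpolyP => // i; rewrite mul0r. Qed.

Lemma radial_hpoly_le z v i : (forall i, 0 <= z i) -> v != 0 ->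
  rho z v * dotp v (u i) <= z i.
Proof.
move=> z0 v0.
by have /(radial_hpolyP z0 v0 (radial_hpoly_ge0 z0 v0)) := lexx (rho z v).
Qed.

Lemma le_radial_hpoly z z' v : (forall i, 0 <= z i) -> (forall i, z i <= z' i) -> v != 0 ->
  rho z v <= rho z' v.
Proof.
move=> z0 zz' v0; apply/radial_hpolyP => //.
- by move=> i; rewrite (le_trans (z0 i)).
- exact: radial_hpoly_ge0.
- by move=> i; rewrite (le_trans (radial_hpoly_le i z0 v0)).
Qed.

Lemma radial_hpoly_scale z v (c : R) : (forall i, 0 <= z i) -> v != 0 -> 0 < c ->
  rho (fun i => c * z i) v = c * rho z v.
Proof.
move=> z0 v0 c0; have cz0 i : 0 <= c * z i by rewrite mulr_ge0// ltW.
apply/eqP; rewrite eq_le; apply/andP; split.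
  rewrite mulrC -ler_pdivrMr//; apply/radial_hpolyP => //.
    by rewrite divr_ge0 ?radial_hpoly_ge0// ltW.
  by move=> i; rewrite mulrAC ler_pdivrMr// [leRHS]mulrC radial_hpoly_le.
apply/radial_hpolyP => //; first by rewrite mulr_ge0 ?radial_hpoly_ge0// ltW.
by move=> i; rewrite -mulrA ler_wpM2l ?radial_hpoly_le// ltW.
Qed.

(** Otherwise all constraints have a common slack [e], and as [dotp v (u i) <= 1] the radius could
    be increased by [e]. *)
Lemma radial_hpoly_tight z v : (forall i, 0 <= z i) -> sphere R n v ->
  exists i, rho z v * dotp v (u i) = z i.
Proof.
move=> z0 v1; have v0 := sphere_neq0 v1; apply: contrapT => /forallNP h.
have gap i : 0 < z i - rho z v * dotp v (u i).
  by rewrite subr_gt0 lt_neqAle radial_hpoly_le// andbT; apply/eqP; exact: h.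
have [e e0 he] := exists_pos_lb gap.
have : rho z v + e <= rho z v.
  apply/radial_hpolyP => //; first by rewrite addr_ge0 ?radial_hpoly_ge0// ltW.
  move=> i; rewrite mulrDl -lerBrDl (le_trans _ (he i))//.
  by rewrite ler_piMr ?(ltW e0)// sphere_dotp_le.
by rewrite gerDl leNgt e0.
Qed.

Lemma radial_hpoly_gt0 z v : (forall i, 0 < z i) -> sphere R n v -> 0 < rho z v.
Proof.
move=> z0 v1; have v0 := sphere_neq0 v1; have [r r0 rz] := exists_pos_lb z0.
apply: (lt_le_trans r0); apply/radial_hpolyP => //; first by move=> i; exact: ltW.
  exact: ltW.
move=> i; rewrite (le_trans _ (rz i))// ler_piMr ?(ltW r0)// sphere_dotp_le//.
Qed.

Lemma radial_hpoly_bounded : exists2 b, 0 < b & forall z v, (forall i, 0 <= z i) ->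
  sphere R n v -> rho z v <= b * \sum_i z i.
Proof.
have [b b0 hb] := hpoly_bounded u1 u_pos; exists b => // z v z0 v1.
have v0 := sphere_neq0 v1.
have := hb z (rho z v *: v) z0; rewrite enormZ (_ : enorm v = 1)// mulr1.
rewrite ger0_norm ?radial_hpoly_ge0//; apply => i.
by rewrite dotpZl radial_hpoly_le.
Qed.

(** Superlevel sets are cut out of the sphere by closed half-spaces. This gives measurability even
    when some [z i] vanishes and the radial function may jump. *)
Lemma closed_radial_hpoly_ge z t : (forall i, 0 <= z i) -> 0 <= t ->
  closed (sphere R n `&` [set v | t <= rho z v]).
Proof.
move=> z0 t0.
rewrite (_ : _ `&` _ = sphere R n `&` \bigcap_i [set v | dotp v (t *: u i) <= z i]).
  apply: closedI; first exact: closed_sphere.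
  by apply: closed_bigI => i _; exact: closed_dotp_le.
apply/seteqP; split=> v [v1 h]; split => //; have v0 := sphere_neq0 v1.
  by move=> i _ /=; rewrite dotpZr; have /radial_hpolyP := h; apply.
by apply/radial_hpolyP => // i; rewrite -dotpZr; exact: h.
Qed.

End radial_function.

(** * Discrete measures as sums of Dirac masses *)

Section discrete_measures.
Local Open Scope ereal_scope.
Context (R : realType) (n : nat) (mu : {finite_measure set (borelE R n) -> \bar R}).
Local Notation S := (topological_support mu).

Lemma borelE_open (U : set 'rV[R]_n) : open U -> measurable (U : set (borelE R n)).
Proof. by move=> oU; exact: sub_sigma_algebra. Qed.

Lemma borelE_closed (C : set 'rV[R]_n) : closed C -> measurable (C : set (borelE R n)).
Proof.
by move=> cC; rewrite -(setCK C); apply: measurableC; apply: borelE_open; exact: closed_openC.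
Qed.

Lemma borelE_set1 (x : 'rV[R]_n) : measurable ([set x] : set (borelE R n)).
Proof. by apply: borelE_closed; apply: accessible_closed_set1; apply: hausdorff_accessible; exact: norm_hausdorff. Qed.

Let negligible_seq (I : eqType) (r : seq I) (F : I -> set (borelE R n)) :
  (forall i, i \in r -> mu.-negligible (F i)) ->
  mu.-negligible [set x | exists2 i, i \in r & F i x].
Proof.
elim: r => [|a r IH] h.
  by rewrite (_ : [set x | _] = set0); [exact: negligible_set0|rewrite -subset0 => x []].
rewrite (_ : [set x | _] = F a `|` [set x | exists2 i, i \in r & F i x]).
  apply: negligibleU; first by apply: h; rewrite mem_head.
  by apply: IH => i ir; apply: h; rewrite inE ir orbT.
apply/seteqP; split=> [x [i]|x [Fx|[i ir Fx]]].
- by rewrite inE => /orP[/eqP ->|ir] Fx; [left|right; exists i].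
- by exists a => //; rewrite mem_head.
- by exists i => //; rewrite inE ir orbT.
Qed.

(** Each point off the support has an open null neighbourhood; finitely many of them cover [K]. *)
Let null_compact (K : set 'rV[R]_n) : compact K -> K `<=` ~` S ->
  mu.-negligible (K : set (borelE R n)).
Proof.
move=> cK KS.
pose P x := [set U : set 'rV[R]_n | [/\ open U, U x & mu U = 0]].
have PS x : K x -> P x (get (P x)).
  move=> /KS /existsNP[U /not_implyP[oU /not_implyP[Ux /negP]]].
  rewrite -leNgt => U0; apply: getPex; exists U; split => //.
  by apply/eqP; rewrite eq_le U0 measure_ge0.
have := cK; rewrite compact_cover => /(_ _ K (fun x => get (P x))).
move=> [x Kx|x Kx|D DK KD]; first by have [] := PS x Kx.
  by exists x => //; have [] := PS x Kx.
have : mu.-negligible [set x : borelE R n | exists2 i, i \in finmap.enum_fset D & get (P i) x].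
  apply: negligible_seq => i iD; have /PS[oU _ U0] : K i by move: (DK i iD); rewrite inE.
  by exists (get (P i)); split => //; exact: borelE_open.
by apply: negligibleS => x /KD[i iD Px]; exists i.
Qed.

Context (s : seq 'rV[R]_n).
Hypothesis Ss : S = [set` s].

(** The complement of a finite support is a countable union of compact sets: bounded parts at
    distance at least [1 / (m + 1)] from the support. *)
Let off_support : mu.-negligible (~` S : set (borelE R n)).
Proof.
pose K m := [set x : 'rV[R]_n | (enorm x <= m%:R)%R] `&`
  \bigcap_(s in S) [set x : 'rV[R]_n | (m.+1%:R^-1 <= enorm (x - s))%R].
have cK m : compact (K m).
  apply: (@compact_enorm _ _ _ m%:R); last by move=> x [].
  apply: closedI.
    apply: (@closed_comp _ _ (@enorm R n) [set t | t <= m%:R]%R) => [x _|].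
      exact: continuous_enorm.
    exact: closed_le.
  apply: closed_bigI => y _.
  exact: closed_enorm_ge.
have : mu.-negligible (\bigcup_m (K m : set (borelE R n))).
  apply: negligible_bigcup => m; apply: null_compact => // x [_ h] Sx.
  have := h x Sx; rewrite /= subrr enorm0 leNgt => /negP; apply.
  by rewrite invr_gt0.
apply: negligibleS => x nSx.
have d0 (i : 'I_(size s)) : (0 < enorm (x - s`_i))%R.
  apply: enorm_gt0; rewrite subr_eq0; apply/eqP => xs; apply: nSx; rewrite Ss xs.
  exact: mem_nth.
have [r r0 hr] := exists_pos_lb d0.
pose M := Num.trunc (Num.max (enorm x) r^-1)%R.
have := truncnS_gt (Num.max (enorm x) r^-1)%R; rewrite gt_max -/M => /andP[M1 M2].
exists M.+1 => //; split; first exact: ltW.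
move=> y; rewrite Ss /= => ys; rewrite -(nth_index 0%R ys).
have ys' : (index y s < size s)%N by rewrite index_mem.
apply: le_trans (hr (Ordinal ys')).
by rewrite invf_ple ?posrE// (le_trans (ltW M2))// ler_nat leqnSn.
Qed.

Let seq_decomposition (r : seq 'rV[R]_n) (eta : set (borelE R n)) : uniq r -> measurable eta ->
  measurable (eta `&` [set` r]) /\
  mu (eta `&` [set` r]) = \sum_(x <- r) mu [set x] * \d_(x : borelE R n) eta.
Proof.
move=> + me; elim: r => [_|a r IH /= /andP[ar /IH[mr IHr]]].
  rewrite (_ : _ `&` _ = set0); last by rewrite -subset0 => x [_].
  by rewrite big_nil measure0; split => //; exact: measurable0.
have ma : measurable (eta `&` [set a]) by apply: measurableI => //; exact: borelE_set1.
have E : eta `&` [set` a :: r] = (eta `&` [set a]) `|` (eta `&` [set` r]).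
  apply/seteqP; split=> x.
    case=> ex; rewrite /mkset inE => /orP[/eqP xa|xr].
      by left; split=> //; rewrite /= xa.
    by right; split.
  case=> -[ex xr]; split=> //; rewrite /mkset/= inE; first by rewrite xr eqxx.
  by apply/orP; right.
rewrite E; split; first exact: measurableU.
rewrite big_cons -IHr measureU//; last first.
  by rewrite -subset0 => x [[_ ->] [_ /=]]; rewrite (negbTE ar).
congr (_ + _); rewrite diracE; have [ea|nea] := boolP (a \in eta).
  rewrite mule1; congr (mu _); apply/seteqP; split=> [x [_ ->]//|x ->].
  by split => //; rewrite inE in ea.
rewrite mule0 (_ : _ `&` _ = set0) ?measure0// -subset0 => x [ex xa].
by move: nea; rewrite notin_setE; apply; rewrite -xa.
Qed.

Hypothesis us : uniq s.

Lemma discrete_decomposition (eta : set (borelE R n)) : measurable eta ->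
  mu eta = \sum_(x <- s) mu [set x] * \d_(x : borelE R n) eta.
Proof.
move=> me; have [mI <-] := seq_decomposition us me.
have mS : measurable ([set` s] : set (borelE R n)).
  apply: borelE_closed; have /accessible_finite_set_closed : accessible_space 'rV[R]_n.
    by apply: hausdorff_accessible; exact: norm_hausdorff.
  by apply; exact: finite_seq.
rewrite (measureDI mu me mS) [X in X + _](_ : _ = 0) ?add0e//.
apply: measure_negligible; first exact: measurableD.
by apply: negligibleS off_support; rewrite Ss => x [].
Qed.

(** Removing the other atoms leaves an open neighbourhood of [x], of positive measure, in which [x]
    is the only atom. *)
Lemma discrete_atom_gt0 x : x \in s -> 0 < mu [set x].
Proof.
move=> xs; pose U := ~` [set` [seq y <- s | y != x]].
have oU : open U.
  apply: closed_openC.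
  have /accessible_finite_set_closed : accessible_space 'rV[R]_n.
    by apply: hausdorff_accessible; exact: norm_hausdorff.
  by apply; exact: finite_seq.
have Ux : U x by rewrite /U/= mem_filter eqxx.
have Sx : S x by rewrite Ss.
have := Sx U oU Ux; rewrite discrete_decomposition; last exact: borelE_open.
rewrite (bigD1_seq x)//= diracE mem_set// mule1 big_seq_cond big1 ?adde0//.
move=> y /andP[ys yx]; rewrite diracE memNset ?mule0//.
by move=> h; apply: h; rewrite /mkset/= mem_filter yx ys.
Qed.

Lemma discrete_atom_sphere x : concentrated_on mu (sphere R n) -> x \in s -> sphere R n x.
Proof.
move=> mu_sphere xs; have Sx : S x by rewrite Ss.
apply: contrapT => nx.
have := Sx _ (closed_openC (@closed_sphere R n)) nx.
by rewrite (_ : mu _ = 0) ?ltxx.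
Qed.

End discrete_measures.

(** If no [u i] had a positive inner product with [v], all atoms would lie in the closed hemisphere
    around [- v], which would carry the measure. *)
Lemma discrete_on_sphereP (R : realType) n (mu : {finite_measure set (borelE R n) -> \bar R}) :
  discrete_on_sphere mu ->
  (forall v, sphere R n v -> ~ concentrated_on mu (closed_hemisphere v)) ->
  exists k (u : 'I_k -> 'rV[R]_n) (alpha : 'I_k -> R),
  [/\ injective u, forall i, sphere R n (u i), forall i, 0 < alpha i,
    forall v, v != 0 -> exists i, 0 < dotp v (u i) &
    forall eta : set (borelE R n), measurable eta ->
      mu eta = (\sum_(i < k) (alpha i)%:E * \d_(u i : borelE R n) eta)%E].
Proof.
move=> [mu_sphere /finite_seqP[s0 Ss0]] hemi.
pose s := undup s0.
have us : uniq s by exact: undup_uniq.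
have Ss : topological_support mu = [set` s].
  by rewrite Ss0; apply/seteqP; split=> x /=; rewrite mem_undup.
pose u (i : 'I_(size s)) : 'rV[R]_n := s`_i.
have ui i : u i \in s by exact: mem_nth.
have fin x : mu [set x] \is a fin_num by apply: fin_num_measure; exact: borelE_set1.
have dec (eta : set (borelE R n)) : measurable eta ->
    mu eta = (\sum_(i < size s) (fine (mu [set u i]))%:E * \d_(u i : borelE R n) eta)%E.
  move=> me; rewrite (discrete_decomposition Ss us me) (big_nth 0) big_mkord.
  by apply: eq_bigr => i _; rewrite fineK.
exists (size s), u, (fun i => fine (mu [set u i])); split => //.
- by move=> i j /eqP; rewrite /u nth_uniq// => /eqP/val_inj.
- by move=> i; exact: (discrete_atom_sphere Ss).
- move=> i; apply: fine_gt0; rewrite (discrete_atom_gt0 Ss)//=.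
  by rewrite ltey_eq fin.
- move=> v v0; apply: contrapT => /forallNP h.
  have Nv0 : - v != 0 by rewrite oppr_eq0.
  apply: (hemi _ (sphere_normalize Nv0)); rewrite /concentrated_on dec; last first.
    apply: measurableC; apply: borelE_closed.
    rewrite (_ : closed_hemisphere _ = sphere R n `&`
      [set x | dotp x (- ((enorm (- v))^-1 *: - v)) <= 0]).
      by apply: closedI; [exact: closed_sphere|exact: closed_dotp_le].
    by apply/seteqP; split=> x [x1 /=] hx; split=> //=; move: hx; rewrite dotpNr oppr_le0.
  rewrite big1// => i _; rewrite diracE memNset ?mule0// => -[]; split.
    exact: (discrete_atom_sphere Ss).
  rewrite dotpZr mulr_ge0 ?invr_ge0 ?enorm_ge0// dotpNr oppr_ge0 leNgt dotpC.
  by apply/negP; exact: h.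
Qed.

(** * Measure of a strip along the boundary of a cone *)

Section strips.
Local Open Scope ereal_scope.
Context (R : realType) (m : nat).
Local Notation n := m.+2.
Local Notation k := m.+1.

Lemma exists_real_lb (x : \bar R) : 0 < x -> exists2 r : R, (0 < r)%R & r%:E <= x.
Proof.
by case: x => [r r0|_|//]; [exists r; rewrite -?lte_fin|exists 1%R; rewrite ?leey].
Qed.

Lemma hausdorff_translate (A : set 'rV[R]_n) (w : 'rV[R]_n) :
  hausdorff k [set (x + w)%R | x in A] <= hausdorff k A.
Proof.
have := @hausdorff_lipschitz R n n k (fun x => x + w)%R A 1 ltr01.
by rewrite expr1n mul1e; apply => x y _ _; rewrite mul1r opprD addrACA subrr addr0.
Qed.

(** The hyperplane is a graph over a coordinate [i] with [a_i <> 0]. The graph map is [L]-Lipschitz,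
    so the disk projects onto a set containing a cube of side [r / (L * k)]. *)
Lemma hausdorff_affine_disk_gt0 (a x0 : 'rV[R]_n) (r : R) : a != 0%R -> (0 < r)%R ->
  dotp x0 a = 1%R ->
  0 < hausdorff k [set x | dotp x a = 1%R /\ (enorm (x - x0) <= r)%R].
Proof.
move=> a0 r0 x0a.
have [i ai] : exists i, a ord0 i != 0%R.
  apply: contrapT => /forallNP h; case/eqP: a0; apply/rowP => i; rewrite mxE.
  by apply/eqP/negPn/negP => /h.
pose a' := col' i a; pose y0 := col' i x0.
pose f (y : 'rV[R]_k) := insert i ((1 - dotp y a') / a ord0 i)%R y.
have fa y : dotp (f y) a = 1%R.
  by rewrite -{1}(insert_col' i a) dotp_insert divfK// subrK.
have x0E : x0 = f y0.
  rewrite /f -{1}(insert_col' i x0); congr insert.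
  apply: (mulIf ai); rewrite divfK//; apply/eqP; rewrite eq_sym subr_eq -x0a.
  by rewrite -{1}(insert_col' i x0) -{1}(insert_col' i a) dotp_insert.
pose L : R := (enorm a' / `|a ord0 i| + 1)%R.
have L0 : (0 < L)%R by rewrite ltr_wpDl// divr_ge0 ?enorm_ge0.
have fL y : (enorm (f y - x0) <= L * enorm (y - y0))%R.
  rewrite [in X in (X <= _)%R]x0E /f insertB (le_trans (enorm_insert_le _ _ _))//.
  rewrite /L [leRHS]mulrDl mul1r lerD2r -mulrBl.
  have -> : (1 - dotp y a' - (1 - dotp y0 a') = dotp (y0 - y) a')%R by rewrite dotpBl; ring.
  rewrite normrM normfV mulrAC ler_wpM2r ?invr_ge0//.
  by rewrite (enormBC y) mulrC cauchy_schwarz_abs.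
have k0 : (0 < k%:R :> R)%R by [].
apply: (@hausdorff_gt0 R k i _ y0 (r / (L * k%:R))); first by rewrite divr_gt0// mulr_gt0.
move=> y yb; exists (f y); last by move=> j; rewrite insert_lift.
split=> //; apply: (le_trans (fL y)).
rewrite -ler_pdivlMl//.
apply: (@le_trans _ _ (k%:R * (r / (L * k%:R)))%R).
  apply: enorm_le_coord => j; rewrite mxE [X in (_ + X)%R]mxE; have /andP[y1 y2] := yb j.
  by rewrite ger0_norm ?subr_ge0// lerBlDl.
by rewrite le_eqVlt; apply/orP; left; apply/eqP; field; rewrite !gt_eqF.
Qed.

(* A closed convex cone with interior point [e] is exited through a strip whose measure is at
   least proportional to its width: in the chart [dotp x a = 1], translations along [e] carry
   about [1 / t] copies of the strip over a fixed disk lying outside the cone. *)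
Lemma strip_lower_bound (I : finType) (u : I -> 'rV[R]_n) (J : pred I) (e : 'rV[R]_n) (j0 : I) :
  (forall i, sphere R n (u i)) -> J j0 -> (forall j, J j -> dotp e (u j) < 0)%R ->
  (enorm e <= 1)%R ->
  exists2 c : R, (0 < c)%R & forall t : R, (0 < t <= 1)%R ->
    (c * t)%:E <= hausdorff k (sphere R n `&`
      [set v | (exists2 j, J j & 0 < dotp v (u j)) /\ forall j, J j -> dotp v (u j) <= t])%R.
Proof.
move=> u1 Jj0 eJ e1.
have [a a1 ae] := @exists_orthogonal R n e isT.
have a0 := sphere_neq0 a1.
pose eta0 := (- dotp e (u j0))%R.
have eta0_gt0 : (0 < eta0)%R by rewrite oppr_gt0 eJ.
(* A point of the chart well outside the cone: [dotp a (u j0) >= -1], and the second term adds 2. *)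
pose x0 := (a - (2 / eta0) *: e)%R.
have x0a : dotp x0 a = 1%R.
  by rewrite dotpBl dotpZl (dotpC e) ae mulr0 subr0 sphere_dotp.
have x0u : (1 <= dotp x0 (u j0))%R.
  rewrite dotpBl dotpZl -mulrN -/eta0 divfK ?gt_eqF//.
  have := cauchy_schwarz_abs a (u j0); rewrite (a1 : enorm a = 1)%R (u1 j0 : enorm _ = 1)%R mulr1.
  rewrite ler_norml => /andP[h _]; lra.
pose V0 := [set x | dotp x a = 1%R /\ (enorm (x - x0) <= 1 / 2)%R].
have V0_gt0 : 0 < hausdorff k V0.
  by apply: hausdorff_affine_disk_gt0 => //; rewrite divr_gt0.
have [h0 h0_gt0 h0V] := exists_real_lb V0_gt0.
have V0u x : V0 x -> (0 < dotp x (u j0))%R.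
  move=> [_ xx0]; have := cauchy_schwarz (x0 - x)%R (u j0).
  by rewrite enormBC (u1 j0 : enorm _ = 1)%R mulr1 dotpBl; lra.
have V0x x : V0 x -> (enorm x <= enorm x0 + 1)%R.
  by move=> [_ xx0]; have := enormD (x - x0) x0; rewrite subrK; lra.
have [eta eta_gt0 etaJ] : exists2 r : R, (0 < r)%R & forall j, J j -> (r <= - dotp e (u j))%R.
  have pos j : (0 < (if J j then - dotp e (u j) else 1))%R.
    by case: ifP => // Jj; rewrite oppr_gt0 eJ.
  have [r r0 hr] := exists_pos_lb pos.
  by exists r => // j Jj; have := hr j; rewrite Jj.
(* By time [delta], translation along [e] has carried the whole disk [V0] into the cone. *)
pose delta := ((enorm x0 + 1) / eta)%R.
have delta_gt0 : (0 < delta)%R by rewrite divr_gt0// ltr_wpDl ?enorm_ge0.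
pose inC x := forall j, J j -> (dotp x (u j) <= 0)%R.
have V0C x s : V0 x -> (delta <= s)%R -> inC (x + s *: e)%R.
  move=> Vx ds j Jj; rewrite dotpDl dotpZl.
  have h1 : (dotp x (u j) <= enorm x0 + 1)%R.
    by rewrite (le_trans (cauchy_schwarz _ _))// (u1 j : enorm _ = 1)%R mulr1 V0x.
  have h2 : (enorm x0 + 1 <= s * - dotp e (u j))%R.
    have -> : (enorm x0 + 1 = delta * eta)%R by rewrite /delta divfK ?gt_eqF.
    by apply: ler_pM; rewrite ?(ltW delta_gt0) ?(ltW eta_gt0)// etaJ.
  lra.
(* Bounds the norm of all translates of [V0] along [e] up to time [delta + 1]. *)
pose Rad := (enorm x0 + 1 + (delta + 1))%R.
have Rad_gt0 : (0 < Rad)%R.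
  by rewrite /Rad; have := enorm_ge0 x0; lra.
pose L := (Rad + Rad ^+ 2)%R.
have L_gt0 : (0 < L)%R by rewrite addr_gt0// exprn_gt0.
pose K := ((delta + 1) * L ^+ k)%R.
have K_gt0 : (0 < K)%R by rewrite mulr_gt0 ?exprn_gt0// addr_gt0.
exists (h0 / K)%R; first by rewrite divr_gt0.
move=> t /andP[t0 t1]; set G := _ `&` _.
(* The strip seen in the chart: points outside the cone that one translation by [t *: e] moves into
   it. *)
pose A := [set x | [/\ dotp x a = 1%R, (enorm x <= Rad)%R,
  exists2 j, J j & (0 < dotp x (u j))%R & inC (x + t *: e)%R]].
(* The number of translates; [N * t] lies between [delta] and [delta + 1] since [t <= 1]. *)
pose N := (Num.trunc (delta / t)).+1.
have Nt : (delta <= N%:R * t)%R by rewrite -ler_pdivrMr// ltW// truncnS_gt.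
have tN : (N%:R * t <= delta + 1)%R.
  rewrite /N -natr1 mulrDl mul1r lerD// -ler_pdivlMr// truncn_le.
  by rewrite divr_ge0// ltW.
(* If [q + 1] is the first number of translations taking a point of [V0] into the cone, then [q] of
   them take it into [A]. *)
have VA : V0 `<=` [set x | exists2 q, q \in iota 0 N &
    [set (y + (- (q%:R * t)) *: e)%R | y in A] x].
  move=> x Vx.
  pose P q := `[< inC (x + (q%:R * t) *: e)%R >].
  have PN : P N by apply/asboolP; exact: V0C.
  have [q /asboolP Pq qmin] := ex_minnP (ex_intro P N PN).
  have q0 : (0 < q)%N.
    rewrite lt0n; apply/eqP => q0; move: Pq; rewrite q0 mul0r scale0r addr0 => /(_ _ Jj0).
    by rewrite leNgt V0u.
  have qN : (q <= N)%N by exact: qmin.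
  case: q q0 qN Pq qmin => // q _ qN Pq qmin.
  exists q; first by rewrite mem_iota.
  exists (x + (q%:R * t) *: e)%R; last by rewrite scaleNr addrK.
  split.
  - by case: Vx => xa _; rewrite dotpDl dotpZl (dotpC e) ae mulr0 addr0.
  - rewrite (le_trans (enormD _ _))// lerD ?V0x// enormZ.
    apply: (@le_trans _ _ (`|q%:R * t|)%R); first by rewrite ler_piMr.
    rewrite ger0_norm; last by apply: mulr_ge0 => //; exact: ltW.
    by apply: le_trans tN; apply: ler_wpM2r; [exact: ltW|rewrite ler_nat ltnW].
  - apply: contrapT => h; have : ~~ P q.
      by apply/negP => /qmin; rewrite ltnn.
    move=> /asboolP; apply => j Jj; rewrite leNgt; apply/negP => hj.
    by apply: h; exists j.
  - by move: Pq; rewrite -natr1 mulrDl mul1r scalerDl addrA.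
have h0N : h0%:E <= N%:R%:E * hausdorff k A.
  apply: (le_trans h0V); apply: (le_trans (le_hausdorff k VA)).
  apply: (le_trans (hausdorff_finite_subadditive _ _ _)).
  apply: (@le_trans _ _ (\sum_(q <- iota 0 N) hausdorff k A)).
    by apply: lee_sum => q _; exact: hausdorff_translate.
  elim: N {Nt tN VA} => [|M IH]; first by rewrite big_nil mul0e.
  rewrite -addn1 iotaD big_cat big_seq1 natrD EFinD ge0_muleDl ?lee_fin//.
  by rewrite mul1e; exact: leeD2r.
(* Central projection from the sphere to the chart; it is [L]-Lipschitz on [G'], where [dotp v a]
   stays away from 0. *)
pose g v := ((dotp v a)^-1 *: v)%R.
pose G' := G `&` [set v | (Rad^-1 <= dotp v a)%R].
(* Points of the chart have norm at least 1, so normalising them keeps the inner products at most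
   [t]. *)
have AG : A `<=` g @` G'.
  move=> x [xa xR [j Jj xj] xC].
  have x_ne0 : x != 0%R by apply/eqP => xx; move: xa; rewrite xx dotp0l => /esym/eqP; rewrite oner_eq0.
  have nx := enorm_gt0 x_ne0.
  have x1 : (1 <= enorm x)%R.
    by have := cauchy_schwarz x a; rewrite xa (a1 : enorm a = 1)%R mulr1.
  exists ((enorm x)^-1 *: x)%R; last first.
    by rewrite /g dotpZl xa mulr1 invrK scalerA divff ?scale1r// gt_eqF.
  split; last by rewrite /= dotpZl xa mulr1 lef_pV2 ?posrE.
  split; first exact: sphere_normalize.
  split; first by exists j => //; rewrite dotpZl mulr_gt0// invr_gt0.
  move=> i Ji; rewrite dotpZl ler_pdivrMl//; have := xC i Ji; rewrite dotpDl dotpZl.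
  have := cauchy_schwarz (- e)%R (u i); rewrite enormN (u1 i : enorm _ = 1)%R mulr1 dotpNl => h hx.
  have : (t * - dotp e (u i) <= t)%R by rewrite ler_piMr ?(ltW t0)// (le_trans h).
  have : (t <= enorm x * t)%R by rewrite ler_peMl// ltW.
  lra.
have gL v w : G' v -> G' w -> (enorm (g v - g w) <= L * enorm (v - w))%R.
  move=> [[v1 _] /= va] [[w1 _] /= wa].
  have va0 : (0 < dotp v a)%R by rewrite (lt_le_trans _ va)// invr_gt0.
  have wa0 : (0 < dotp w a)%R by rewrite (lt_le_trans _ wa)// invr_gt0.
  have va' : ((dotp v a)^-1 <= Rad)%R by rewrite invf_ple ?posrE.
  have wa' : ((dotp w a)^-1 <= Rad)%R by rewrite invf_ple ?posrE.
  rewrite /g (le_trans (enorm_triangle ((dotp v a)^-1 *: w)%R _ _))//.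
  rewrite -scalerBr -scalerBl !enormZ (w1 : enorm w = 1)%R mulr1 mulrDl lerD//.
    by rewrite ler_wpM2r ?enorm_ge0// ger0_norm// invr_ge0 ltW.
  have -> : ((dotp v a)^-1 - (dotp w a)^-1 = (dotp v a)^-1 * (dotp w a)^-1 * dotp (w - v) a)%R.
    by rewrite dotpBl; field; rewrite !gt_eqF.
  have va1 : (0 <= (dotp v a)^-1)%R by rewrite invr_ge0 ltW.
  have wa1 : (0 <= (dotp w a)^-1)%R by rewrite invr_ge0 ltW.
  rewrite !normrM (ger0_norm va1) (ger0_norm wa1).
  apply: ler_pM => //; first exact: mulr_ge0.
    by rewrite expr2; exact: ler_pM.
  by rewrite (le_trans (cauchy_schwarz_abs _ _))// (a1 : enorm a = 1)%R mulr1 enormBC.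
have AL : hausdorff k A <= (L ^+ k)%:E * hausdorff k G.
  apply: (le_trans (le_hausdorff k AG)); apply: (le_trans (@hausdorff_lipschitz R n n k g G' L L_gt0 gL)).
  apply: lee_wpmul2l; first by rewrite lee_fin exprn_ge0// ltW.
  by apply: le_hausdorff => v [].
have NL0 : (0 < N%:R * L ^+ k)%R by rewrite mulr_gt0// exprn_gt0.
have : h0%:E <= (N%:R * L ^+ k)%:E * hausdorff k G.
  by rewrite EFinM -muleA (le_trans h0N)// lee_wpmul2l ?lee_fin.
rewrite -lee_pdivrMl// -EFinM; apply: le_trans; rewrite lee_fin.
rewrite [leRHS]mulrC -mulrA ler_wpM2l ?(ltW h0_gt0)// mulrC ler_pdivrMr//.
rewrite [leRHS]mulrC ler_pdivlMr// /K mulrA ler_wpM2r ?exprn_ge0 ?(ltW L_gt0)//.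
by rewrite mulrC.
Qed.

End strips.

(** * Powers and finite maxima *)

Section powers.
Context (R : realType).

Lemma powRVK (x q : R) : 0 <= x -> q != 0 -> (x `^ q^-1) `^ q = x.
Proof. by move=> x0 q0; rewrite -powRrM mulVf// powRr1. Qed.

Lemma powRKV (x q : R) : 0 <= x -> q != 0 -> (x `^ q) `^ q^-1 = x.
Proof. by move=> x0 q0; rewrite -powRrM divff// powRr1. Qed.

Lemma le_powR (x y q : R) : 0 <= q -> 0 <= x -> x <= y -> x `^ q <= y `^ q.
Proof. by move=> q0 x0 xy; apply: ge0_ler_powR; rewrite // nnegrE// (le_trans x0). Qed.

Lemma lt_powR (x y q : R) : 0 < q -> 0 <= x -> x < y -> x `^ q < y `^ q.
Proof.
by move=> q0 x0 xy; apply: gt0_ltr_powR; rewrite // nnegrE// (le_trans x0)// ltW.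
Qed.

End powers.

Lemma exists_max_seq (T : eqType) (R : realType) (f : T -> R) (s : seq T) (x : T) :
  x \in s -> exists2 y, y \in s & forall y', y' \in s -> f y' <= f y.
Proof.
elim: s x => // a s IH x _; case: s IH => [_|b s IH].
  by exists a; rewrite ?mem_head// => y'; rewrite inE => /eqP ->.
have [y ys ymax] := IH b (mem_head _ _).
have [ay|ya] := leP (f a) (f y).
  exists y; first by rewrite inE ys orbT.
  by move=> y'; rewrite inE => /orP[/eqP ->|/ymax].
exists a; first by rewrite mem_head.
move=> y'; rewrite inE => /orP[/eqP -> //|/ymax h].
by rewrite (le_trans h)// ltW.
Qed.

(** * The functional to be maximised: finiteness, monotonicity, homogeneity, semicontinuity *)

Section variational.
Context (R : realType) (m : nat).
Local Notation n := m.+2.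
Local Notation S := (sphere R n).
Local Notation T := (caratheodory_type (@hausdorff R n m.+1)).
Local Notation H := (hausdorff_measure R n m.+1).

Lemma measurable_open (U : set 'rV[R]_n) : open U -> measurable (U : set T).
Proof. exact: measurable_hausdorff_open. Qed.

Lemma measurable_closed (C : set 'rV[R]_n) : closed C -> measurable (C : set T).
Proof.
by move=> cC; rewrite -(setCK C); apply: measurableC; apply: measurable_open; exact: closed_openC.
Qed.

Lemma measurable_sphere : measurable (S : set T).
Proof. by apply: measurable_closed; exact: closed_sphere. Qed.

Lemma sphere_measure_lt_pinfty : (H S < +oo)%E.
Proof. exact: hausdorff_sphere_fin. Qed.

Lemma measurable_null (N : set 'rV[R]_n) : hausdorff m.+1 N = 0%E -> measurable (N : set T).
Proof.
move=> N0; apply: le_caratheodory_measurable => X.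
rewrite [X in (X + _ <= _)%E](_ : _ = 0%E).
  by rewrite add0e; apply: le_hausdorff => x [].
apply/eqP; rewrite eq_le hausdorff_ge0 andbT -N0.
by apply: le_hausdorff => x [].
Qed.

(** As [f] is nonnegative on the sphere, a negative level gives the same superlevel set as the level
    0. *)
Lemma measurable_closed_superlevel (f : 'rV[R]_n -> R) :
  (forall t, 0 <= t -> closed (S `&` [set v | t <= f v])) ->
  (forall v, S v -> 0 <= f v) -> measurable_fun (S : set T) (f : T -> R).
Proof.
move=> cf f0 mS; apply: (measurability _ (RGenCInfty.measurableE R)) => //.
move=> /= _ [_ [t ->] <-].
rewrite (_ : _ `&` _ = S `&` [set v | Num.max t 0 <= f v]).
  by apply: measurable_closed; apply: cf; rewrite le_max lexx orbT.
apply/seteqP; split=> v [v1] /=; rewrite in_itv/= andbT ge_max => ft; split=> //.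
  by rewrite ft f0.
by case/andP: ft.
Qed.

Context (I : finType) (u : I -> 'rV[R]_n).
Hypothesis u1 : forall i, S (u i).
Hypothesis u_pos : forall v, v != 0 -> exists i, 0 < dotp v (u i).
Context (w : 'rV[R]_n -> R) (w1 w2 q : R).
Hypothesis mw : measurable_fun (S : set T) (w : T -> R).
Hypothesis w1_gt0 : 0 < w1.
Hypothesis w1w : forall v, S v -> w1 <= w v.
Hypothesis ww2 : forall v, S v -> w v <= w2.
Hypothesis q0 : 0 < q.
Implicit Types z : I -> R.
Local Notation rho z := (radial (hpoly u z)).

Definition density z (v : T) : \bar R := (rho z v `^ q * w v)%:E.

Let w_ge0 v : S v -> 0 <= w v.
Proof. by move=> /w1w; apply: le_trans; exact: ltW. Qed.

Lemma density_ge0 z v : S v -> (0 <= density z v)%E.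
Proof. by move=> v1; rewrite lee_fin mulr_ge0 ?powR_ge0// w_ge0. Qed.

Lemma measurable_radial z : (forall i, 0 <= z i) ->
  measurable_fun (S : set T) (rho z : T -> R).
Proof.
move=> z0; apply: measurable_closed_superlevel => [t t0|v v1].
  exact: closed_radial_hpoly_ge.
by apply: radial_hpoly_ge0 => //; exact: sphere_neq0.
Qed.

Lemma measurable_density z : (forall i, 0 <= z i) ->
  measurable_fun (S : set T) (density z).
Proof.
move=> z0; have h := measurable_funM
  (measurableT_comp (measurable_powR q) (measurable_radial z0)) mw.
exact: (measurableT_comp (@EFin_measurable R setT) h).
Qed.

(** For the weight [w = rho_Q^(n-q)] and positive [z] this is [n] times the total mass of the dual
    curvature measure of [hpoly u z]. The value under [fine] is finite by [PhiE]. *)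
Definition Phi z : R := fine (\int[H]_(v in S) density z v)%E.

Lemma density_bounded z (b : R) : (forall v, S v -> rho z v <= b) -> (forall i, 0 <= z i) ->
  forall v, S v -> (density z v <= (b `^ q * w2)%:E)%E.
Proof.
move=> hb z0 v v1; rewrite lee_fin ler_pM ?powR_ge0 ?w_ge0 ?ww2//.
by apply: le_powR; [exact: ltW|exact: radial_hpoly_ge0 (sphere_neq0 v1)|exact: hb].
Qed.

Lemma PhiE z : (forall i, 0 <= z i) -> (\int[H]_(v in S) density z v = (Phi z)%:E)%E.
Proof.
move=> z0; have mS := measurable_sphere.
have [e e1 _] := @exists_orthogonal R n 0 isT.
have [b b0 hb] := radial_hpoly_bounded u1 u_pos.
rewrite /Phi fineK// ge0_fin_numE; last by apply: integral_ge0 => v; exact: density_ge0.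
apply: (@le_lt_trans _ _ (\int[H]_(v in S) ((b * \sum_i z i) `^ q * w2)%:E)%E).
  apply: ge0_le_integral => //.
  - by move=> v; exact: density_ge0.
  - exact: measurable_density.
  - by apply: density_bounded => // v; exact: hb.
rewrite integral_cst//; apply: lte_mul_pinfty => //; last exact: sphere_measure_lt_pinfty.
rewrite lee_fin; apply: mulr_ge0; first exact: powR_ge0.
exact: le_trans (w_ge0 e1) (ww2 e1).
Qed.

End variational.


Lemma lee_eq2 (R : realType) (a a' b b' : \bar R) :
  a = a' -> b = b' -> (a <= b)%E -> (a' <= b')%E.
Proof. by move=> -> ->. Qed.

Section maximizer.
Context (R : realType) (m : nat).
Local Notation n := m.+2.
Local Notation S := (sphere R n).
Local Notation T := (caratheodory_type (@hausdorff R n m.+1)).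
Local Notation H := (hausdorff_measure R n m.+1).
Context (N : nat) (u : 'I_N -> 'rV[R]_n).
Hypothesis u1 : forall i, S (u i).
Hypothesis u_pos : forall v, v != 0 -> exists i, 0 < dotp v (u i).
Context (w : 'rV[R]_n -> R) (w1 w2 q : R).
Hypothesis mw : measurable_fun (S : set T) (w : T -> R).
Hypothesis w1_gt0 : 0 < w1.
Hypothesis w1w : forall v, S v -> w1 <= w v.
Hypothesis ww2 : forall v, S v -> w v <= w2.
Hypothesis q0 : 0 < q.
Implicit Types z : 'I_N -> R.
Local Notation rho z := (radial (hpoly u z)).
Local Notation F := (Phi u w q).

Let PhiE' z : (forall i, 0 <= z i) -> (\int[H]_(v in S) density u w q z v = (F z)%:E)%E.
Proof. exact: (PhiE u1 u_pos mw w1_gt0 w1w ww2 q0). Qed.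

Let mdens z : (forall i, 0 <= z i) -> measurable_fun (S : set T) (density u w q z).
Proof. exact: (measurable_density u_pos q mw). Qed.

Let dens_ge0 z v : S v -> (0 <= density u w q z v)%E.
Proof. exact: (density_ge0 u q w1_gt0 w1w z). Qed.

Let w_ge0 v : S v -> 0 <= w v.
Proof. by move=> /w1w; apply: le_trans; exact: ltW. Qed.

Lemma Phi_ge0 z : (forall i, 0 <= z i) -> 0 <= F z.
Proof. by move=> z0; rewrite -lee_fin -PhiE'//; apply: integral_ge0 => v; exact: dens_ge0. Qed.

Lemma density_mono z z' v : (forall i, 0 <= z i) -> (forall i, z i <= z' i) -> S v ->
  (density u w q z v <= density u w q z' v)%E.
Proof.
move=> z0 zz' v1; have v0 := sphere_neq0 v1.
rewrite lee_fin ler_wpM2r ?w_ge0//; apply: le_powR; first exact: ltW.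
  exact: radial_hpoly_ge0.
exact: le_radial_hpoly.
Qed.

Lemma Phi_mono z z' : (forall i, 0 <= z i) -> (forall i, z i <= z' i) -> F z <= F z'.
Proof.
move=> z0 zz'; have z'0 i : 0 <= z' i by rewrite (le_trans (z0 i)).
have h := @ge0_le_integral _ _ _ H S (@measurable_sphere R m) _ _ (@dens_ge0 z)
  (mdens z0) (mdens z'0) (fun v => density_mono z0 zz').
by rewrite -lee_fin; exact: (lee_eq2 (PhiE' z0) (PhiE' z'0) h).
Qed.

Lemma density_scale z (c : R) v : (forall i, 0 <= z i) -> 0 < c -> S v ->
  density u w q (fun i => c * z i) v = ((c `^ q)%:E * density u w q z v)%E.
Proof.
move=> z0 c0 v1; have v0 := sphere_neq0 v1.
rewrite /density radial_hpoly_scale// powRM ?(ltW c0)//; last exact: radial_hpoly_ge0.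
by rewrite -EFinM mulrA.
Qed.

Lemma integral_density_scale z (c : R) (D : set T) : measurable D -> D `<=` S ->
  (forall i, 0 <= z i) -> 0 < c ->
  (\int[H]_(v in D) density u w q (fun i => c * z i)%R v =
   (c `^ q)%:E * \int[H]_(v in D) density u w q z v)%E.
Proof.
move=> mD DS z0 c0.
have mf : measurable_fun D (density u w q z).
  by apply: (measurable_funS _ DS (mdens z0)); exact: measurable_sphere.
have f0 v : D v -> (0 <= density u w q z v)%E by move=> /DS; exact: dens_ge0.
apply: etrans (@ge0_integralZl_EFin _ _ _ H D mD _ f0 mf _ (powR_ge0 c q)).
by apply: eq_integral => v /[!inE] /DS v1; exact: density_scale.
Qed.

Lemma Phi_scale z (c : R) : (forall i, 0 <= z i) -> 0 < c ->
  F (fun i => c * z i) = c `^ q * F z.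
Proof.
move=> z0 c0; have cz i : 0 <= c * z i by rewrite mulr_ge0// ltW.
have h := integral_density_scale (@measurable_sphere R m) (@subset_refl _ S) z0 c0.
apply: EFin_inj; rewrite EFinM.
by apply: etrans (esym (PhiE' cz)) (etrans h _); congr (_ * _)%E; exact: PhiE'.
Qed.

(** Along [z + 1 / (j + 1)] the radial functions decrease to that of [z], and dominated convergence
    applies. Together with monotonicity this is upper semicontinuity. *)
Lemma Phi_usc z r : (forall i, 0 <= z i) -> F z < r ->
  exists2 h, 0 < h & F (fun i => z i + h) < r.
Proof.
move=> z0 zr.
pose zj j i := z i + j.+1%:R^-1.
have zj0 j i : 0 <= zj j i by rewrite addr_ge0.
have zzj j i : z i <= zj j i by rewrite lerDl.
have zj1 j i : zj j i <= z i + 1 by rewrite lerD2l invf_le1// ler1n.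
have cvg_rho v : S v -> (fun j => rho (zj j) v `^ q) @ \oo --> rho z v `^ q.
  move=> v1; have v0 := sphere_neq0 v1.
  have r0 := radial_hpoly_ge0 u_pos z0 v0.
  apply/cvgrPdist_lt => e e0.
  have e2 : 0 < e / 2 by rewrite divr_gt0.
  (* [t] exceeds the radius at [z], so it violates some constraint, and it still does after that
     constraint is relaxed by a small [1 / (j + 1)]. *)
  pose t := (rho z v `^ q + e / 2) `^ q^-1.
  have s0 : 0 <= rho z v `^ q + e / 2 by rewrite addr_ge0 ?powR_ge0// ltW.
  have tq : t `^ q = rho z v `^ q + e / 2 by rewrite powRVK// gt_eqF.
  have t0 : 0 <= t by exact: powR_ge0.
  have rt : rho z v < t.
    rewrite ltNge; apply/negP => tr.
    by have := le_powR (ltW q0) t0 tr; rewrite tq gerDl leNgt e2.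
  have [i zi] : exists i, z i < t * dotp v (u i).
    apply: contrapT => /forallNP h.
    have : t <= rho z v.
      by apply/radial_hpolyP => // i; rewrite leNgt; apply/negP; exact: h.
    by rewrite leNgt rt.
  have gap : 0 < t * dotp v (u i) - z i by rewrite subr_gt0.
  near=> j.
  have jt : rho (zj j) v <= t.
    rewrite leNgt; apply/negP => tj.
    have := radial_hpoly_le u_pos i (zj0 j) v0; rewrite leNgt => /negP; apply.
    apply: (@lt_le_trans _ _ (t * dotp v (u i))); last first.
      rewrite ler_wpM2r ?(ltW tj)//.
      have : 0 <= t * dotp v (u i) by rewrite (le_trans (z0 i))// ltW.
      by move=> h; rewrite leNgt; apply/negP => d0; move: zi; rewrite ltNge
        (le_trans _ (z0 i))// mulr_ge0_le0// ltW.
    rewrite /zj -ltrBrDl.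
    by near: j; exact: (near_infty_natSinv_lt (PosNum gap)).
  have := le_powR (ltW q0) (radial_hpoly_ge0 u_pos (zj0 j) v0) jt; rewrite tq => h1.
  have := le_powR (ltW q0) r0 (le_radial_hpoly u_pos z0 (zzj j) v0) => h2.
  by rewrite distrC ger0_norm ?subr_ge0// ltrBlDl (le_lt_trans h1)// ltrD2l; lra.
have [b b0 hb] := radial_hpoly_bounded u1 u_pos.
pose B := b * \sum_i (z i + 1).
have rhoB j v : S v -> rho (zj j) v <= B.
  move=> v1; apply: (le_trans (hb _ _ (zj0 j) v1)).
  by rewrite ler_wpM2l ?(ltW b0)//; apply: ler_sum => i _.
have mS := @measurable_sphere R m.
have int_cst : H.-integrable S (EFin \o cst (B `^ q * w2)).
  apply: measurable_bounded_integrable => //; first exact: sphere_measure_lt_pinfty.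
  by exists `|B `^ q * w2|; split => // x /ltW + v _ => /=.
have [] := @dominated_convergence _ _ _ H S mS (fun j => density u w q (zj j))
  (density u w q z) (EFin \o cst (B `^ q * w2)) (fun j => mdens (zj0 j)) (mdens z0) _ int_cst _.
- apply: aeW => v v1; apply/cvg_EFin; first exact: nearW.
  by apply: cvgM; [exact: cvg_rho|exact: cvg_cst].
- apply: aeW => v j v1; rewrite gee0_abs ?dens_ge0//.
  apply: (density_bounded u_pos w1_gt0 w1w ww2 q0) => //; exact: rhoB.
move=> _ _ cF.
have /fine_cvgP[_ cF'] := eq_ind _
  (fun l => (fun j => \int[H]_(v in S) density u w q (zj j) v)%E @ \oo --> l) cF _ (PhiE' z0).
have := @cvgr_lt _ _ _ _ _ _ cF' _ zr; move=> [j _ /(_ j (leqnn j)) hj].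
by exists j.+1%:R^-1.
Unshelve. all: by end_near. Qed.

End maximizer.

(** * Exponential estimates *)

Section elementary_inequalities.
Context (R : realType).

Lemma expR_le_inv (y : R) : y < 1 -> expR y <= (1 - y)^-1.
Proof.
move=> y1; rewrite -(opprK y) expRN lef_pV2 ?posrE ?expR_gt0 ?opprK ?subr_gt0//.
exact: expR_ge1Dx.
Qed.

Lemma powR_le_expR (x r : R) : 0 <= x -> 0 <= r -> (1 + x) `^ r <= expR (x * r).
Proof.
move=> x0 r0; rewrite expRM; apply: le_powR => //; first by rewrite addr_ge0.
exact: expR_ge1Dx.
Qed.

End elementary_inequalities.

(** * Existence of a maximiser on the constraint set *)

(* The simplex is parametrised by [y i = z i `^ p], so that compactness is linear. *)
Section usc_maximum.
Context (R : realType) (N : nat) (F : ('I_N -> R) -> R) (p : R) (alpha : 'I_N -> R).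
Implicit Types z : 'I_N -> R.
Hypothesis exists_index : exists i : 'I_N, True.
Hypothesis alpha0 : forall i, 0 < alpha i.
Hypothesis p0 : 0 < p.
Hypothesis Fmono : forall z z', (forall i, 0 <= z i) -> (forall i, z i <= z' i) -> F z <= F z'.
Hypothesis Fusc : forall z r, (forall i, 0 <= z i) -> F z < r ->
  exists2 h, 0 < h & F (fun i => z i + h) < r.

Let pn0 : p != 0. Proof. by rewrite gt_eqF. Qed.

Definition simplex : set 'rV[R]_N := [set y | (forall i, 0 <= y ord0 i) /\ \sum_i y ord0 i * alpha i = 1].
Definition simplex_root (y : 'rV[R]_N) i := y ord0 i `^ p^-1.

Lemma simplex_root_ge0 y i : 0 <= simplex_root y i. Proof. exact: powR_ge0. Qed.

Lemma compact_simplex : compact simplex.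
Proof.
pose a : 'rV[R]_N := \row_i alpha i.
have dE y : dotp y a = \sum_i y ord0 i * alpha i.
  by apply: eq_bigr => i _; rewrite mxE.
apply: (@compact_enorm _ _ _ (N%:R * \sum_i (alpha i)^-1)).
  rewrite (_ : simplex = \bigcap_i [set y : 'rV[R]_N | 0 <= y ord0 i] `&` ([set y | dotp y a <= 1] `&`
      [set y | dotp y (- a) <= - 1])).
    apply: closedI; last by apply: closedI; exact: closed_dotp_le.
    apply: closed_bigI => i _.
    apply: (@closed_comp _ _ (fun y : 'rV[R]_N => y ord0 i) [set t | 0 <= t]) => [y _|].
      apply: (@lipschitz_continuous _ _ _ 1) => x z; rewrite mul1r.
      by have := coord_le_enorm (x - z) i; rewrite !mxE.
    exact: closed_ge.
  apply/seteqP; split=> [y [y0 ya]|y [y0 [/= ya yb]]].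
    by split=> [i _|]; [exact: y0|rewrite /= dotpNr dE ya].
  split; first by move=> i; exact: y0.
  by apply/eqP; rewrite eq_le -dE ya/=; rewrite dotpNr lerN2 in yb.
move=> y [y0 ya]; apply: enorm_le_coord => i; rewrite ger0_norm//.
apply: (@le_trans _ _ (alpha i)^-1).
  rewrite -[leRHS]mul1r ler_pdivlMr// -ya (bigD1 i)//= lerDl sumr_ge0// => j _.
  by rewrite mulr_ge0// ltW.
by rewrite (bigD1 i)//= lerDl sumr_ge0// => j _; rewrite invr_ge0 ltW.
Qed.

Lemma simplex_nonempty : simplex !=set0.
Proof.
have [i0 _] := exists_index.
have S0 : 0 < \sum_i alpha i.
  by rewrite (bigD1 i0)//= ltr_wpDr// sumr_ge0// => j _; rewrite ltW.
exists (\row_i (\sum_i alpha i)^-1); split=> [i|]; first by rewrite mxE invr_ge0 ltW.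
under eq_bigr do rewrite mxE.
by rewrite -mulr_sumr mulVf// gt_eqF.
Qed.

(** Upper semicontinuity on a compact set, through covers: without a maximum the open sets [f y'] of
    points beaten by [y'] cover the simplex, finitely many suffice, and the best of their indices is
    beaten by another one. *)
Lemma maximum_on_simplex : exists2 y0, simplex y0 & forall y, simplex y -> F (simplex_root y) <= F (simplex_root y0).
Proof.
apply: contrapT => nomax.
have better y : simplex y -> exists2 y', simplex y' & F (simplex_root y) < F (simplex_root y').
  move=> Zy; apply: contrapT => h; apply: nomax; exists y => // y' Zy'.
  by rewrite leNgt; apply/negP => yy'; apply: h; exists y'.
(* An open set of points worse than [y']: being dominated by some [c] with a smaller value is an
   open condition, and monotonicity turns it into a comparison of values. *)
pose f y' := [set y : 'rV[R]_N | exists2 c : 'I_N -> R, (forall i, 0 <= c i) /\ F c < F (simplex_root y') &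
  forall i, y ord0 i < c i `^ p].
have of_ y' : simplex y' -> open (f y').
  move=> _; apply/open_enorm => y [c [c0 cF] yc].
  have gap i : 0 < c i `^ p - y ord0 i by rewrite subr_gt0.
  have [r r0 hr] := exists_pos_lb gap.
  exists r => // x xy; exists c => // i.
  have := coord_le_enorm (x - y) i; rewrite !mxE ler_norml => /andP[_ h].
  by have := hr i; lra.
have cov : simplex `<=` \bigcup_(y' in simplex) f y'.
  move=> y Zy; have [y' Zy' yy'] := better y Zy; exists y' => //.
  have [h h0 hF] := Fusc (simplex_root_ge0 y) yy'.
  exists (fun i => simplex_root y i + h); first by split=> // i; rewrite addr_ge0 ?simplex_root_ge0 ?(ltW h0).
  move=> i; rewrite -[ltLHS](powRVK _ pn0); last by case: Zy.
  by apply: lt_powR; rewrite ?powR_ge0 /simplex_root ?ltrDl.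
have := compact_simplex; rewrite compact_cover => /(_ _ simplex f of_ cov)[D DZ covD].
have [y1 Zy1] := simplex_nonempty.
have [d dD _] := covD y1 Zy1.
have [y yD ymax] := exists_max_seq (fun y => F (simplex_root y)) (dD : d \in finmap.enum_fset D).
have Zy : simplex y by have := DZ y yD; rewrite inE.
have [y' y'D [c [c0 cF] yc]] := covD y Zy.
have := ymax y' y'D; rewrite leNgt => /negP; apply; apply: le_lt_trans cF.
apply: Fmono => i; first exact: simplex_root_ge0.
have p'0 : 0 <= p^-1 by rewrite invr_ge0 ltW.
rewrite -(powRKV (c0 i) pn0); apply: le_powR => //; first by case: Zy.
exact: ltW.
Qed.

Context (q : R).
Hypothesis Fscale : forall z (c : R), (forall i, 0 <= z i) -> 0 < c ->
  F (fun i => c * z i) = c `^ q * F z.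
Hypothesis F1_gt0 : 0 < F (fun=> 1).

Definition mass z : R := \sum_i alpha i * z i `^ p.

(** Dividing [z'] by [mass z' ^ (1 / p)] puts it on the constraint set, and homogeneity of degree
    [q] gives the factor. Variations can then ignore the constraint. *)
Lemma exists_maximizer : exists z, [/\ forall i, 0 <= z i, mass z = 1, 0 < F z &
  forall z', (forall i, 0 <= z' i) -> 0 < mass z' -> F z' <= mass z' `^ (q / p) * F z].
Proof.
have [y0 Zy0 ymax] := maximum_on_simplex.
have key z' : (forall i, 0 <= z' i) -> 0 < mass z' -> F z' <= mass z' `^ (q / p) * F (simplex_root y0).
  move=> z'0 mz'; pose c := mass z' `^ p^-1.
  have c0 : 0 < c by exact: powR_gt0.
  have cn0 : c != 0 by rewrite gt_eqF.
  pose z2 i := c^-1 * z' i.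
  have z20 i : 0 <= z2 i by rewrite mulr_ge0// invr_ge0 ltW.
  pose y : 'rV[R]_N := \row_i (z2 i `^ p).
  have rootE : simplex_root y = z2.
    by apply/funext => i; rewrite /simplex_root mxE powRKV.
  have Zy : simplex y.
    split=> [i|]; first by rewrite mxE powR_ge0.
    have ci0 : 0 <= c^-1 by rewrite invr_ge0 ltW.
    under eq_bigr do rewrite mxE /z2 powRM// -mulrA [_ * alpha _]mulrC.
    rewrite -mulr_sumr -/(mass z') -(powRVK (ltW mz') pn0) -/c -powRM ?(ltW c0)//.
    by rewrite mulVf// powR1.
  have -> : z' = fun i => c * z2 i by apply/funext => i; rewrite /z2 mulVKf.
  rewrite (Fscale z20 c0).
  have -> : mass (fun i => c * z2 i) = mass z'.
    by apply: eq_bigr => i _; rewrite /z2 mulVKf.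
  rewrite [q / p]mulrC powRrM -/c ler_wpM2l ?powR_ge0//.
  by rewrite -rootE; exact: ymax.
exists (simplex_root y0); split => //.
- by move=> i; exact: simplex_root_ge0.
- case: Zy0 => y00 ya; apply: etrans ya; apply: eq_bigr => i _.
  by rewrite powRVK// mulrC.
- have [i0 _] := exists_index.
  have m1 : 0 < mass (fun=> 1).
    rewrite /mass (bigD1 i0)//= powR1 mulr1 ltr_wpDr// sumr_ge0// => j _.
    by rewrite mulr1 ltW.
  have := lt_le_trans F1_gt0 (key (fun=> 1) (fun=> ler01) m1).
  by rewrite pmulr_rgt0// powR_gt0.
Qed.

End usc_maximum.

Section maximizer_existence.
Context (R : realType) (m : nat).
Local Notation n := m.+2.
Local Notation S := (sphere R n).
Local Notation T := (caratheodory_type (@hausdorff R n m.+1)).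
Local Notation H := (hausdorff_measure R n m.+1).
Context (N : nat) (u : 'I_N -> 'rV[R]_n).
Hypothesis u1 : forall i, S (u i).
Hypothesis u_pos : forall v, v != 0 -> exists i, 0 < dotp v (u i).
Context (w : 'rV[R]_n -> R) (w1 w2 q : R).
Hypothesis mw : measurable_fun (S : set T) (w : T -> R).
Hypothesis w1_gt0 : 0 < w1.
Hypothesis w1w : forall v, S v -> w1 <= w v.
Hypothesis ww2 : forall v, S v -> w v <= w2.
Hypothesis q0 : 0 < q.
Implicit Types z : 'I_N -> R.
Local Notation rho z := (radial (hpoly u z)).
Local Notation F := (Phi u w q).

Let PhiE' z : (forall i, 0 <= z i) -> (\int[H]_(v in S) density u w q z v = (F z)%:E)%E.
Proof. exact: (PhiE u1 u_pos mw w1_gt0 w1w ww2 q0). Qed.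

Let mdens z : (forall i, 0 <= z i) -> measurable_fun (S : set T) (density u w q z).
Proof. exact: (measurable_density u_pos q mw). Qed.

Let dens_ge0 z v : S v -> (0 <= density u w q z v)%E.
Proof. exact: (density_ge0 u q w1_gt0 w1w z). Qed.

Let exists_index : exists i : 'I_N, True.
Proof.
have [a a1 _] := @exists_orthogonal R n 0 isT.
by have [i _] := u_pos (sphere_neq0 a1); exists i.
Qed.

(** The sphere contains a strip, here for the single vector [u i0], the direction [- u i0] and width
    1. *)
Lemma sphere_measure_gt0 : (0 < H S)%E.
Proof.
have [i0 _] := exists_index.
have e1 : enorm (- u i0) <= 1 by rewrite enormN (u1 i0 : enorm _ = 1).
have eJ j : pred1 i0 j -> dotp (- u i0) (u j) < 0.
  by move=> /eqP ->; rewrite dotpNl sphere_dotp// oppr_lt0.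
have [c c0 hc] := @strip_lower_bound R m _ u (pred1 i0) (- u i0) i0 u1 (eqxx i0) eJ e1.
have h1 : 0 < (1 : R) <= 1 by rewrite ltr01 lexx.
apply: lt_le_trans (le_trans (hc 1 h1) _); first by rewrite lte_fin mulr1.
by apply: le_hausdorff => v [].
Qed.

(* A constant lower bound for the integrand over a part [G] of the sphere. *)
Lemma integral_density_ge z (G : set T) (d : R) : (forall i, 0 <= z i) -> measurable G ->
  G `<=` S -> 0 <= d -> (forall v, G v -> d <= rho z v) ->
  ((d `^ q * w1)%:E * H G <= \int[H]_(v in G) density u w q z v)%E.
Proof.
move=> z0 mG GS d0 hd.
have mf : measurable_fun G (density u w q z).
  by apply: (measurable_funS _ GS (mdens z0)); exact: measurable_sphere.
rewrite -(integral_cst H mG (d `^ q * w1)%:E); apply: ge0_le_integral => //.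
- by move=> v _; rewrite /= lee_fin mulr_ge0 ?powR_ge0// ltW.
- move=> v Gv /=; rewrite lee_fin; apply: ler_pM; rewrite ?powR_ge0 ?(ltW w1_gt0) ?w1w//.
    by apply: le_powR; rewrite ?(ltW q0)// hd.
  exact: GS.
Qed.

(** The polytope with all [z i = 1] contains the unit ball, so its radial function is at least 1. *)
Lemma Phi1_gt0 : 0 < F (fun=> 1).
Proof.
have z0 (i : 'I_N) : 0 <= (fun=> 1 : R) i by [].
have h := @integral_density_ge (fun=> 1) S 1 z0 (@measurable_sphere R m) (@subset_refl _ S)
  ler01.
rewrite -lte_fin.
have lower : ((1 `^ q * w1)%:E * H S <= (F (fun=> 1))%:E)%E.
  apply: lee_eq2 (erefl _) (PhiE' z0) (h _) => v v1.
  apply/radial_hpolyP => //; first exact: sphere_neq0.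
  by move=> i; rewrite mul1r sphere_dotp_le.
apply: lt_le_trans lower; rewrite powR1 mul1r mule_gt0 ?lte_fin//.
exact: sphere_measure_gt0.
Qed.

Context (p : R) (alpha : 'I_N -> R).
Hypothesis alpha0 : forall i, 0 < alpha i.
Hypothesis p1 : 1 < p.


Let p0 : 0 < p. Proof. exact: lt_trans p1. Qed.
Let Fmono z z' : (forall i, 0 <= z i) -> (forall i, z i <= z' i) -> F z <= F z'.
Proof. exact: (Phi_mono u1 u_pos mw w1_gt0 w1w ww2 q0). Qed.

Let Fusc z r : (forall i, 0 <= z i) -> F z < r ->
  exists2 h, 0 < h & F (fun i => z i + h) < r.
Proof. exact: (Phi_usc u1 u_pos mw w1_gt0 w1w ww2 q0). Qed.

Let Fscale z (c : R) : (forall i, 0 <= z i) -> 0 < c -> F (fun i => c * z i) = c `^ q * F z.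
Proof. exact: (Phi_scale u1 u_pos mw w1_gt0 w1w ww2 q0). Qed.

Lemma exists_Phi_maximizer : exists z, [/\ forall i, 0 <= z i, mass p alpha z = 1, 0 < F z &
  forall z', (forall i, 0 <= z' i) -> 0 < mass p alpha z' ->
    F z' <= mass p alpha z' `^ (q / p) * F z].
Proof. exact: (exists_maximizer exists_index alpha0 p0 Fmono Fusc Fscale Phi1_gt0). Qed.

End maximizer_existence.

(** * Positivity of the coordinates of a maximiser *)

Lemma add_le_of_split (R : realType) (x y k : R) (a b a' b' : \bar R) :
  x%:E = (a + b)%E -> y%:E = (a' + b')%E -> a = 0%E -> (k%:E <= a')%E -> (b <= b')%E ->
  x + k <= y.
Proof.
by move=> xab yab a0 ka bb; rewrite -lee_fin EFinD xab yab a0 add0e addeC leeD.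
Qed.

Section interior_maximizer.
Context (R : realType) (m : nat).
Local Notation n := m.+2.
Local Notation S := (sphere R n).
Local Notation T := (caratheodory_type (@hausdorff R n m.+1)).
Local Notation H := (hausdorff_measure R n m.+1).

(** The right side exceeds [F] by order [t ^ p], which a linear gain beats for small [t] because
    [p > 1]. *)
Lemma linear_vs_power (p r a F k : R) : 1 < p -> 0 <= r -> 0 <= a -> 0 <= F -> 0 < k ->
  (forall t, 0 < t <= 1 -> F + k * t <= (1 + a * t `^ p) `^ r * F) -> False.
Proof.
move=> p1 r0 a0 F0 k0 h.
have K0 : 0 <= r * a by exact: mulr_ge0.
have b0 : 0 <= 4 * (r * a) * F / k by rewrite divr_ge0 ?(ltW k0)// !mulr_ge0.
(* Chosen so that [s = 1 / D] satisfies both [r * a * s <= 1 / 2] and [4 * r * a * F * s <= k]. *)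
pose D := 1 + 2 * (r * a) + 4 * (r * a) * F / k.
have D1 : 1 <= D by rewrite /D -addrA lerDl addr_ge0// mulr_ge0.
have D0 : 0 < D by exact: lt_le_trans D1.
pose s := D^-1; have s0 : 0 < s by rewrite invr_gt0.
have s1 : s <= 1 by rewrite invf_le1.
have sD : s * D = 1 by rewrite mulVf// gt_eqF.
have Ks : r * a * s <= 1 / 2.
  have : s * (2 * (r * a)) <= s * D.
    apply: ler_wpM2l; first exact: ltW.
    by rewrite /D addrAC lerDr addr_ge0.
  rewrite sD; lra.
have Fs : 4 * (r * a) * F * s <= k.
  have h1 : s * (4 * (r * a) * F / k) <= 1.
    apply: le_trans (_ : s * D <= 1); last by rewrite sD.
    by apply: ler_wpM2l; [exact: ltW|rewrite /D lerDr addr_ge0// mulr_ge0].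
  have -> : 4 * (r * a) * F * s = k * (s * (4 * (r * a) * F / k)).
    by field; rewrite gt_eqF.
  by rewrite ler_piMr// ltW.
have p10 : p - 1 != 0 by rewrite subr_eq0 gt_eqF.
have p1' : 0 <= p - 1 by rewrite subr_ge0 ltW.
(* For this [t] one has [t ^ p = t * s], so the excess is at most
   [2 * r * a * F * s * t <= k * t / 2]. *)
pose t := s `^ (p - 1)^-1.
have t0 : 0 < t by exact: powR_gt0.
have t1 : t <= 1.
  rewrite -[leRHS](congr1 (fun f => f (p - 1)^-1) (powR1 R)).
  by apply: le_powR; rewrite ?invr_ge0// ltW.
have tp : t `^ p = t * s.
  have -> : p = 1 + (p - 1) by ring.
  rewrite powRD; last by rewrite (gt_eqF t0) implybT.
  by rewrite powRr1 ?(ltW t0)// powRVK// ltW.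
have tt : 0 < t <= 1 by rewrite t0.
have := h t tt; rewrite tp.
have x0 : 0 <= a * (t * s) by rewrite mulr_ge0// mulr_ge0// ltW.
have := powR_le_expR x0 r0.
have xr : a * (t * s) * r <= 1 / 2.
  have -> : a * (t * s) * r = r * a * s * t by ring.
  by rewrite (le_trans _ Ks)// ler_piMr// mulr_ge0// ltW.
have xr1 : a * (t * s) * r < 1 by lra.
have := expR_le_inv xr1.
have : (1 - a * (t * s) * r)^-1 <= 1 + 2 * (a * (t * s) * r).
  have y0 : 0 <= a * (t * s) * r by rewrite mulr_ge0.
  move: (a * (t * s) * r) y0 xr xr1 => y y0 yh y1.
  have yy : 0 <= y * (1 / 2 - y) by rewrite mulr_ge0// subr_ge0.
  rewrite -[leLHS]mul1r ler_pdivrMr ?subr_gt0//.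
  rewrite -subr_ge0.
  have -> : (1 + 2 * y) * (1 - y) - 1 = 2 * (y * (1 / 2 - y)) by field.
  exact: mulr_ge0.
move: (expR _) ((1 + _) `^ r) => E P h1 h2 h3.
have hP : P <= 1 + 2 * (a * (t * s) * r) by exact: le_trans h3 (le_trans h2 h1).
move=> h4; have := le_trans h4 (ler_wpM2r F0 hP).
have -> : (1 + 2 * (a * (t * s) * r)) * F = F + (2 * (r * a) * F * s) * t by ring.
rewrite lerD2l ler_pM2r//; move: Fs.
have -> : 4 * (r * a) * F * s = 2 * (2 * (r * a) * F * s) by ring.
lra.
Qed.

Context (N : nat) (u : 'I_N -> 'rV[R]_n).
Hypothesis u1 : forall i, S (u i).
Hypothesis u_pos : forall v, v != 0 -> exists i, 0 < dotp v (u i).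
Context (w : 'rV[R]_n -> R) (w1 w2 q : R).
Hypothesis mw : measurable_fun (S : set T) (w : T -> R).
Hypothesis w1_gt0 : 0 < w1.
Hypothesis w1w : forall v, S v -> w1 <= w v.
Hypothesis ww2 : forall v, S v -> w v <= w2.
Hypothesis q0 : 0 < q.
Implicit Types z : 'I_N -> R.
Local Notation rho z := (radial (hpoly u z)).
Local Notation F := (Phi u w q).

Let PhiE' z : (forall i, 0 <= z i) -> (\int[H]_(v in S) density u w q z v)%E = (F z)%:E.
Proof. exact: (PhiE u1 u_pos mw w1_gt0 w1w ww2 q0). Qed.

Let mdens z : (forall i, 0 <= z i) -> measurable_fun (S : set T) (density u w q z).
Proof. exact: (measurable_density u_pos q mw). Qed.

Let dens_ge0 z v : S v -> (0 <= density u w q z v)%E.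
Proof. exact: (density_ge0 u q w1_gt0 w1w z). Qed.

Lemma integral_density_split z (G : set T) : (forall i, 0 <= z i) -> measurable G -> G `<=` S ->
  (\int[H]_(v in S) density u w q z v =
   \int[H]_(v in G) density u w q z v + \int[H]_(v in S `\` G) density u w q z v)%E.
Proof.
move=> z0 mG GS; have mS := @measurable_sphere R m.
have E : G `|` (S `\` G) = S by rewrite setDUK.
have mD : measurable (S `\` G : set T) by exact: measurableD.
have mf : measurable_fun (G `|` (S `\` G)) (density u w q z) by rewrite E; exact: mdens.
have f0 v : (G `|` (S `\` G)) v -> (0 <= density u w q z v)%E.
  by rewrite E; exact: dens_ge0.
have disj : [disjoint G & S `\` G].
  by apply/disj_setPS => v [? [_ ?]].
rewrite -(ge0_integral_setU H mG mD mf f0 disj); congr (integral _ _ _).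
by rewrite E.
Qed.

Lemma le_integral_density z z' (G : set T) : (forall i, 0 <= z i) -> (forall i, z i <= z' i) ->
  measurable G -> G `<=` S ->
  (\int[H]_(v in G) density u w q z v <= \int[H]_(v in G) density u w q z' v)%E.
Proof.
move=> z0 zz' mG GS; have z'0 i : 0 <= z' i by rewrite (le_trans (z0 i)).
have mS := @measurable_sphere R m.
apply: (@ge0_le_integral _ _ _ H G mG _ _ _ (measurable_funS mS GS (mdens z0))
  (measurable_funS mS GS (mdens z'0))) => v /GS v1; first exact: dens_ge0.
exact: (density_mono u_pos w1_gt0 w1w q0).
Qed.

Lemma radial_hpoly_eq0 z v j : (forall i, 0 <= z i) -> S v -> z j = 0 -> 0 < dotp v (u j) ->
  rho z v = 0.
Proof.
move=> z0 v1 zj vj; have v0 := sphere_neq0 v1.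
have := radial_hpoly_le u_pos j z0 v0; rewrite zj pmulr_lle0// => h.
by apply/eqP; rewrite eq_le h radial_hpoly_ge0.
Qed.

Lemma density_eq0 z v : rho z v = 0 -> density u w q z v = 0%E.
Proof. by move=> r0; rewrite /density r0 powR0 ?gt_eqF// mul0r. Qed.

(** If for some [j] no point of the cone [C] had negative inner product with [u j], the radial
    function would vanish off the great subsphere orthogonal to [u j], which is null, and [F z]
    would be 0. Adding up one such point for each [j] gives [e]. *)
Let interior_direction z (J : pred 'I_N) (j0 : 'I_N) : (forall i, 0 <= z i) -> 0 < F z ->
  J j0 -> (forall j, J j -> z j = 0) ->
  exists2 e, (forall j, J j -> dotp e (u j) < 0) & enorm e <= 1.
Proof.
move=> z0 Fz Jj0 Jz.
pose C := [set x | forall j, J j -> dotp x (u j) <= 0].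
have xs j : exists x, J j -> C x /\ dotp x (u j) < 0.
  have [Jj|] := boolP (J j); last by exists 0.
  apply: contrapT => /forallNP h.
  pose Nul := S `&` [set v | dotp v (u j) = 0].
  have hN : hausdorff m.+1 Nul = 0%E.
    by apply: hausdorff_great_sphere; exact: sphere_neq0.
  have h1 := @ge0_negligible_integral _ _ _ H S Nul _ (measurable_null hN)
    (@measurable_sphere R m) (mdens z0) (@dens_ge0 z) hN.
  have h2 : (\int[H]_(v in S `\` Nul) density u w q z v = 0)%E.
    apply: integral0_eq => v [v1 nv]; apply: density_eq0.
    have v0 := sphere_neq0 v1.
    have [//|rn0] := eqVneq (rho z v) 0; exfalso.
    have r0 : 0 < rho z v by rewrite lt_neqAle eq_sym rn0 radial_hpoly_ge0.
    have Cv : C v.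
      by move=> i Ji; have := radial_hpoly_le u_pos i z0 v0; rewrite Jz// pmulr_rle0.
    apply: (h v) => _; split=> //; rewrite lt_neqAle Cv// andbT.
    by apply/eqP => vj; apply: nv.
  have := etrans (esym (PhiE' z0)) (etrans h1 h2) => -[F0].
  by move: Fz; rewrite F0 ltxx.
have [xf hx] := choice xs.
pose e0 := \sum_(j | J j) xf j.
have e0J j : J j -> dotp e0 (u j) < 0.
  move=> Jj; rewrite dotp_suml (bigD1 j)//=.
  rewrite -[ltRHS]addr0 ltr_leD//; first by have [] := hx j Jj.
  by apply: sumr_le0 => i /andP[Ji _]; have [Ci _] := hx i Ji; exact: Ci.
have e0n : e0 != 0.
  by apply/eqP => e00; have := e0J j0 Jj0; rewrite e00 dotp0l ltxx.
exists ((enorm e0)^-1 *: e0); last by rewrite (sphere_normalize e0n : enorm _ = 1).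
by move=> j Jj; rewrite dotpZl pmulr_rlt0 ?e0J// invr_gt0 enorm_gt0.
Qed.

Context (p : R) (alpha : 'I_N -> R) (z : 'I_N -> R).
Hypothesis alpha0 : forall i, 0 < alpha i.
Hypothesis p1 : 1 < p.
Hypothesis z0 : forall i, 0 <= z i.
Hypothesis mz : mass p alpha z = 1.
Hypothesis Fz : 0 < F z.
Hypothesis zmax : forall z', (forall i, 0 <= z' i) -> 0 < mass p alpha z' ->
  F z' <= mass p alpha z' `^ (q / p) * F z.

(** Raise all vanishing coordinates to [t]. On the strip the density grows from 0 to at least a
    constant and elsewhere it does not decrease, a gain linear in [t]; the mass grows by a multiple
    of [t ^ p], contradicting maximality by [linear_vs_power]. *)
Lemma maximizer_gt0 i : 0 < z i.
Proof.
rewrite lt_neqAle z0 andbT eq_sym; apply/eqP => zi.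
pose J := [pred j | z j == 0].
have Ji : J i by apply/eqP.
have Jz j : J j -> z j = 0 by move=> /eqP.
have [e eJ e1] := interior_direction z0 Fz Ji Jz.
have [c c0 hc] := strip_lower_bound u1 Ji eJ e1.
(* The resulting [d] bounds the positive coordinates from below and is at most 1; it will bound the
   raised radial function on the strip. *)
have pos j : 0 < (if J j then 1 else z j).
  by case: ifPn => // nJ; rewrite lt_neqAle z0 andbT eq_sym.
have [d d0 hd] := exists_pos_lb pos.
have d1 : d <= 1 by have := hd i; rewrite Ji.
have p0 : 0 < p by exact: lt_trans p1.
pose zt (t : R) j := if J j then t else z j.
have ztE t : 0 < t -> mass p alpha (zt t) = 1 + (\sum_(j | J j) alpha j) * t `^ p.
  move=> t0.
  have -> : (\sum_(j | J j) alpha j) * t `^ p = \sum_j (if J j then alpha j * t `^ p else 0).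
    by rewrite mulr_suml big_mkcond.
  rewrite -mz /mass -big_split/=.
  apply: eq_bigr => j _; rewrite /zt /J/=; have [zj|zj] := eqVneq (z j) 0; last by rewrite addr0.
  by rewrite zj powR0 ?gt_eqF// mulr0 add0r.
have a0 : 0 <= \sum_(j | J j) alpha j by apply: sumr_ge0 => j _; exact: ltW.
have k0 : 0 < d `^ q * w1 * c by rewrite !mulr_gt0// powR_gt0.
apply: (linear_vs_power p1 _ a0 (ltW Fz) k0 (r := q / p)).
  by rewrite divr_ge0// ltW.
move=> t t01; have /andP[t0 t1] := t01.
have zt0 j : 0 <= zt t j by rewrite /zt; case: ifP => // _; exact: ltW.
have zzt j : z j <= zt t j.
  by rewrite /zt; case: ifP => // /Jz ->; exact: ltW.
rewrite -ztE//; apply: le_trans (zmax zt0 _); last first.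
  by rewrite ztE// ltr_wpDr// mulr_ge0// powR_ge0.
have := hc t t01; set G := _ `&` _ => hG.
have GS : G `<=` S by move=> v [].
have mG : measurable (G : set T).
  apply: measurableI; first exact: measurable_sphere.
  rewrite (_ : [set v | _] = (\bigcup_(j in [set j | J j]) [set v | 0 < dotp v (u j)]) `&`
      (\bigcap_(j in [set j | J j]) [set v | dotp v (u j) <= t])).
    apply: measurableI; last first.
      apply: measurable_closed; apply: closed_bigI => j _; exact: closed_dotp_le.
    apply: measurable_open; apply: bigcup_open => j _.
    rewrite (_ : [set v | _] = ~` [set v | dotp v (u j) <= 0]).
      by apply: closed_openC; exact: closed_dotp_le.
    by apply/seteqP; split=> v /=; rewrite ltNge => /negP.
  apply/seteqP; split=> v.
    by move=> [[j Jj vj] h]; split=> [|k Jk]; [exists j|exact: h].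
  by move=> [[j Jj vj] h]; split=> [|k Jk]; [exists j|exact: h].
have mSG : measurable (S `\` G : set T).
  by apply: measurableD => //; exact: measurable_sphere.
have IG : (\int[H]_(v in G) density u w q z v = 0)%E.
  apply: integral0_eq => v [v1 [[j Jj vj] _]].
  exact: density_eq0 (radial_hpoly_eq0 z0 v1 (Jz j Jj) vj).
have IGt : ((d `^ q * w1 * c * t)%:E <= \int[H]_(v in G) density u w q (zt t) v)%E.
  apply: le_trans (integral_density_ge u_pos mw w1_gt0 w1w q0 zt0 mG GS (ltW d0) _).
    rewrite -mulrA EFinM; apply: lee_wpmul2l => //.
    by rewrite lee_fin mulr_ge0 ?powR_ge0// ltW.
  move=> v [v1 [_ vt]]; apply/(radial_hpolyP u_pos zt0 (sphere_neq0 v1) (ltW d0)) => j.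
  rewrite /zt; case: ifPn => [Jj|nJ].
    have [vj|vj] := leP 0 (dotp v (u j)).
      by rewrite (le_trans _ (vt j Jj))// ler_piMl.
    by rewrite (le_trans _ (ltW t0))// mulr_ge0_le0 ?(ltW d0)// ltW.
  have := hd j; rewrite (negbTE nJ); apply: le_trans.
  by rewrite ler_piMr ?(ltW d0)// sphere_dotp_le.
have hz := etrans (esym (PhiE' z0)) (integral_density_split z0 mG GS).
have hzt := etrans (esym (PhiE' zt0)) (integral_density_split zt0 mG GS).
exact: add_le_of_split hz hzt IG IGt (le_integral_density z0 zzt mSG (@subDsetl _ _ _)).
Qed.

End interior_maximizer.

(** * First variation and the cones over the facets *)

Section variation_inequality.
Context (R : realType).

Lemma growth_of_split (x y L : R) (a b a' b' : \bar R) : (0 <= a)%E -> (0 <= b)%E ->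
  x%:E = (a + b)%E -> y%:E = (a' + b')%E -> (L%:E * a <= a')%E -> (b <= b')%E ->
  ((L - 1)%:E * a <= (y - x)%:E)%E.
Proof.
case: a => [a| |]//; case: b => [b| |]// _ _ [xab] yab La bb.
rewrite -EFinM lee_fin.
have : ((L * a + b)%:E <= y%:E)%E by rewrite yab EFinD leeD// EFinM.
rewrite lee_fin xab; lra.
Qed.

(** To first order in [s] the two sides of the hypothesis are [s * q * g] and [s * q * beta * F];
    the margin [e] absorbs the higher orders. *)
Lemma variation_bound (p q beta e : R) : 0 < p -> 0 < q -> 0 < beta -> 0 < e ->
  exists2 d, 0 < d & forall s F g, 0 < s <= d -> 0 <= F -> 0 <= g ->
    (expR (s * q) - 1) * g <= (1 + beta * (expR (s * p) - 1)) `^ (q / p) * F - F ->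
    g <= (beta + e) * F.
Proof.
move=> p0 q0 b0 e0.
have be0 : 0 < beta + e by rewrite addr_gt0.
have pq0 : 0 < p + q * beta by rewrite addr_gt0// mulr_gt0.
(* For [s] up to this bound, [1 - (p + q * beta) * s >= beta / (beta + e)]. *)
exists (e / ((beta + e) * (p + q * beta))); first by rewrite divr_gt0// mulr_gt0.
move=> s F g /andP[s0 sd] F0 g0 h.
have sp0 : 0 < s * p by rewrite mulr_gt0.
have sqb0 : 0 < q * beta * s by rewrite !mulr_gt0.
have D_ge : beta / (beta + e) <= 1 - (p + q * beta) * s.
  have : (p + q * beta) * s <= (p + q * beta) * (e / ((beta + e) * (p + q * beta))).
    by rewrite ler_wpM2l// ltW.
  have -> : (p + q * beta) * (e / ((beta + e) * (p + q * beta))) = 1 - beta / (beta + e).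
    by field; rewrite !gt_eqF.
  by rewrite lerBrDr => h2; rewrite lerBrDr addrC.
have D0 : 0 < 1 - (p + q * beta) * s by apply: lt_le_trans D_ge; rewrite divr_gt0.
have sp1 : s * p < 1.
  have : (p + q * beta) * s = s * p + q * beta * s by ring.
  by move=> E; move: D0; rewrite E; move: sqb0; move: (q * beta * s) => X X0; lra.
have h1 : expR (s * p) - 1 <= s * p / (1 - s * p).
  have E : (1 - s * p)^-1 = 1 + s * p / (1 - s * p) by field; rewrite subr_eq0 gt_eqF.
  by rewrite lerBlDl -E; exact: expR_le_inv.
have h0 : 0 <= expR (s * p) - 1 by have := expR_ge1Dx (s * p); lra.
set x := beta * (expR (s * p) - 1) in h.
have x0 : 0 <= x by rewrite mulr_ge0// ltW.
have qp0 : 0 <= q / p by rewrite divr_ge0// ltW.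
have P1 := powR_le_expR x0 qp0.
(* [y] bounds the exponent of [(1 + x) ^ (q / p) <= exp y <= 1 / (1 - y)], and this last fraction is
   explicit in [s]. *)
pose y := q * beta * s / (1 - s * p).
have xy : x * (q / p) <= y.
  have -> : y = beta * (s * p / (1 - s * p)) * (q / p).
    by rewrite /y; field; rewrite subr_eq0 !gt_eqF.
  by rewrite ler_wpM2r// ler_wpM2l// ltW.
have spp : 0 < 1 - s * p by rewrite subr_gt0.
have y1 : y < 1.
  rewrite /y ltr_pdivrMr// mul1r; move: D0.
  have -> : (p + q * beta) * s = s * p + q * beta * s by ring.
  lra.
have P2 : expR (x * (q / p)) <= expR y by rewrite ler_expR.
have P3 := expR_le_inv y1.
have P4 : (1 - y)^-1 <= 1 + q * s * (beta + e).
  have -> : (1 - y)^-1 = 1 + q * beta * s / (1 - (p + q * beta) * s).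
    have D' : 1 - s * p - q * beta * s != 0.
      by rewrite gt_eqF//; move: D0; rewrite mulrDl (mulrC p); lra.
    have D2 : 1 - (p + q * beta) * s != 0 by rewrite gt_eqF.
    have D3 : 1 - s * p != 0 by rewrite gt_eqF.
    have D4 : 1 - y != 0 by rewrite subr_eq0 gt_eqF.
    apply: (mulfI D4); rewrite mulfV// /y.
    by field; rewrite D2 D3.
  rewrite lerD2l ler_pdivrMr//.
  have -> : q * beta * s = q * s * (beta + e) * (beta / (beta + e)).
    by field; rewrite gt_eqF.
  by rewrite ler_wpM2l// !mulr_ge0// ltW.
have P : (1 + x) `^ (q / p) <= 1 + q * s * (beta + e).
  exact: le_trans P1 (le_trans P2 (le_trans P3 P4)).
have lower : s * q * g <= (expR (s * q) - 1) * g.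
  by rewrite ler_wpM2r//; have := expR_ge1Dx (s * q); lra.
have upper : (1 + x) `^ (q / p) * F - F <= q * s * (beta + e) * F.
  by have := ler_wpM2r F0 P; rewrite mulrDl mul1r; lra.
have := le_trans lower (le_trans h upper).
have -> : q * s * (beta + e) * F = s * q * ((beta + e) * F) by ring.
by rewrite ler_pM2l// mulr_gt0.
Qed.

End variation_inequality.

Section first_variation.
Context (R : realType) (m : nat).
Local Notation n := m.+2.
Local Notation S := (sphere R n).
Local Notation T := (caratheodory_type (@hausdorff R n m.+1)).
Local Notation H := (hausdorff_measure R n m.+1).

Lemma measurable_continuous (f : 'rV[R]_n -> R) : continuous f ->
  measurable_fun (S : set T) (f : T -> R).
Proof.
move=> cf mS; apply: (measurability _ (RGenCInfty.measurableE R)) => //.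
move=> /= _ [_ [t ->] <-].
rewrite (_ : _ `&` _ = S `&` [set v | t <= f v]); last first.
  by apply/seteqP; split=> v [v1] /=; rewrite in_itv/= andbT.
apply: measurable_closed; apply: closedI; first exact: closed_sphere.
by apply: (@closed_comp _ _ f [set x | t <= x]) => [v _|]; [exact: cf|exact: closed_ge].
Qed.

Context (N : nat) (u : 'I_N -> 'rV[R]_n).
Hypothesis u1 : forall i, S (u i).
Hypothesis u_inj : injective u.
Hypothesis u_pos : forall v, v != 0 -> exists i, 0 < dotp v (u i).
Implicit Types z : 'I_N -> R.
Local Notation rho z := (radial (hpoly u z)).

(** Directions whose boundary point keeps a relative slack in all constraints except the [i]-th: for
    [c = exp (- s)] they can be lengthened by [exp s] without violating the others. *)
Definition partial_cone z (c : R) i := S `&`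
  [set v | forall j, j != i -> rho z v * dotp v (u j) <= c * z j].

(** Directions that leave the polytope through the relative interior of its [i]-th facet. *)
Definition strict_cone z i := S `&`
  [set v | forall j, j != i -> rho z v * dotp v (u j) < z j].

(** A finite union of great subspheres containing, for positive [z], every direction in which two
    constraints become tight at once. *)
Definition ties z := S `&` [set v | exists i j, i != j /\
  dotp v ((z i)^-1 *: u i - (z j)^-1 *: u j) = 0].

Let mprod z j : (forall i, 0 <= z i) ->
  measurable_fun (S : set T) (fun v : T => rho z v * dotp v (u j)).
Proof.
move=> z0; exact: (measurable_funM (measurable_radial u_pos z0)
  (measurable_continuous (@continuous_dotp R n (u j)))).
Qed.

Lemma measurable_partial_cone z c i : (forall i, 0 <= z i) ->
  measurable (partial_cone z c i : set T).
Proof.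
move=> z0; have mS := @measurable_sphere R m.
rewrite (_ : partial_cone z c i = S `&` \bigcap_(j in [set j | j != i])
    ((S : set T) `&` (fun v : T => rho z v * dotp v (u j)) @^-1` `]-oo, c * z j])).
  apply: measurableI => //; apply: fin_bigcap_measurable; first exact: finite_finset.
  by move=> j _; have := mprod j z0 mS; apply; exact: measurable_itv.
apply/seteqP; split=> v [v1 h]; split => // j ji; have := h j ji.
  by split => //=; rewrite in_itv.
by case=> _ /=; rewrite in_itv.
Qed.

Lemma measurable_strict_cone z i : (forall i, 0 <= z i) ->
  measurable (strict_cone z i : set T).
Proof.
move=> z0; have mS := @measurable_sphere R m.
rewrite (_ : strict_cone z i = S `&` \bigcap_(j in [set j | j != i])
    ((S : set T) `&` (fun v : T => rho z v * dotp v (u j)) @^-1` `]-oo, z j[)).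
  apply: measurableI => //; apply: fin_bigcap_measurable; first exact: finite_finset.
  by move=> j _; have := mprod j z0 mS; apply; exact: measurable_itv.
apply/seteqP; split=> v [v1 h]; split => // j ji; have := h j ji.
  by split => //=; rewrite in_itv.
by case=> _ /=; rewrite in_itv.
Qed.

Lemma strict_cone_tight z i v : (forall i, 0 <= z i) -> strict_cone z i v ->
  rho z v * dotp v (u i) = z i.
Proof.
move=> z0 [v1 h]; have [j hj] := radial_hpoly_tight u1 u_pos z0 v1.
have [<-//|ji] := eqVneq j i.
by have := h j ji; rewrite hj ltxx.
Qed.

Lemma strict_cone_disjoint z i j v : (forall i, 0 <= z i) ->
  strict_cone z i v -> strict_cone z j v -> i = j.
Proof.
move=> z0 iv [_ jv]; apply/eqP; apply: contrapT => /negP ij.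
by have := jv i ij; rewrite (strict_cone_tight z0 iv) ltxx.
Qed.

Lemma strict_cone_cover z v : (forall i, 0 < z i) -> S v -> ~ ties z v ->
  exists i, strict_cone z i v.
Proof.
move=> z0 v1 nt; have z0' i : 0 <= z i by exact: ltW.
have [i hi] := radial_hpoly_tight u1 u_pos z0' v1; exists i; split => // j ji.
rewrite lt_neqAle radial_hpoly_le ?sphere_neq0// andbT; apply/eqP => hj.
apply: nt; split => //; exists i, j; split; first by rewrite eq_sym.
have r0 : rho z v != 0 by rewrite gt_eqF// radial_hpoly_gt0.
apply: (mulfI r0); rewrite dotpBr !dotpZr mulrBr !(mulrCA (rho z v)) hi hj.
by rewrite !mulVf ?gt_eqF// subrr mulr0.
Qed.

(** The normals of these subspheres are nonzero: equality of [u i / z i] and [u j / z j] forces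
    [z i = z j] by comparing norms, then [u i = u j]. *)
Lemma ties_null z : (forall i, 0 < z i) -> hausdorff m.+1 (ties z) = 0%E.
Proof.
move=> z0; pose f (ij : 'I_N * 'I_N) := (z ij.1)^-1 *: u ij.1 - (z ij.2)^-1 *: u ij.2.
pose r := [seq ij <- enum {: 'I_N * 'I_N} | ij.1 != ij.2].
apply/eqP; rewrite eq_le hausdorff_ge0 andbT.
apply: (@le_trans _ _ (hausdorff m.+1
    [set v | exists2 ij, ij \in r & (S `&` [set v | dotp v (f ij) = 0]) v])).
  apply: le_hausdorff => v [v1 [i [j [ij vij]]]]; exists (i, j) => //.
  by rewrite mem_filter mem_enum ij.
apply: (le_trans (hausdorff_finite_subadditive _ _ _)).
rewrite big_seq_cond big1// => -[i j] /andP[]; rewrite mem_filter /= => /andP[ij _] _.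
apply: hausdorff_great_sphere; rewrite /f/= subr_eq0; apply: contra ij => /eqP uij.
have zij : (z i)^-1 = (z j)^-1.
  have := congr1 (@enorm R n) uij; rewrite !enormZ (u1 i : enorm _ = 1) (u1 j : enorm _ = 1).
  by rewrite !mulr1 !ger0_norm// invr_ge0 ltW.
apply/eqP/u_inj; move: uij; rewrite zij; apply: scalerI.
by rewrite invr_eq0 gt_eqF.
Qed.

End first_variation.

(** * Facet integrals at the maximiser *)

Lemma real_of_split (R : realType) (x : R) (a b : \bar R) : (0 <= a)%E -> (0 <= b)%E ->
  x%:E = (a + b)%E -> exists2 g : R, a = g%:E & 0 <= g.
Proof. by case: a => [a| |]//; case: b => [b| |]// a0 _ _; exists a; rewrite -?lee_fin. Qed.

Section balanced_polytope.
Context (R : realType) (m : nat).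
Local Notation n := m.+2.
Local Notation S := (sphere R n).
Local Notation T := (caratheodory_type (@hausdorff R n m.+1)).
Local Notation H := (hausdorff_measure R n m.+1).
Context (N : nat) (u : 'I_N -> 'rV[R]_n).
Hypothesis u1 : forall i, S (u i).
Hypothesis u_inj : injective u.
Hypothesis u_pos : forall v, v != 0 -> exists i, 0 < dotp v (u i).
Context (w : 'rV[R]_n -> R) (w1 w2 q : R).
Hypothesis mw : measurable_fun (S : set T) (w : T -> R).
Hypothesis w1_gt0 : 0 < w1.
Hypothesis w1w : forall v, S v -> w1 <= w v.
Hypothesis ww2 : forall v, S v -> w v <= w2.
Hypothesis q0 : 0 < q.
Context (p : R) (alpha : 'I_N -> R).
Hypothesis alpha0 : forall i, 0 < alpha i.
Hypothesis p1 : 1 < p.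
Local Notation rho z := (radial (hpoly u z)).
Local Notation F := (Phi u w q).

Let p0 : 0 < p. Proof. exact: lt_trans p1. Qed.

Let PhiE' z : (forall i, 0 <= z i) -> (\int[H]_(v in S) density u w q z v)%E = (F z)%:E.
Proof. exact: (PhiE u1 u_pos mw w1_gt0 w1w ww2 q0). Qed.

Let mdens z (D : set T) : (forall i, 0 <= z i) -> D `<=` S ->
  measurable_fun D (density u w q z).
Proof.
move=> z0 DS; apply: (measurable_funS _ DS (measurable_density u_pos q mw z0)).
exact: measurable_sphere.
Qed.

Let dens_ge0 z v : S v -> (0 <= density u w q z v)%E.
Proof. exact: (density_ge0 u q w1_gt0 w1w z). Qed.

Let int_ge0 z (D : set T) : D `<=` S -> (0 <= \int[H]_(v in D) density u w q z v)%E.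
Proof. by move=> DS; apply: integral_ge0 => v /DS; exact: dens_ge0. Qed.

Section at_maximizer.
Context (z : 'I_N -> R).
Hypothesis z0 : forall i, 0 < z i.
Hypothesis mz : mass p alpha z = 1.
Hypothesis Fz : 0 < F z.
Hypothesis zmax : forall z', (forall i, 0 <= z' i) -> 0 < mass p alpha z' ->
  F z' <= mass p alpha z' `^ (q / p) * F z.

Let z0' i : 0 <= z i. Proof. exact: ltW. Qed.

Let grow i (s : R) j := if j == i then expR s * z j else z j.

Let grow_ge0 i s j : 0 <= grow i s j.
Proof. by rewrite /grow; case: ifP => // _; rewrite mulr_ge0 ?expR_ge0. Qed.

Let cone_sub c i : partial_cone u z c i `<=` S. Proof. by move=> v []. Qed.

Let mcone c i : measurable (partial_cone u z c i : set T).
Proof. exact: measurable_partial_cone. Qed.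

(** On the partial cone the slack of the other constraints lets the radius grow by the full factor
    [exp s]. *)
Let density_grow i s v : 0 < s -> partial_cone u z (expR (- s)) i v ->
  ((expR (s * q))%:E * density u w q z v <= density u w q (grow i s) v)%E.
Proof.
move=> s0 [v1 h]; have v0 := sphere_neq0 v1.
have r0 := radial_hpoly_ge0 u_pos z0' v0.
have le_rho : expR s * rho z v <= rho (grow i s) v.
  apply/(radial_hpolyP u_pos (grow_ge0 i s) v0); first by rewrite mulr_ge0 ?expR_ge0.
  move=> j; rewrite -mulrA /grow; have [ji|ji] := eqVneq j i.
    by rewrite ler_wpM2l ?expR_ge0// radial_hpoly_le.
  have := ler_wpM2l (expR_ge0 s) (h j ji).
  by rewrite [X in _ <= X -> _]mulrA -expRD subrr expR0 mul1r.
rewrite /density -EFinM lee_fin mulrA ler_wpM2r//.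
  by rewrite (le_trans _ (w1w v1))// ltW.
rewrite expRM -powRM ?expR_ge0//; apply: le_powR => //; first exact: ltW.
by rewrite mulr_ge0 ?expR_ge0.
Qed.

(** The gain comes from the partial cone; on the rest of the sphere the density does not
    decrease. *)
Let growth i s : 0 < s ->
  ((expR (s * q) - 1)%:E * \int[H]_(v in partial_cone u z (expR (- s)) i) density u w q z v <=
    (F (grow i s) - F z)%:E)%E.
Proof.
move=> s0; set G := partial_cone _ _ _ _.
have mG : measurable (G : set T) := mcone _ _.
have GS : G `<=` S := @cone_sub _ _.
have mSG : measurable (S `\` G : set T).
  by apply: measurableD => //; exact: measurable_sphere.
have SGS : S `\` G `<=` S := @subDsetl _ _ _.
have hz := etrans (esym (PhiE' z0'))
  (integral_density_split u_pos q mw w1_gt0 w1w z0' mG GS).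
have hg := etrans (esym (PhiE' (grow_ge0 i s)))
  (integral_density_split u_pos q mw w1_gt0 w1w (grow_ge0 i s) mG GS).
have zg j : z j <= grow i s j.
  rewrite /grow; case: ifP => // _; rewrite ler_peMl//.
  by rewrite (le_trans _ (expR_ge1Dx _))// lerDl ltW.
have bb := le_integral_density u_pos mw w1_gt0 w1w q0 z0' zg mSG SGS.
apply: (growth_of_split (int_ge0 z GS) (int_ge0 z SGS) hz hg _ bb).
have f0 v : G v -> (0 <= density u w q z v)%E by move=> /GS; exact: dens_ge0.
have e1 := @ge0_integralZl_EFin _ _ _ H G mG _ f0 (mdens z0' GS) _ (expR_ge0 (s * q)).
apply: (lee_eq2 e1 (erefl _)).
apply: (@ge0_le_integral _ _ _ H G mG _ _ _ _ (mdens (grow_ge0 i s) GS)).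
- by move=> v /f0 fv; rewrite mule_ge0// lee_fin expR_ge0.
- exact: (measurable_funeM (expR (s * q))%:E (mdens z0' GS)).
- by move=> v; exact: density_grow.
Qed.

Let mass_grow i s : mass p alpha (grow i s) = 1 + alpha i * z i `^ p * (expR (s * p) - 1).
Proof.
have := mz; rewrite /mass (bigD1 i)//= => h.
rewrite (bigD1 i)//= /grow eqxx powRM ?expR_ge0// -expRM.
rewrite [X in _ + X = _](_ : _ = \sum_(j < N | j != i) alpha j * z j `^ p).
  move: h; move: (\sum_(j < N | _) _) => X h.
  have -> : X = 1 - alpha i * z i `^ p by rewrite -h; ring.
  ring.
by apply: eq_bigr => j /negbTE ->.
Qed.

Let beta0 i : 0 < alpha i * z i `^ p. Proof. by rewrite mulr_gt0// powR_gt0. Qed.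

Let strict_sub i : strict_cone u z i `<=` S. Proof. by move=> v []. Qed.

(** Maximality tested on [grow i s] gives, through [growth], [mass_grow] and [variation_bound], the
    estimate up to [e] on partial cones. As [s] decreases to 0 these increase to a set containing
    the strict cone, and monotone convergence concludes. *)
Let strict_cone_le i : (\int[H]_(v in strict_cone u z i) density u w q z v <=
  (alpha i * z i `^ p * F z)%:E)%E.
Proof.
apply/lee_addgt0Pr => e e0.
have eF0 : 0 < e / F z by rewrite divr_gt0.
have [d d0 hd] := variation_bound p0 q0 (beta0 i) eF0.
(* The sequence [s] starts late enough for all its terms to be at most [d]. *)
pose K := Num.trunc d^-1.
pose s k : R := (K + k).+1%:R^-1.
have s0 k : 0 < s k by rewrite invr_gt0.
have sd k : s k <= d.
  rewrite invf_ple ?posrE// (le_trans (ltW (truncnS_gt d^-1)))//.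
  by rewrite ler_nat ltnS leq_addr.
pose G k := partial_cone u z (expR (- s k)) i.
have Gle k : (\int[H]_(v in G k) density u w q z v <=
    ((alpha i * z i `^ p + e / F z) * F z)%:E)%E.
  have mG : measurable (G k : set T) := mcone _ _.
  have GS : G k `<=` S := @cone_sub _ _.
  have hz := etrans (esym (PhiE' z0'))
    (integral_density_split u_pos q mw w1_gt0 w1w z0' mG GS).
  have [g ga g0] := real_of_split (int_ge0 z GS) (int_ge0 z (@subDsetl _ _ _)) hz.
  apply: (lee_eq2 (esym ga) (erefl _)); rewrite lee_fin.
  have skd : 0 < s k <= d by rewrite s0 sd.
  apply: (hd (s k) (F z) g skd (ltW Fz) g0).
  have gr : (expR (s k * q) - 1) * g <= F (grow i (s k)) - F z.
    by rewrite -lee_fin EFinM; apply: (lee_eq2 (congr1 _ ga) (erefl _)) (growth i (s0 k)).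
  apply: (le_trans gr); rewrite lerD2r -mass_grow; apply: zmax => //.
  rewrite mass_grow ltr_wpDr// mulr_ge0 ?(ltW (beta0 i))//.
  by rewrite subr_ge0 (le_trans _ (expR_ge1Dx _))// lerDl mulr_ge0 ?(ltW (s0 k)) ?(ltW p0).
have Gnd : {homo G : a b / (a <= b)%N >-> (a <= b)%O}.
  move=> a b ab; apply/subsetPset => v [v1 h]; split => // j ji.
  apply: (le_trans (h j ji)); rewrite ler_wpM2r// ler_expR lerN2.
  by rewrite lef_pV2 ?posrE// ler_nat ltnS leq_add2l.
have mG k : measurable (G k : set T) := mcone _ _.
have cvg := @ge0_nondecreasing_set_cvg_integral _ T R (G : nat -> set T) (density u w q z) H
  Gnd mG (fun k => mdens z0' (@cone_sub _ _)) (fun k v h => dens_ge0 z (cone_sub h)).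
have UGS : \bigcup_k G k `<=` S by move=> v [k _ []].
have mU : measurable (\bigcup_k G k : set T) by exact: bigcup_measurable.
have TU : strict_cone u z i `<=` \bigcup_k G k.
  move=> v [v1 h]; have v0 := sphere_neq0 v1.
  (* Relative slacks at [v]; once [s <= r], the bound [1 - s <= exp (- s)] puts [v] in the partial
     cone. *)
  have gap j : 0 < (if j == i then 1 else (z j - rho z v * dotp v (u j)) / z j).
    by case: eqVneq => // ji; rewrite divr_gt0// subr_gt0 h.
  have [r r0 hr] := exists_pos_lb gap.
  exists (Num.trunc r^-1) => //; split => // j ji.
  have := hr j; rewrite (negbTE ji) ler_pdivlMr// => hrj.
  have sr : s (Num.trunc r^-1) <= r.
    rewrite invf_ple ?posrE// (le_trans (ltW (truncnS_gt r^-1)))//.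
    by rewrite ler_nat ltnS leq_addl.
  have : (1 - s (Num.trunc r^-1)) * z j <= expR (- s (Num.trunc r^-1)) * z j.
    by rewrite ler_wpM2r// expR_ge1Dx.
  apply: le_trans.
  have := ler_wpM2r (z0' j) sr; rewrite mulrBl mul1r; lra.
apply: (@le_trans _ _ (\int[H]_(v in \bigcup_k G k) density u w q z v)%E).
  apply: ge0_subset_integral => //.
  - exact: measurable_strict_cone.
  - exact: mdens.
  - by move=> v /UGS; exact: dens_ge0.
have -> : ((alpha i * z i `^ p * F z)%:E + e%:E =
    ((alpha i * z i `^ p + e / F z) * F z)%:E)%E.
  by rewrite -EFinD mulrDl divfK// gt_eqF.
rewrite -(cvg_lim (@ereal_hausdorff R) cvg); apply: lime_le; first by apply/cvg_ex; eexists; exact: cvg.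
by apply: nearW => k; exact: Gle.
Qed.

(** The strict cones are disjoint and cover the sphere up to the null set of ties. *)
Let strict_cones_total :
  ((F z)%:E <= \sum_(i < N) \int[H]_(v in strict_cone u z i) density u w q z v)%E.
Proof.
have mS := @measurable_sphere R m.
have tn := ties_null u1 u_inj z0.
have mN := measurable_null tn.
pose U := \big[setU/set0]_(i <- index_enum 'I_N) (strict_cone u z i : set T).
have UE v : U v <-> exists i, strict_cone u z i v.
  rewrite /U -bigcup_seq; split=> [[i _ iv]|[i iv]]; first by exists i.
  by exists i => //=; exact: mem_index_enum.
have US : U `<=` S by move=> v /UE[i []].
have mT i : measurable (strict_cone u z i : set T) by exact: measurable_strict_cone.
have mU : measurable U by apply: bigsetU_measurable.
have tr : trivIset [set` index_enum 'I_N] (fun i => strict_cone u z i : set T).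
  by move=> i j _ _ [v [iv jv]]; exact: (strict_cone_disjoint u1 u_pos z0' iv jv).
have f0 v : U v -> (0 <= density u w q z v)%E by move=> /US; exact: dens_ge0.
have e1 := @ge0_integral_bigsetU _ _ _ H _ (fun i => strict_cone u z i : set T)
  (density u w q z) (index_enum 'I_N) mT (index_enum_uniq _) tr (mdens z0' US) f0.
have e2 := @ge0_negligible_integral _ _ _ H S (ties u z) _ mN mS (mdens z0' (@subset_refl _ S))
  (@dens_ge0 z) tn.
apply: (lee_eq2 (etrans (esym e2) (PhiE' z0')) e1).
apply: ge0_subset_integral => //.
- by apply: measurableD.
- exact: mdens.
- by move=> v [v1 nv]; apply/UE; exact: (strict_cone_cover u1 u_pos z0 v1 nv).
Qed.

(** The upper bounds add up to [F z], because the mass is 1, and the integrals to at least [F z]; so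
    each upper bound is attained and one-sided variations suffice. *)
Lemma strict_cone_integral i : (\int[H]_(v in strict_cone u z i) density u w q z v =
  (alpha i * z i `^ p * F z)%:E)%E.
Proof.
have fin j : exists g : R,
    (\int[H]_(v in strict_cone u z j) density u w q z v)%E = g%:E /\
    g <= alpha j * z j `^ p * F z.
  have := int_ge0 z (@strict_sub j); have := strict_cone_le j.
  by case: (integral _ _ _) => [g| |]// gF _; exists g.
have [g hg] := choice fin.
have tot : F z <= \sum_j g j.
  rewrite -lee_fin -sumEFin; apply: (lee_eq2 (erefl _) _ strict_cones_total).
  by apply: eq_bigr => j _; have [] := hg j.
have [gi gle] := hg i; apply: (etrans gi); congr (_%:E).
apply/eqP; rewrite eq_le gle/=.
have sumF : \sum_j alpha j * z j `^ p * F z = F z by rewrite -mulr_suml -/(mass p alpha z) mz mul1r.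
have : \sum_j alpha j * z j `^ p * F z <= \sum_j g j by rewrite sumF.
rewrite (bigD1 i)//= [leRHS](bigD1 i)//=.
have : \sum_(j < N | j != i) g j <= \sum_(j < N | j != i) alpha j * z j `^ p * F z.
  by apply: ler_sum => j _; have [] := hg j.
move: (\sum_(j < N | _) _) (\sum_(j < N | _) _) => X Y; lra.
Qed.

End at_maximizer.

(** Dilating the maximiser by [t] keeps its cones and scales the sides by [t ^ q] and [t ^ p]; since
    [p != q] one can solve [t ^ (q - p) = c / F z]. *)
Lemma exists_balanced (c : R) : 0 < c -> p != q -> exists2 z : 'I_N -> R, (forall i, 0 < z i) &
  forall i, (\int[H]_(v in strict_cone u z i) density u w q z v =
    (c * (alpha i * z i `^ p))%:E)%E.
Proof.
move=> c0 pq.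
have [z [z0' mz Fz zmax]] := exists_Phi_maximizer u1 u_pos mw w1_gt0 w1w ww2 q0 alpha0 p1.
have z0 := maximizer_gt0 u1 u_pos mw w1_gt0 w1w ww2 q0 alpha0 p1 z0' mz Fz zmax.
have key := strict_cone_integral z0 mz Fz zmax.
have qp : q - p != 0 by rewrite subr_eq0 eq_sym.
pose t := (c / F z) `^ (q - p)^-1.
have cF : 0 < c / F z by rewrite divr_gt0.
have t0 : 0 < t by exact: powR_gt0.
have tq : t `^ q * F z = c * t `^ p.
  have -> : t `^ q = t `^ p * (c / F z).
    rewrite -(powRVK (ltW cF) qp) -/t -powRD; first by rewrite addrC subrK.
    by rewrite (gt_eqF t0) implybT.
  by rewrite -mulrA divfK ?gt_eqF// mulrC.
exists (fun i => t * z i); first by move=> i; rewrite mulr_gt0.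
move=> i.
have -> : strict_cone u (fun i => t * z i) i = strict_cone u z i.
  apply/seteqP; split=> v [v1 h]; split => // j ji; have := h j ji;
    by rewrite radial_hpoly_scale ?sphere_neq0// -mulrA ltr_pM2l.
have mT : measurable (strict_cone u z i : set T) by exact: measurable_strict_cone.
have TS : strict_cone u z i `<=` S by move=> v [].
apply: etrans (integral_density_scale u_pos q mw w1_gt0 w1w mT TS z0' t0) _.
apply: etrans (congr1 _ (key i)) _; rewrite -EFinM; congr (_%:E).
by rewrite powRM ?(ltW t0)// mulrCA tq; ring.
Qed.

End balanced_polytope.

(** * Bounds and measurability of the weight given by the star body *)

Section star_bodies.
Context (R : realType) (m : nat).
Local Notation n := m.+2.
Local Notation S := (sphere R n).
Local Notation T := (caratheodory_type (@hausdorff R n m.+1)).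

(** The exponent, [n - q] in the application, may have either sign, which decides whether the power
    increases or decreases. *)
Lemma powR_bounds (a r b : R) : 0 < r -> r <= b ->
  exists w1 w2 : R, 0 < w1 /\ forall x, r <= x <= b -> w1 <= x `^ a <= w2.
Proof.
move=> r0 rb; have b0 : 0 < b by exact: lt_le_trans rb.
have [a0|a0] := leP 0 a.
  exists (r `^ a), (b `^ a); split; first exact: powR_gt0.
  move=> x /andP[rx xb]; rewrite !le_powR//; first exact: ltW.
  by rewrite (le_trans _ rx)// ltW.
have Na0 : 0 <= - a by rewrite oppr_ge0 ltW.
exists (b `^ (- a))^-1, (r `^ (- a))^-1; split; first by rewrite invr_gt0 powR_gt0.
move=> x /andP[rx xb]; have x0 : 0 < x by exact: lt_le_trans rx.
have -> : x `^ a = (x `^ (- a))^-1 by rewrite powRN invrK.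
by rewrite !lef_pV2 ?posrE ?powR_gt0// !le_powR// ltW.
Qed.

Lemma star_body_radial_bounds (Q : set 'rV[R]_n) : star_body_o Q ->
  exists r b : R, [/\ 0 < r, r <= b & forall v, S v -> r <= radial Q v <= b].
Proof.
move=> [cQ _ /interior_enorm[r0 r0_gt0 hr] _].
have [b b0 hb] := compact_enorm_bounded cQ.
have h v : S v -> r0 / 2 <= radial Q v <= b.
  move=> v1.
  have ub : ubound [set t : R | 0 <= t /\ Q (t *: v)] b.
    move=> t [t0 /hb]; rewrite enormZ (v1 : enorm v = 1) mulr1; apply: le_trans.
    exact: ler_norm.
  have r2 : [set t : R | 0 <= t /\ Q (t *: v)] (r0 / 2).
    split; first by rewrite divr_ge0// ltW.
    apply: hr; rewrite subr0 enormZ (v1 : enorm v = 1) mulr1 gtr0_norm ?divr_gt0//.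
    by rewrite ltr_pdivrMr//; lra.
  apply/andP; split; first by apply: ub_le_sup => //; exists b.
  by apply: ge_sup => //; exists (r0 / 2).
have [a a1 _] := @exists_orthogonal R n 0 isT.
exists (r0 / 2), b; split => //; first by rewrite divr_gt0.
by have /andP[h1 h2] := h a a1; exact: le_trans h2.
Qed.

(** Continuity on the sphere makes the superlevel sets within it closed. *)
Lemma measurable_star_radial (Q : set 'rV[R]_n) : star_body_o Q ->
  measurable_fun (S : set T) (radial Q : T -> R).
Proof.
move=> sQ; have [r [b [r0 _ hr]]] := star_body_radial_bounds sQ.
case: sQ => _ _ _ cQ.
apply: measurable_closed_superlevel => [t t0|v v1]; last first.
  by have /andP[h _] := hr v v1; rewrite (le_trans _ h)// ltW.
have /continuous_closedP/(_ [set x | t <= x] (@closed_ge _ t)) := cQ.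
move=> /closed_subspaceP[V cV VE].
rewrite (_ : _ `&` _ = V `&` S); first by apply: closedI => //; exact: closed_sphere.
by rewrite VE setIC.
Qed.

End star_bodies.

(** * Dual curvature measure of the polytope *)

Section polytope_curvature.
Context (R : realType) (m : nat).
Local Notation n := m.+2.
Local Notation S := (sphere R n).
Local Notation T := (caratheodory_type (@hausdorff R n m.+1)).
Local Notation H := (hausdorff_measure R n m.+1).
Context (N : nat) (u : 'I_N -> 'rV[R]_n).
Hypothesis u1 : forall i, S (u i).
Hypothesis u_inj : injective u.
Hypothesis u_pos : forall v, v != 0 -> exists i, 0 < dotp v (u i).
Context (z : 'I_N -> R).
Hypothesis z0 : forall i, 0 < z i.
Local Notation P := (hpoly u z).

Let z0' i : 0 <= z i. Proof. exact: ltW. Qed.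

Let P0 : P 0. Proof. by move=> i; rewrite dotp0l. Qed.

Lemma hpoly_dotp_le_support v x : P x -> dotp x v <= support_fun P v.
Proof.
move=> Px; apply: ub_le_sup; last by exists x.
have [b b0 hb] := hpoly_bounded u1 u_pos; exists ((b * \sum_i z i) * enorm v) => _ [y Py <-].
apply: (le_trans (cauchy_schwarz _ _)); rewrite ler_wpM2r ?enorm_ge0//.
exact: hb.
Qed.

(** A supremum of linear functions has open strict superlevel sets. *)
Lemma measurable_support_fun :
  measurable_fun [set: borelE R n] (support_fun P : borelE R n -> R).
Proof.
move=> mT; apply: (measurability _ (RGenOInfty.measurableE R)) => //.
move=> /= _ [_ [t ->] <-]; rewrite setTI.
rewrite (_ : _ @^-1` _ = \bigcup_(x in P) ~` [set v | dotp v x <= t]).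
  apply: borelE_open; apply: bigcup_open => x _; apply: closed_openC.
  exact: closed_dotp_le.
apply/seteqP; split=> v /=.
  rewrite in_itv/= andbT => /sup_gt[|_ [x Px <-] tx]; first by exists (dotp 0 v), 0.
  by exists x => //=; apply/negP; rewrite -ltNge dotpC.
move=> [x Px /negP]; rewrite -ltNge in_itv/= andbT dotpC => h.
by apply: lt_le_trans h _; exact: hpoly_dotp_le_support.
Qed.

(** A direction in the strict cone reaches the hyperplane of the [i]-th constraint, so this
    constraint is not redundant and [z i] is the support value. *)
Lemma strict_cone_support i v : strict_cone u z i v ->
  P (radial P v *: v) /\ dotp (radial P v *: v) (u i) = support_fun P (u i) /\
  support_fun P (u i) = z i.
Proof.
move=> vi; have t := strict_cone_tight u1 u_pos z0' vi; case: vi => v1 _.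
have Px : P (radial P v *: v).
  by move=> j; rewrite dotpZl radial_hpoly_le// sphere_neq0.
have sE : support_fun P (u i) = z i.
  apply/eqP; rewrite eq_le; apply/andP; split.
    by apply: ge_sup => [|_ [y Py <-]]; [exists (dotp 0 (u i)), 0|exact: Py].
  by rewrite -[leLHS]t -dotpZl hpoly_dotp_le_support.
by split => //; rewrite sE dotpZl.
Qed.

(* Near a relative interior point of a facet the polytope is a half-space, so its normal there is
   unique. *)
Lemma strict_cone_normal i v v' : strict_cone u z i v -> S v' ->
  face P v' (radial P v *: v) -> v' = u i.
Proof.
move=> vi v'1 [Px xv']; have t := strict_cone_tight u1 u_pos z0' vi.
set x := radial P v *: v in Px xv'.
have xi : dotp x (u i) = z i by rewrite dotpZl.
have xj j : j != i -> dotp x (u j) < z j by rewrite dotpZl; case: vi => _; apply.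
clearbody x.
have gap j : 0 < (if j == i then 1 else z j - dotp x (u j)).
  by case: eqVneq => // ji; rewrite subr_gt0 xj.
have [r r0 hr] := exists_pos_lb gap.
(* A short move from [x] in a direction that does not increase the [i]-th constraint stays in the
   polytope, so it cannot increase [dotp _ v'], maximal at [x]. *)
have dir d : enorm d <= 2 -> dotp d (u i) <= 0 -> dotp d v' <= 0.
  move=> d2 di.
  have Pd : P (x + (r / 2) *: d).
    move=> j; rewrite dotpDl dotpZl; have [->|ji] := eqVneq j i.
      by rewrite xi gerDl mulr_ge0_le0// divr_ge0// ltW.
    have := hr j; rewrite (negbTE ji) => hrj.
    have dj : dotp d (u j) <= 2.
      by rewrite (le_trans (cauchy_schwarz _ _))// (u1 j : enorm _ = 1) mulr1.
    have r2 : 0 <= r / 2 by rewrite divr_ge0// ltW.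
    have := ler_wpM2l r2 dj; rewrite divfK//; lra.
  have := hpoly_dotp_le_support v' Pd; rewrite -xv' dotpDl dotpZl gerDl.
  by rewrite pmulr_rle0// divr_gt0.
pose c := dotp v' (u i).
have c1 : `|c| <= 1.
  rewrite (le_trans (cauchy_schwarz_abs _ _))// (u1 i : enorm _ = 1).
  by rewrite (v'1 : enorm _ = 1) mulr1.
(* The component of [v'] orthogonal to [u i]; [dir] applied to it gives [dotp d d <= 0]. *)
pose d := v' - c *: u i.
have dui : dotp d (u i) = 0 by rewrite dotpBl dotpZl sphere_dotp// mulr1 subrr.
have d2 : enorm d <= 2.
  rewrite (le_trans (enormB _ _))// enormZ (u1 i : enorm _ = 1) (v'1 : enorm _ = 1).
  by rewrite mulr1; lra.
have dd : dotp d d <= 0.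
  rewrite {2}/d dotpBr dotpZr dui mulr0 subr0; apply: dir => //.
  by rewrite dui.
have d0 : d = 0.
  by apply: dotp_eq0; apply/eqP; rewrite eq_le dd dotp_ge0.
have v'E : v' = c *: u i by apply/eqP; rewrite -subr_eq0 -/d d0.
have c0 : 0 <= c.
  rewrite -oppr_le0 /c dotpC -dotpNl; apply: dir.
    by rewrite enormN (u1 i : enorm _ = 1) ler1n.
  by rewrite dotpNl sphere_dotp// oppr_le0.
have : enorm v' = 1 by [].
rewrite v'E enormZ (u1 i : enorm _ = 1) mulr1 ger0_norm// => ->.
by rewrite scale1r.
Qed.

Context (w : 'rV[R]_n -> R) (w1 q : R).
Hypothesis mw : measurable_fun (S : set T) (w : T -> R).
Hypothesis w1_gt0 : 0 < w1.
Hypothesis w1w : forall v, S v -> w1 <= w v.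

Let mdens (D : set T) : D `<=` S -> measurable_fun D (density u w q z).
Proof.
move=> DS; apply: (measurable_funS _ DS (measurable_density u_pos q mw z0')).
exact: measurable_sphere.
Qed.

Let dens_ge0 v : S v -> (0 <= density u w q z v)%E.
Proof. exact: (density_ge0 u q w1_gt0 w1w z). Qed.

(** Off the ties, the reverse image of [eta] is the union of the strict cones with [u i] in [eta].
    The ties are null, so by completeness the image is measurable whatever [eta] is. *)
Lemma integral_reverse_gauss_image (eta : set 'rV[R]_n) :
  (forall i, exists v, strict_cone u z i v) ->
  (\int[H]_(v in reverse_radial_gauss_image P eta) density u w q z v =
   \sum_(i < N) \int[H]_(v in strict_cone u z i) density u w q z v *
     \d_(u i : borelE R n) eta)%E.
Proof.
move=> ne.
set A := reverse_radial_gauss_image P eta.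
pose r := [seq i <- index_enum 'I_N | u i \in eta].
pose C i : set T := strict_cone u z i.
pose U := \big[setU/set0]_(i <- r) C i.
have UE v : U v <-> exists2 i, eta (u i) & C i v.
  rewrite /U -bigcup_seq; split=> [[i /= + iv]|[i ei iv]].
    by rewrite mem_filter => /andP[/set_mem ei _]; exists i.
  by exists i => //=; rewrite mem_filter mem_index_enum andbT; exact: mem_set.
have US : U `<=` S by move=> v /UE[i _ []].
have AS : A `<=` S by move=> v [].
have UA : U `<=` A.
  move=> v /UE[i ei iv]; split; first by case: iv.
  exists (u i); first by split.
  by have [Px [xs _]] := strict_cone_support iv.
have AU v : A v -> ~ ties u z v -> U v.
  move=> [v1 [v' [ev' v'1] fv']] nt.
  have [i iv] := strict_cone_cover u1 u_pos z0 v1 nt.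
  by apply/UE; exists i => //; rewrite -(strict_cone_normal iv v'1 fv').
have mC i : measurable (C i) by exact: measurable_strict_cone.
have mU : measurable U by exact: bigsetU_measurable.
have tn := ties_null u1 u_inj z0.
have mN := measurable_null tn.
have mA : measurable (A : set T).
  rewrite (_ : A = U `|` (A `&` ties u z)).
    apply: measurableU => //; apply: measurable_null.
    apply/eqP; rewrite eq_le hausdorff_ge0 andbT -tn.
    by apply: le_hausdorff => v [].
  apply/seteqP; split=> [v Av|v [/UA//|[]//]].
  have [tv|ntv] := pselect (ties u z v); [by right|left; exact: AU].
have eA := @ge0_negligible_integral _ _ _ H A (ties u z) _ mN mA (mdens AS)
  (fun v Av => dens_ge0 (AS v Av)) tn.
have eU := @ge0_negligible_integral _ _ _ H U (ties u z) _ mN mU (mdens US)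
  (fun v Uv => dens_ge0 (US v Uv)) tn.
have AUE : A `\` ties u z = U `\` ties u z.
  by apply/seteqP; split=> v [h nt]; split=> //; [exact: AU|exact: UA].
have tr : trivIset [set` r] C.
  by move=> i j _ _ [v [iv jv]]; exact: (strict_cone_disjoint u1 u_pos z0' iv jv).
have ur : uniq r by rewrite filter_uniq// index_enum_uniq.
have eS := @ge0_integral_bigsetU _ _ _ H _ C (density u w q z) r mC ur tr (mdens US)
  (fun v Uv => dens_ge0 (US v Uv)).
apply: etrans eA _; rewrite AUE; apply: etrans (esym eU) _.
apply: etrans eS _; rewrite /r big_filter big_mkcond; apply: eq_bigr => i _.
by rewrite diracE; case: ifP => _; rewrite ?mule1 ?mule0.
Qed.

End polytope_curvature.

(** * Integration against the curvature measure and the solution *)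

(** [nu] is only a set function; it is identified with a finite sum of scaled Dirac measures, for
    which the integral is linear. *)
Lemma integral_weighted_diracs (R : realType) d (X : measurableType d) (N : nat)
    (u : 'I_N -> X) (a : 'I_N -> R) (nu : set X -> \bar R) (D : set X) (f : X -> \bar R) :
  (forall i, 0 <= a i) ->
  (forall A, nu A = \sum_(i < N) (a i)%:E * \d_(u i) A)%E ->
  measurable D -> measurable_fun D f -> (forall x, D x -> (0 <= f x)%E) ->
  (\int[nu]_(x in D) f x = \sum_(i < N) (a i)%:E * (\d_(u i) D * f (u i)))%E.
Proof.
move=> a0 nuE mD mf f0.
case: N u a a0 nuE => [|N] u a a0 nuE.
  rewrite big_ord0 (_ : nu = mzero); last by apply/funext => A; rewrite nuE big_ord0.
  by rewrite integral_measure_zero.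
pose c j : {nonneg R} := NngNum (a0 (inord j : 'I_N.+1)).
pose mm j : {measure set X -> \bar R} := mscale (c j) \d_(u (inord j)).
have -> : nu = msum mm N.+1.
  apply/funext => A; rewrite nuE /msum; apply: eq_bigr => i _.
  by rewrite /mm /= /mscale /= inord_val.
rewrite ge0_integral_measure_sum//; apply: eq_bigr => i _.
by rewrite ge0_integral_mscale//= integral_dirac// inord_val.
Qed.

Theorem theorem1p1 (R : realType) (n : nat) (Q : set 'rV[R]_n) (p q : R)
    (mu : {finite_measure set (borelE R n) -> \bar R}) :
  (2 <= n)%N ->
  star_body_o Q ->
  1 < p -> 0 < q -> p != q ->
  discrete_on_sphere mu ->
  (forall v, sphere R n v -> ~ concentrated_on mu (closed_hemisphere v)) ->
  exists P : set 'rV[R]_n,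
    [/\ polytope P, convex_body_o P &
      forall eta : set (borelE R n), measurable eta ->
        Lp_dual_curvature p q P Q eta = mu eta].
Proof.
case: n Q mu => [|[|m]] Q mu // _ sQ p1 q0 pq dmu hemi.
have [N [u [alpha [u_inj u1 alpha0 u_pos muE]]]] := discrete_on_sphereP dmu hemi.
have [r [b [r0 rb hr]]] := star_body_radial_bounds sQ.
have [w1 [w2 [w1_gt0 hw]]] := powR_bounds (m.+2%:R - q) r0 rb.
pose w v := radial Q v `^ (m.+2%:R - q).
have w1w v : sphere R m.+2 v -> w1 <= w v by move=> /hr/hw/andP[].
have ww2 v : sphere R m.+2 v -> w v <= w2 by move=> /hr/hw/andP[].
have mw := measurableT_comp (measurable_powR (m.+2%:R - q)) (measurable_star_radial sQ).
have n0 : 0 < m.+2%:R :> R by [].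
(* The constant [n] cancels the factor [1 / n] in the dual curvature measure. *)
have [z z0 zE] := exists_balanced u1 u_inj u_pos mw w1_gt0 w1w ww2 q0 alpha0 p1 n0 pq.
(* Every facet is met, since the integral over its cone is positive. *)
have ne i : exists v, strict_cone u z i v.
  apply: contrapT => /forallNP h; have := zE i.
  rewrite (_ : strict_cone u z i = set0); last by rewrite -subset0 => v /h.
  rewrite integral_set0 => -[] /esym/eqP.
  by rewrite gt_eqF// !mulr_gt0// powR_gt0.
exists (hpoly u z); split; [exact: hpoly_polytope|exact: hpoly_convex_body|].
move=> eta meta.
have a0 i : 0 <= alpha i * z i `^ p by rewrite mulr_ge0 ?powR_ge0// ltW.
have dcE (A : set (borelE R m.+2)) : dual_curvature q (hpoly u z) Q A =
    (\sum_(i < N) (alpha i * z i `^ p)%:E * \d_(u i : borelE R m.+2) A)%E.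
  have e1 := integral_reverse_gauss_image u1 u_inj u_pos z0 q mw w1_gt0 w1w A ne.
  apply: etrans (congr1 (fun x => (m.+2%:R^-1)%:E * x)%E e1) _.
  rewrite ge0_sume_distrr; last first.
    by move=> i _; rewrite zE mule_ge0// lee_fin mulr_ge0.
  by apply: eq_bigr => i _; rewrite zE muleA -EFinM mulKf.
have mf : measurable_fun eta
    (fun x : borelE R m.+2 => (support_fun (hpoly u z) x `^ (- p))%:E).
  apply: measurable_funTS; have h := measurableT_comp (measurable_powR (- p))
    (measurable_support_fun u1 u_pos z0).
  exact: (measurableT_comp (@EFin_measurable R setT) h).
have fg0 (x : borelE R m.+2) : eta x -> (0 <= (support_fun (hpoly u z) x `^ (- p))%:E)%E.
  by move=> _; rewrite lee_fin powR_ge0.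
apply: etrans (integral_weighted_diracs a0 dcE meta mf fg0) _.
rewrite muE//; apply: eq_bigr => i _.
(* Here [h(u_i) = z_i], so [h(u_i) ^ (- p)] cancels [z_i ^ p]. *)
have [v iv] := ne i; have [_ [_ ->]] := strict_cone_support u1 u_pos z0 iv.
rewrite [X in (_ * X)%E]muleC muleA -EFinM powRN mulfK//.
by rewrite gt_eqF// powR_gt0.
Qed.
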